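(* In the $K$-tier network model described in the context with noise power $W\ge0$, let $\mathcal U_k=\mathbb E[\log_2(1+\mathrm{SINR}_k)]$ be the average achievable rate of a typical user associated with tier $k$. For $\beta>0$ and $x>0$ let $\sigma_k(\beta)=\beta W/P_k$, $\tau_{j,k}(\beta)=\beta/(M_{j,k}B_{j,k})$, $\varphi_{j,k}(0;\beta)=\frac{\delta_j\tau_{j,k}\,{}_2F_1(1,1-\delta_j;2-\delta_j;-\tau_{j,k})}{1-\delta_j}$, $\varphi_{j,k}(n;\beta)=\frac{\delta_j\tau_{j,k}^n\,{}_2F_1(n+1,n-\delta_j;n+1-\delta_j;-\tau_{j,k})}{n-\delta_j}$ for $n\ge1$ (with $\tau_{j,k}=\tau_{j,k}(\beta)$), $g_{k,n}(x;\beta)=\sum_j\mathcal A_j\lambda_j\Omega_{j,k}^{\delta_j}\varphi_{j,k}(n;\beta)x^{\delta_{j,k}}$, and let $\mathbf Q_{M_k}(x;\beta)$ be the $M_k\times M_k$ lower triangular Toeplitz matrix with zero diagonal and $(p,q)$ entry $g_{k,p-q}(x;\beta)$ for $p>q$. Then $$\mathcal U_k=\frac{1}{\ln2}\frac{\lambda_k}{\mathcal T_k}\sum_{i=0}^{M_k-1}\sum_{m=0}^{M_k-1}\sum_{n=0}^{m}\int_0^{R_k^2}\!\!\int_0^\infty\frac{\pi^{i+1}\sigma_k(\beta)^{m-n}}{(m-n)!\,i!}\frac{x^{\frac{\alpha_k}{2}(m-n)}}{1+\beta}\exp\Big(-\sigma_k(\beta)x^{\alpha_k/2}-\pi g_{k,0}(x;\beta)-\pi\sum_{j=1}^K\lambda_j\Omega_{j,k}^{\delta_j}x^{\delta_{j,k}}\Big)\mathbf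 Q^i_{M_k}(x;\beta)(n+1,1)\,d\beta\,dx,$$ where $\mathbf Q^i(p,q)$ denotes the $(p,q)$ entry of the $i$-th power.
   Context: Network model: $\mathcal K=\{1,\dots,K\}$. In $\mathbb R^2$, tier-$k$ BSs form a homogeneous PPP of intensity $\lambda_k>0$ and users a homogeneous PPP of intensity $\lambda_u>0$, all independent. Tier-$k$ BSs have transmit power $P_k>0$, $M_k\in\mathbb N$ antennas, bias $B_k>0$, path-loss exponent $\alpha_k>2$. $\Omega_k=P_kM_kB_k$, $\delta_k=2/\alpha_k$, $\mathcal V_{j,k}=\mathcal V_j/\mathcal V_k$ for $\mathcal V\in\{P,M,B,\Omega,\delta\}$. Access threshold $\epsilon>0$, $R_k=(\Omega_k/\epsilon)^{1/\alpha_k}$. Association: with $D_k$ the distance from a typical user to its nearest tier-$k$ BS, $\hat\rho_k=\Omega_kD_k^{-\alpha_k}$ if $D_k\le R_k$, else $0$; the user is associated with tier $k$ iff $\hat\rho_k>\hat\rho_j$ for all $j\ne k$, with probability $\mathcal T_k=\pi\lambda_k\int_0^{R_k^2}\exp(-\pi\sum_j\lambda_j\Omega_{j,k}^{\delta_j}r^{\delta_{j,k}})dr$. Activation probability of tier $j$: $\mathcal A_j=1-\exp\big(-\pi\lambda_u\int_0^{R_j^2}\exp(-\pi\sum_l\lambda_l\Omega_{l,j}^{\delta_l}r^{\delta_{l,j}})dr\big)$; active tier-$j$ BSs are modeled as a homogeneous PPP of intensity $\mathcal A_j\lambda_j$. SINR model: conditional on association with tier $k$, the serving distance $X_k$ has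 density $\frac{2\pi\lambda_k}{\mathcal T_k}x\exp(-\pi\sum_j\lambda_j\Omega_{j,k}^{\delta_j}x^{2\delta_{j,k}})$ on $(0,R_k]$; given $X_k$, interferers of tier $j$ are the points of independent homogeneous PPPs of intensity $\mathcal A_j\lambda_j$ outside the disk around the user of radius $\Omega_{j,k}^{1/\alpha_j}X_k^{\alpha_k/\alpha_j}$; the signal gain $\|\mathbf h\|^2\sim\mathrm{Gamma}(M_k,1)$, an interferer of tier $j$ at distance $r$ contributes $P_jVr^{-\alpha_j}$ with $V\sim\mathrm{Exp}(1)$, all fading independent of each other and of the point processes; $I_o$ is the total interference and $\mathrm{SINR}_k=P_k\|\mathbf h\|^2X_k^{-\alpha_k}/(I_o+W)$. ${}_2F_1$ is the Gauss hypergeometric function. *)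

(* Defs.v *)
From HB Require Import structures.
From mathcomp Require Import all_boot all_order all_algebra.
From mathcomp Require Import all_classical all_reals all_analysis.
From mathcomp Require Import measurable_realfun.

Set Implicit Arguments.
Unset Strict Implicit.
Unset Printing Implicit Defensive.

Import Order.TTheory GRing.Theory Num.Def Num.Theory.
Import numFieldNormedType.Exports.

Local Open Scope classical_set_scope.
Local Open Scope ring_scope.

(* Gauss hypergeometric function 2F1 on the real half-line z < 1.      *)
(* Power series on |z| < 1; for z <= -1 its analytic continuation      *)
(* given by Pfaff's transformation                                     *)
(*   2F1(a,b;c;z) = (1-z)^(-a) 2F1(a,c-b;c;z/(z-1))                    *)
(* (z/(z-1) lies in [1/2,1) there, where the series converges).        *)
(* Only values at z = -tau <= 0 are used in the statement.             *)
Section Hypergeometric.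
Context {R : realType}.

Definition rising (a : R) (n : nat) : R := \prod_(i < n) (a + i%:R).

Definition hyp2F1_series (a b c z : R) : R :=
  limn (series (fun n : nat =>
           rising a n * rising b n / (rising c n * n`!%:R) * z ^+ n)).

Definition hyp2F1 (a b c z : R) : R :=
  if `|z| < 1 then hyp2F1_series a b c z
  else if z <= -1 then (1 - z) `^ (- a) * hyp2F1_series a (c - b) c (z / (z - 1))
  else 0 (* z >= 1: not used *).

End Hypergeometric.

Section Network.
Context {R : realType}.
Variables (K : nat) (lam Pw Bb alpha : 'I_K -> R) (Mant : 'I_K -> nat)
          (lam_u eps : R).

Local Notation leb := (@lebesgue_measure R).

Definition Omega (j : 'I_K) : R := Pw j * (Mant j)%:R * Bb j.
Definition delta (j : 'I_K) : R := 2 / alpha j.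
Definition Rad (k : 'I_K) : R := (Omega k / eps) `^ (alpha k)^-1.

Definition assoc_exp (k : 'I_K) (r : R) : R :=
  expR (- (pi * \sum_(j < K) lam j * (Omega j / Omega k) `^ delta j
                               * r `^ (delta j / delta k))).

Definition assoc_int (k : 'I_K) : R :=
  \int[leb]_(r in `[0, Rad k ^+ 2]) assoc_exp k r.

Definition Tassoc (k : 'I_K) : R := pi * lam k * assoc_int k.

Definition Aact (j : 'I_K) : R := 1 - expR (- (pi * lam_u * assoc_int j)).

(* density of the serving distance X_k on (0, R_k] *)
Definition serv_dens (k : 'I_K) (x : R) : R :=
  2 * pi * lam k / Tassoc k * x *
  expR (- (pi * \sum_(j < K) lam j * (Omega j / Omega k) `^ delta j
                               * x `^ (2 * (delta j / delta k)))).

Definition sigmak (W : R) (k : 'I_K) (beta : R) : R := beta * W / Pw k.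

Definition tauf (j k : 'I_K) (beta : R) : R :=
  beta / (((Mant j)%:R / (Mant k)%:R) * (Bb j / Bb k)).

Definition phif (j k : 'I_K) (n : nat) (beta : R) : R :=
  let d := delta j in let t := tauf j k beta in
  if n == 0%N then d * t * hyp2F1 1 (1 - d) (2 - d) (- t) / (1 - d)
  else d * t ^+ n * hyp2F1 (n.+1)%:R (n%:R - d) (n.+1%:R - d) (- t) / (n%:R - d).

Definition gf (k : 'I_K) (n : nat) (x beta : R) : R :=
  \sum_(j < K) Aact j * lam j * (Omega j / Omega k) `^ delta j * phif j k n beta
               * x `^ (delta j / delta k).

(* lower triangular Toeplitz matrix Q_{M_k}(x;beta), of size M_k
   (written (M_k).-1.+1, equal to M_k since M_k >= 1);
   0-based entry (p,q) is g_{k,p-q} for p > q, and 0 otherwise *)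
Definition Qmx (k : 'I_K) (x beta : R) : 'M[R]_((Mant k).-1.+1) :=
  \matrix_(p, q) (if (q < p)%N then gf k (p - q)%N x beta else 0).

(* integrand of the rate formula; the 1-based entry (n+1,1) of Q^i
   is the 0-based entry (n,0) *)
Definition rate_integrand (W : R) (k : 'I_K) (i m n : nat) (x beta : R) : R :=
  pi ^+ i.+1 * sigmak W k beta ^+ (m - n) / ((m - n)`!%:R * i`!%:R)
  * x `^ (alpha k / 2 * (m - n)%:R) / (1 + beta)
  * expR (- sigmak W k beta * x `^ (alpha k / 2) - pi * gf k 0 x beta
          - pi * \sum_(j < K) lam j * (Omega j / Omega k) `^ delta j
                               * x `^ (delta j / delta k))
  * ((Qmx k x beta) ^+ i) (inord n) ord0.

Definition Ioc0 (r : R) : set R := `]0, r].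
Definition Ioo0inf : set R := `]0, +oo[.

Definition rate_formula (W : R) (k : 'I_K) : \bar R :=
  ((ln 2)^-1 * (lam k / Tassoc k))%:E *
  (\sum_(0 <= i < Mant k) \sum_(0 <= m < Mant k) \sum_(0 <= n < m.+1)
     \int[leb]_(x in Ioc0 (Rad k ^+ 2))
       \int[leb]_(beta in Ioo0inf) (rate_integrand W k i m n x beta)%:E)%E.

End Network.

(* Points of the marked process live in (R * R) * R : position (y1,y2) *)
(* in R^2 and fading mark v.                                           *)
Section Probabilistic.
Context {R : realType}.
Local Notation leb := (@lebesgue_measure R).
Local Notation pt := ((R * R) * R)%type.

Definition leb3 : set pt -> \bar R := ((leb \x leb) \x leb)%E.

Definition exp1_dens (v : R) : R := if 0 <= v then expR (- v) else 0.

(* mean measure of a homogeneous PPP of intensity c on R^2 with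
   i.i.d. Exp(1) marks: c * Leb_2 (x) Exp(1) *)
Definition marked_mean (c : R) (B : set pt) : \bar R :=
  (c%:E * \int[leb3]_(z in B) (exp1_dens z.2)%:E)%E.

Definition pois (m : R) (n : nat) : R := m ^+ n / n`!%:R * expR (- m).

Context d (T : measurableType d) (P : probability T R).

Definition is_PPP (N : T -> {measure set pt -> \bar R}) (mu : set pt -> \bar R) :=
  (forall B, measurable B -> measurable_fun setT (fun w => (N w B : \bar R))) /\
  (forall n (Bs : 'I_n -> set pt) (cs : 'I_n -> nat),
     (forall i, measurable (Bs i)) ->
     (forall i, (mu (Bs i) < +oo)%E) ->
     (forall i j, i != j -> Bs i `&` Bs j = set0) ->
     P [set w | forall i, N w (Bs i) = (cs i)%:R%:E] =
       (\prod_(i < n) pois (fine (mu (Bs i))) (cs i))%:E).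

Definition events_of_real (X : T -> R) : set (set T) :=
  [set E | exists2 A : set R, measurable A & E = X @^-1` A].

Definition events_of_pp (N : T -> {measure set pt -> \bar R}) : set (set T) :=
  <<s [set E | exists B : set pt, exists S : set (\bar R),
          [/\ measurable B, measurable S & E = (fun w => N w B) @^-1` S]] >>.

Definition mutually_indep (I : finType) (F : I -> set (set T)) :=
  forall E : I -> set T, (forall i, F i (E i)) ->
    fine (P (\bigcap_(i in setT) E i)) = \prod_(i : I) fine (P (E i)).

End Probabilistic.

(* X : serving distance, H : signal gain ||h||^2, N j : marked PPP of  *)
(* (potentially) interfering active tier-j BSs (positions in R^2 with  *)
(* Exp(1) fading marks); only the points outside the exclusion disk    *)
(* of radius Omega_{j,k}^{1/alpha_j} X^{alpha_k/alpha_j} interfere.    *)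
Section SINR.
Context {R : realType}.
Local Notation pt := ((R * R) * R)%type.
Variables (K : nat) (Pw Bb alpha : 'I_K -> R) (Mant : 'I_K -> nat).
Context d (T : measurableType d) (P : probability T R).

(* distance of the point (position part) to the typical user at 0 *)
Definition pdist (z : pt) : R := Num.sqrt (z.1.1 ^+ 2 + z.1.2 ^+ 2).

Definition excl_radius (j k : 'I_K) (x : R) : R :=
  (Omega Pw Bb Mant j / Omega Pw Bb Mant k) `^ (alpha j)^-1 * x `^ (alpha k / alpha j).

Definition interference (k : 'I_K) (X : T -> R)
    (N : 'I_K -> T -> {measure set pt -> \bar R}) (w : T) : \bar R :=
  (\sum_(j < K)
     \int[N j w]_(z in [set z : pt | (excl_radius j k (X w) < pdist z)%R /\ (0 <= z.2)%R])
        (Pw j * z.2 * pdist z `^ (- alpha j))%:E)%E.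

Definition SINR (W : R) (k : 'I_K) (X H : T -> R)
    (N : 'I_K -> T -> {measure set pt -> \bar R}) (w : T) : R :=
  Pw k * H w * X w `^ (- alpha k) / (fine (interference k X N w) + W).

Definition avg_rate (W : R) (k : 'I_K) (X H : T -> R)
    (N : 'I_K -> T -> {measure set pt -> \bar R}) : \bar R :=
  (\int[P]_w (ln (1 + SINR W k X H N w) / ln 2)%:E)%E.

End SINR.

(* Main.v *)
Require Import Defs.
From HB Require Import structures.
From mathcomp Require Import all_boot all_order all_algebra.
From mathcomp Require Import all_classical all_reals all_analysis.
From mathcomp Require Import measurable_realfun.
From mathcomp Require Import ring lra zify.
Set Implicit Arguments.
Unset Strict Implicit.
Unset Printing Implicit Defensive.
Import Order.TTheory GRing.Theory Num.Def Num.Theory.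
Import numFieldNormedType.Exports.
Local Open Scope classical_set_scope.
Local Open Scope ring_scope.

(** By the layer-cake formula [ln (1 + s) = \int_(b > 0) 1{b < s} / (1 + b)] and
Tonelli, the rate is an integral of the coverage probabilities [P(SINR > b)].
Conditionally on the serving distance [x] and the interference [I], the event
[SINR > b] says that a Gamma([M], 1) variable exceeds [s (I + W)] with
[s = b x^alpha / P], which has probability [\sum_(m < M) y^m / m! e^(-y)] at
[y = s (I + W)].  The binomial formula reduces its mean to the moments
[E((s I)^n / n! e^(-s I))].

The Laplace functional of the marked Poisson processes and polar coordinates give
[E(e^(-t I)) = exp(- \sum_j c_j pi \int_(u >= u_j) y / (1 + y) du)] with
[y = t P_j u^(-alpha_j / 2)].  At [t = s (1 - z)] the left-hand side generates the
moments as power series in [z]; on the right the exponent expands into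
[g_0 - \sum_p g_p z^p], where [g_p] is an integral of [y^p / (1 + y)^(p + 1)],
that is, a hypergeometric value (series for [tau < 1], integration by parts and
Pfaff's transformation in general).  Comparing coefficients up to order [M], and
reading powers of the lower triangular Toeplitz matrix as powers of the polynomial
[\sum_p g_p z^p], yields the formula; it remains to integrate over the law of the
serving distance and to substitute [x^2] for [x].

The interference depends on the random serving distance only through a monotone,
right-continuous radius, so independence is used by freezing that distance at
dyadic approximations from above. *)

(** * Image measures and independence *)

(** The serving distance enters the interference through the domain of integration of a random
    measure. Independence is therefore used only at constant distances, and whatever holds almost
    surely at a fixed distance has to be upgraded to one null set serving all distances; the
    monotonicity of the interference in the distance does this.

    The SINR is built from total functions: [fine] sends an infinite interference to 0, and a zero
    denominator, possible since [W] may vanish, gives the quotient 0. Either default would break the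
    equivalence between [SINR > b] and a lower bound on the fading. So the interference must be
    shown almost surely finite and positive, and both facts are read off its Laplace transform, as
    the transform variable tends to 0 and to infinity.

    The moments are obtained without differentiating the transform. At [s (1 - z)] with
    [0 <= z <= 1/2] it is compared with two polynomials in [z], each up to [O(z^M)]; on this range
    the surviving factor [e^(-s I / 2)] controls the Taylor remainder, and a polynomial that is
    [O(z^M)] has no lower coefficients. *)

Section Transfer.
Local Open Scope ereal_scope.
Context d1 d2 d3 (T1 : measurableType d1) (T2 : measurableType d2)
  (U : measurableType d3) (R : realType).
Variables (m1 : {measure set T1 -> \bar R}) (m2 : {measure set T2 -> \bar R}).

Import HBNNSimple.

Let int_nnsfun d (T : measurableType d) (m : {measure set T -> \bar R})
    (X : T -> U) (p : T -> \bar R) (h : {nnsfun U >-> R}) :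
  measurable_fun setT X -> measurable_fun setT p -> (forall x, 0 <= p x) ->
  \int[m]_x ((h (X x))%:E * p x) =
  \sum_(r \in range h) r%:E * \int[m]_(x in X @^-1` (h @^-1` [set r])) p x.
Proof.
move=> mX mp p0.
have mXA A : measurable A -> measurable (X @^-1` A).
  by move=> mA; rewrite -[X in measurable X]setTI; exact: mX.
have mi r : measurable_fun setT (fun x => \1_(h @^-1` [set r]) (X x) : R).
  by apply: (measurableT_comp _ mX); exact: measurable_indic.
under eq_integral => x _.
  rewrite fimfunE -fsumEFin// ge0_mule_fsuml; last first.
    by move=> r; exact: nnfun_muleindic_ge0.
  over.
rewrite ge0_integral_fsum//=; last 2 first.
- move=> r; apply: emeasurable_funM => //; apply/measurable_EFinP.
  by apply: measurable_funM.
- by move=> r x _; apply: mule_ge0 => //; exact: nnfun_muleindic_ge0.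
apply: eq_fsbigr => r _.
have [r0|r0] := ltP r 0%R.
  rewrite preimage_nnfun0//= preimage_set0 integral_set0 mule0.
  by apply: integral0_eq => x _; rewrite indic0 mulr0 mul0e.
under eq_integral do rewrite EFinM -muleA.
rewrite ge0_integralZl//; last 2 first.
- by apply: emeasurable_funM => //; exact/measurable_EFinP.
- by move=> x _; apply: mule_ge0.
congr (_ * _); rewrite [RHS]integral_mkcond epatch_indic.
by apply: eq_integral => x _; rewrite muleC.
Qed.

(** Both sides are limits along the simple approximations of [g], and for simple functions they
    reduce to the hypothesis on preimages. Carrying the weights [p1] and [p2] lets one lemma serve
    for independence (an indicator against a constant), for laws given by a density, for polar
    coordinates and for the substitution of a square. *)
Lemma eq_weighted_image_integral (X1 : T1 -> U) (X2 : T2 -> U)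
    (p1 : T1 -> \bar R) (p2 : T2 -> \bar R) (g : U -> \bar R) :
  measurable_fun setT X1 -> measurable_fun setT X2 ->
  measurable_fun setT p1 -> measurable_fun setT p2 ->
  (forall x, 0 <= p1 x) -> (forall x, 0 <= p2 x) ->
  (forall A, measurable A ->
    \int[m1]_(x in X1 @^-1` A) p1 x = \int[m2]_(x in X2 @^-1` A) p2 x) ->
  measurable_fun setT g -> (forall u, 0 <= g u) ->
  \int[m1]_x (g (X1 x) * p1 x) = \int[m2]_x (g (X2 x) * p2 x).
Proof.
move=> mX1 mX2 mp1 mp2 p10 p20 H mg g0.
pose h := nnsfun_approx measurableT mg.
have lim_h d (T : measurableType d) (m : {measure set T -> \bar R})
    (X : T -> U) (p : T -> \bar R) :
    measurable_fun setT X -> measurable_fun setT p -> (forall x, 0 <= p x) ->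
    \int[m]_x (g (X x) * p x) = limn (fun n => \int[m]_x ((h n (X x))%:E * p x)).
  move=> mX mp p0; rewrite -monotone_convergence//=.
  - apply: eq_integral => x _; apply/esym/cvg_lim => //.
    have hc : (h n (X x))%:E @[n --> \oo] --> g (X x) by exact: cvg_nnsfun_approx.
    have [->|p_neq0] := eqVneq (p x) 0.
      by rewrite mule0; under eq_fun do rewrite mule0; exact: cvg_cst.
    have nd n : (h n (X x))%:E <= g (X x).
      by rewrite /h nnsfun_approxE le_approx.
    (* Multiplication by an infinite weight is not continuous at 0, so that case is split according
       to whether [g] vanishes. *)
    have : p x = +oo \/ p x \is a fin_num.
      by have := p0 x; case: (p x) => //; [right|left].
    move=> [px|pfin]; last first.
      by apply: cvgeZr.
    have [g00|g0p] := eqVneq (g (X x)) 0.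
      rewrite g00 mul0e; apply: cvg_near_cst; apply: nearW => n.
      suff -> : (h n (X x))%:E = 0 by rewrite mul0e.
      apply/eqP; rewrite eq_le -{1}g00 nd lee_fin//.
      exact: fun_ge0.
    have gpos : 0 < g (X x) by rewrite lt0e g0p g0.
    rewrite px gt0_muley//; apply: cvg_near_cst.
    have : \forall n \near \oo, 0 < (h n (X x))%:E.
      by apply: (hc [set y | 0 < y]); apply: open_nbhs_nbhs; split => //; exact: open_ereal_gt_ereal.
    by apply: filterS => n hn; rewrite gt0_muley.
  - move=> n; apply: emeasurable_funM => //; apply/measurable_EFinP.
    exact: measurableT_comp.
  - by move=> n x _; apply: mule_ge0 => //; rewrite lee_fin fun_ge0.
  - move=> x _ a b ab; apply: lee_wpmul2r => //; rewrite lee_fin.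
    exact/lefP/nd_nnsfun_approx.
rewrite !lim_h//; congr (lim (_ @ \oo)); apply/funext => n.
rewrite !int_nnsfun//; by apply: eq_fsbigr => r _; rewrite H.
Qed.

End Transfer.

Section Independence.
Local Open Scope ereal_scope.
Context d (T : measurableType d) (R : realType) (P : probability T R).

(** A pi-system argument: the finite intersections whose component at [i0] is the whole space
    generate the sigma-algebra of the other families, and the finite measures [A |-> P (A & E0)] and
    [A |-> P E0 * P A] agree on them. Each family must contain [setT], so that a single event counts
    as such an intersection. *)
Lemma mutually_indep_group (I : finType) (F : I -> set (set T)) (i0 : I) :
  mutually_indep P F -> (forall i, F i `<=` measurable) ->
  (forall i, F i setT) -> (forall i, setI_closed (F i)) ->
  forall E0 E, F i0 E0 ->
    <<s \bigcup_(i in [set i | i != i0]) F i >> E ->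
    P (E0 `&` E) = P E0 * P E.
Proof.
move=> indF mF FT FI E0 E FE0.
pose G := [set A | exists E : I -> set T,
  [/\ forall i, F i (E i), E i0 = setT & A = \bigcap_(i in setT) E i]].
have mG : G `<=` measurable.
  move=> _ [E1 [FE1 _ ->]]; apply: fin_bigcap_measurable => //.
  by move=> i _; apply: mF.
have sub : <<s \bigcup_(i in [set i | i != i0]) F i >> `<=` <<s G >>.
  apply: sub_sigma_algebra2 => A [i /= ii0 FA].
  exists (fun j => if j == i then A else setT); split.
  - by move=> j; case: eqP => [->|].
  - by rewrite eq_sym (negbTE ii0).
  - apply/seteqP; split => [x Ax j _|x /(_ i Logic.I)]; last by rewrite eqxx.
    by case: eqP.
move=> /sub GE.
have mE0 : measurable E0 by exact: mF FE0.
have p0 : (0 <= fine (P E0))%R by rewrite fine_ge0.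
pose m1 := mrestr P mE0.
pose m2 := mscale (NngNum p0) P.
suff : m1 E = m2 E.
  by rewrite /m1 /m2 /mrestr /mscale/= setIC fineK// fin_num_measure.
apply: (g_sigma_algebra_measure_unique G mG (fun=> setT)) => //.
- move=> _; exists (fun=> setT); split => //.
  by apply/seteqP; split.
- by rewrite bigcup_const//; exists 0%N.
- move=> A B [EA [FA A0 ->]] [EB [FB B0 ->]].
  exists (fun i => EA i `&` EB i); split => [i||].
  + exact: FI.
  + by rewrite A0 B0 setIT.
  + by rewrite bigcapI.
- move=> A [EA [FA A0 AE]]; change (P (A `&` E0) = (fine (P E0))%:E * P A).
  have mA : measurable A by apply: mG; exists EA.
  pose EB i := if i == i0 then E0 else EA i.
  have FB i : F i (EB i) by rewrite /EB; case: eqP => [->|].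
  have -> : A `&` E0 = \bigcap_(i in setT) EB i.
    rewrite AE; apply/seteqP; split => [x [Ax E0x] i _|x Ax].
      by rewrite /EB; case: eqP => // _; exact: Ax.
    split=> [i _|]; last by have := Ax i0 Logic.I; rewrite /EB eqxx.
    have := Ax i Logic.I; rewrite /EB; case: eqP => // -> _.
    by rewrite A0.
  have mB : measurable (\bigcap_(i in setT) EB i).
    apply: fin_bigcap_measurable; first exact: finite_finset.
    by move=> i _; apply: mF.
  rewrite -[LHS]fineK ?fin_num_measure// -[in RHS](@fineK _ (P A)) ?fin_num_measure//.
  rewrite -EFinM; congr EFin.
  rewrite (indF EB FB) AE (indF EA FA) (bigD1 i0)//= [in RHS](bigD1 i0)//=.
  rewrite A0 probability_setT/= mul1r {1}/EB eqxx; congr (_ * _)%R.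
  by apply: eq_bigr => i /negbTE ii0; rewrite /EB ii0.
- by move=> k; rewrite ltey_eq fin_num_measure.
Qed.

Lemma indep_event_integral (E0 : set T) (f : T -> \bar R) :
  measurable E0 -> measurable_fun setT f -> (forall x, 0 <= f x) ->
  (forall A, measurable A -> P (E0 `&` f @^-1` A) = P E0 * P (f @^-1` A)) ->
  \int[P]_(w in E0) f w = P E0 * \int[P]_w f w.
Proof.
move=> mE0 mf f0 H.
rewrite integral_mkcond epatch_indic.
(* The transfer lemma wants a test function that is nonnegative on the whole of [\bar R], so the
   absolute value stands in for the identity. *)
rewrite -[X in _ * X](_ : \int[P]_w `|f w| = _); last first.
  by apply: eq_integral => x _; rewrite gee0_abs.
rewrite -ge0_integralZl//; last exact: measurableT_comp.
under [RHS]eq_integral do rewrite muleC.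
transitivity (\int[P]_w (`|f w| * (\1_E0 w)%:E)).
  by apply: eq_integral => x _; rewrite gee0_abs.
apply: (@eq_weighted_image_integral _ _ _ _ _ _ _ P P f f (EFin \o \1_E0) (cst (P E0)) (fun y => `|y|)) => //.
- exact/measurable_EFinP.
- by move=> x; rewrite /= lee_fin.
- move=> A mA.
  have mfA : measurable (f @^-1` A) by rewrite -[X in measurable X]setTI; exact: mf.
  rewrite integral_cst// integral_indic//.
  exact: H.
- exact: measurableT_comp.
Qed.

(** The previous lemma, applied to the events [f^-1 A], says that the weight [g] and the constant
    weight equal to its mean give [f] the same image measure. *)
Lemma indep_integralM (f g : T -> \bar R) :
  measurable_fun setT f -> (forall x, 0 <= f x) ->
  measurable_fun setT g -> (forall x, 0 <= g x) ->
  (forall A B, measurable A -> measurable B ->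
     P (f @^-1` A `&` g @^-1` B) = P (f @^-1` A) * P (g @^-1` B)) ->
  \int[P]_w (f w * g w) = \int[P]_w f w * \int[P]_w g w.
Proof.
move=> mf f0 mg g0 H.
have Eg : 0 <= \int[P]_w g w by apply: integral_ge0.
rewrite -ge0_integralZr//.
have absf (h : T -> \bar R) : \int[P]_w (f w * h w) = \int[P]_w (`|f w| * h w).
  by apply: eq_integral => x _; rewrite gee0_abs.
rewrite absf [RHS]absf.
apply: (@eq_weighted_image_integral _ _ _ _ _ _ _ P P f f g _ (fun y => `|y|)) => //.
- move=> A mA.
  have mfA : measurable (f @^-1` A) by rewrite -[X in measurable X]setTI; exact: mf.
  rewrite [LHS]indep_event_integral//.
    by rewrite (@integral_cst _ _ _ P _ mfA) muleC.
  by move=> B mB; apply: H.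
- exact: measurableT_comp.
Qed.

End Independence.

(** * Dyadic approximation from above and freezing of a random argument *)

Section Dyadic.
Context {R : realType}.

(** For [x >= 0], the least multiple of [2^-n] strictly above [x]; a negative [x] is sent to [2^-n].
    The approximation is from above because the interference and the indicator of [y < H] are
    continuous from the right only. *)
Definition updyadic (n : nat) (x : R) : R := (Num.truncn (x * 2 ^+ n)).+1%:R / 2 ^+ n.

Lemma updyadic_gt n x : x < updyadic n x.
Proof. by rewrite /updyadic ltr_pdivlMr ?exprn_gt0//; exact: truncnS_gt. Qed.

Lemma updyadic_le n x : 0 <= x -> updyadic n x <= x + (2 ^+ n)^-1.
Proof.
move=> x0; rewrite /updyadic ler_pdivrMr ?exprn_gt0// mulrDl mulVf ?expf_neq0//.
rewrite -natr1 lerD2r.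
by have /andP[] : (Num.truncn (x * 2 ^+ n))%:R <= x * 2 ^+ n < (Num.truncn (x * 2 ^+ n)).+1%:R
  by apply: truncn_itv; rewrite mulr_ge0// exprn_ge0.
Qed.

Lemma updyadicS_le n x : updyadic n.+1 x <= updyadic n x.
Proof.
have le2 (a b : R) : (a / (2 * 2 ^+ n) <= b / 2 ^+ n) = (a <= b * 2).
  by rewrite invfM mulrA ler_pM2r ?invr_gt0 ?exprn_gt0// ler_pdivrMr.
rewrite /updyadic exprS le2 -natrM ler_nat muln2.
suff : (Num.truncn (x * (2 * 2 ^+ n)) <= (Num.truncn (x * 2 ^+ n)).*2.+1)%N by lia.
rewrite truncn_le_nat.
have -> : (Num.truncn (x * 2 ^+ n)).*2.+2 = ((Num.truncn (x * 2 ^+ n)).+1 * 2)%N by lia.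
rewrite natrM mulrCA mulrC ltr_pM2r//; exact: truncnS_gt.
Qed.

Lemma updyadic_nincr x : {homo (fun n => updyadic n x) : m n / (m <= n)%N >-> n <= m}.
Proof.
move=> m n; elim: n => [|n IH]; first by rewrite leqn0 => /eqP ->.
rewrite leq_eqVlt => /predU1P[->//|/IH]; apply: le_trans; exact: updyadicS_le.
Qed.

Lemma cvg_updyadic x : 0 <= x -> updyadic n x @[n --> \oo] --> x.
Proof.
move=> x0; apply: (squeeze_cvgr (f := fun=> x) (h := fun n => x + (2 ^+ n)^-1)).
- by apply: nearW => n; rewrite (ltW (updyadic_gt _ _)) updyadic_le.
- exact: cvg_cst.
- rewrite -[X in _ --> X]addr0; apply: cvgD; first exact: cvg_cst.
  under eq_fun do rewrite -exprVn.
  by apply: cvg_expr; rewrite ger0_norm ?invr_ge0// invf_lt1// ltr1n.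
Qed.

Lemma measurable_truncn_eq d (T : measurableType d) (X : T -> R) (n v : nat) :
  measurable_fun setT X ->
  measurable [set w | Num.truncn (X w * 2 ^+ n) = v].
Proof.
move=> mX.
have H u : measurable [set w | (Num.truncn (X w * 2 ^+ n) <= u)%N].
  have -> : [set w | (Num.truncn (X w * 2 ^+ n) <= u)%N] =
      X @^-1` `]-oo, (u.+1%:R / 2 ^+ n)[.
    apply/seteqP; split => w /=;
      by rewrite in_itv/= truncn_le_nat ltr_pdivlMr// exprn_gt0.
  by rewrite -[X in measurable X]setTI; apply: mX => //; exact: measurable_itv.
have -> : [set w | Num.truncn (X w * 2 ^+ n) = v] =
    [set w | (Num.truncn (X w * 2 ^+ n) <= v)%N] `\`
    (if v is u.+1 then [set w | (Num.truncn (X w * 2 ^+ n) <= u)%N] else set0).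
  case: v => [|v]; first by rewrite setD0; apply/seteqP; split => w /=; lia.
  by apply/seteqP; split => w /=; lia.
by apply: measurableD => //; case: v.
Qed.

(** The approximated argument takes countably many values, and on each of the corresponding events
    [f] is evaluated at a constant. Measurability of every [f x] is thus enough, without joint
    measurability. *)
Lemma measurable_fun_updyadic_freeze d d' (T : measurableType d)
    (V : measurableType d') (X : T -> R) (f : R -> T -> V) (n : nat) :
  measurable_fun setT X -> (forall x, measurable_fun setT (f x)) ->
  measurable_fun setT (fun w => f (updyadic n (X w)) w).
Proof.
move=> mX mf.
pose E v := [set w | Num.truncn (X w * 2 ^+ n) = v].
have -> : [set: T] = \bigcup_v E v.
  by apply/seteqP; split => // w _; exists (Num.truncn (X w * 2 ^+ n)).
apply/measurable_fun_bigcup => [v|v]; first exact: measurable_truncn_eq.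
apply: (eq_measurable_fun (f (v.+1%:R / 2 ^+ n))).
  by move=> w; rewrite inE /E/= /updyadic => ->.
by apply: measurable_funS (mf _).
Qed.

Lemma measurable_fun_freeze d (T : measurableType d) (X : T -> R)
    (f : R -> T -> \bar R) :
  measurable_fun setT X -> (forall x, measurable_fun setT (f x)) ->
  (forall w, f (updyadic n (X w)) w @[n --> \oo] --> f (X w) w) ->
  measurable_fun setT (fun w => f (X w) w).
Proof.
move=> mX mf cf.
apply: (emeasurable_fun_cvg (fun n w => f (updyadic n (X w)) w)) => // n.
exact: measurable_fun_updyadic_freeze.
Qed.

End Dyadic.

Section Freeze.
Local Open Scope ereal_scope.
Context d (T : measurableType d) (R : realType) (P : probability T R).

(* The random argument X is replaced by its dyadic approximations from above,
   for which the claim is a countable sum over the values. *)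
Lemma indep_freeze (X : T -> R) (f : R -> T -> R) (phi : R -> R) (D : set R) :
  measurable_fun setT X -> (forall x, measurable_fun setT (f x)) ->
  measurable_fun setT phi -> measurable_fun setT (fun w => f (X w) w) ->
  (forall x w, 0 <= f x w <= 1)%R ->
  (forall x, \int[P]_w (f x w)%:E = (phi x)%:E) ->
  (forall x A, measurable A ->
     \int[P]_(w in X @^-1` A) (f x w)%:E = P (X @^-1` A) * \int[P]_w (f x w)%:E) ->
  {ae P, forall w, D (X w)} ->
  {ae P, forall w, forall x, D x -> f (updyadic n x) w @[n --> \oo] --> f x w} ->
  \int[P]_w (f (X w) w)%:E = \int[P]_w (phi (X w))%:E.
Proof.
move=> mX mf mphi mfX f01 fphi indf aeD aec.
have phi01 x : (0 <= phi x <= 1)%R.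
  rewrite -!lee_fin -fphi integral_ge0/=; last first.
    by move=> w _; rewrite lee_fin; have /andP[] := f01 x w.
  rewrite -(@probability_setT _ _ _ P) -[leRHS]mul1e -integral_cst//.
  apply: ge0_le_integral => //.
  - by move=> w _; rewrite lee_fin; have /andP[] := f01 x w.
  - exact/measurable_EFinP.
  - by move=> w _; rewrite lee_fin; have /andP[] := f01 x w.
have step n : \int[P]_w (f (updyadic n (X w)) w)%:E = \int[P]_w (phi (updyadic n (X w)))%:E.
  pose E v := [set w | Num.truncn (X w * 2 ^+ n) = v].
  have mE v : measurable (E v) by exact: measurable_truncn_eq.
  have UE : [set: T] = \bigcup_v E v.
    by apply/seteqP; split => // w _; exists (Num.truncn (X w * 2 ^+ n)).
  have tE : trivIset setT E by move=> i j _ _ [w [/= <- <-]].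
  rewrite UE !ge0_integral_bigcup//=; last 4 first.
  - rewrite -UE; apply/measurable_EFinP.
    by apply: (@measurable_fun_updyadic_freeze _ _ _ _ _ _ (fun x _ => phi x)) => // x; exact: measurable_cst.
  - by move=> w _; rewrite lee_fin; have /andP[] := phi01 (updyadic n (X w)).
  - by rewrite -UE; apply/measurable_EFinP; exact: measurable_fun_updyadic_freeze.
  - by move=> w _; rewrite lee_fin; have /andP[] := f01 (updyadic n (X w)) w.
  apply: eq_eseriesr => v _.
  transitivity (\int[P]_(w in E v) (f (v.+1%:R / 2 ^+ n)%R w)%:E).
    by apply: eq_integral => w; rewrite inE /E/= /updyadic => ->.
  transitivity (\int[P]_(w in E v) (phi (v.+1%:R / 2 ^+ n)%R)%:E); last first.
    by apply: eq_integral => w; rewrite inE /E/= /updyadic => ->.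
  rewrite integral_cst//= -fphi.
  have -> : E v = X @^-1` [set x | Num.truncn (x * 2 ^+ n) = v] by [].
  rewrite indf; first by rewrite muleC.
  by apply: (@measurable_truncn_eq _ _ _ idfun); exact: measurable_id.
(* On [D], [phi] inherits convergence along the dyadic approximations from [f], by dominated
   convergence at fixed [x]. *)
have cphi x : D x -> phi (updyadic n x) @[n --> \oo] --> phi x.
  move=> Dx.
  suff : (fun n => (phi (updyadic n x))%:E) @ \oo --> (phi x)%:E by move/fine_cvgP => [].
  under eq_fun do rewrite -fphi; rewrite -fphi.
  have [] := @dominated_convergence _ _ _ P setT measurableT
    (fun n w => (f (updyadic n x) w)%:E) (fun w => (f x w)%:E) (cst 1%E) => //.
  - by move=> n; exact/measurable_EFinP.
  - exact/measurable_EFinP.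
  - by apply: filterS aec => w H _; apply: cvg_EFin; [exact: nearW|exact: H].
  - exact: (finite_measure_integrable_cst P 1%R).
  - apply: aeW => w n _; rewrite gee0_abs lee_fin;
    by have /andP[] := f01 (updyadic n x) w.
suff [L Rr] : ((fun n => \int[P]_w (f (updyadic n (X w)) w)%:E) @ \oo -->
               \int[P]_w (f (X w) w)%:E) /\
              ((fun n => \int[P]_w (phi (updyadic n (X w)))%:E) @ \oo -->
               \int[P]_w (phi (X w))%:E).
  by rewrite (funext step) in L; exact: cvg_unique L Rr.
split.
- have [] := @dominated_convergence _ _ _ P setT measurableT
    (fun n w => (f (updyadic n (X w)) w)%:E) (fun w => (f (X w) w)%:E) (cst 1%E) => //.
  - by move=> n; apply/measurable_EFinP; exact: measurable_fun_updyadic_freeze.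
  - exact/measurable_EFinP.
  - by apply: filterS2 aec aeD => w H Dw _; apply: cvg_EFin; [exact: nearW|exact: H].
  - exact: (finite_measure_integrable_cst P 1%R).
  - apply: aeW => w n _; rewrite gee0_abs lee_fin;
    by have /andP[] := f01 (updyadic n (X w)) w.
- have [] := @dominated_convergence _ _ _ P setT measurableT
    (fun n w => (phi (updyadic n (X w)))%:E) (fun w => (phi (X w))%:E) (cst 1%E) => //.
  - move=> n; apply/measurable_EFinP.
    by apply: (@measurable_fun_updyadic_freeze _ _ _ _ _ _ (fun x _ => phi x)) => // x; exact: measurable_cst.
  - by apply/measurable_EFinP; exact: measurableT_comp.
  - by apply: filterS aeD => w Dw _; apply: cvg_EFin; [exact: nearW|exact: cphi].
  - exact: (finite_measure_integrable_cst P 1%R).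
  - apply: aeW => w n _; rewrite gee0_abs lee_fin;
    by have /andP[] := phi01 (updyadic n (X w)).
Qed.

End Freeze.

(** * Laplace functional of a Poisson process *)

Section ExpN.
Context {R : realType}.

(** Finiteness of the interference will be deduced from its Laplace transform, so the transform has
    to make sense at [+oo], where it is 0. The same value at [-oo] is a mere default. *)
Definition expN (y : \bar R) : R := if y \is a fin_num then expR (- fine y) else 0.

Lemma expN_EFin (r : R) : expN r%:E = expR (- r).
Proof. by []. Qed.

Lemma expN_ge0 y : 0 <= expN y.
Proof. by rewrite /expN; case: ifP => // _; exact: expR_ge0. Qed.

Lemma expN_le1 y : (0 <= y)%E -> expN y <= 1.
Proof.
case: y => [r| |] // r0; rewrite lee_fin in r0.
by rewrite expN_EFin -expR0 ler_expR oppr_le0.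
Qed.

Lemma expND x y : (0 <= x)%E -> (0 <= y)%E -> expN (x + y)%E = expN x * expN y.
Proof.
case: x => [r| |]//; case: y => [s| |]// r0 s0; rewrite ?expN_EFin /expN/=
  ?mulr0 ?mul0r//.
by rewrite opprD expRD.
Qed.

Lemma expN_sum (I : Type) (s : seq I) (Q : pred I) (F : I -> \bar R) :
  (forall i, 0 <= F i)%E ->
  expN (\sum_(i <- s | Q i) F i)%E = \prod_(i <- s | Q i) expN (F i).
Proof.
move=> F0; elim: s => [|i s IH].
  by rewrite !big_nil expN_EFin oppr0 expR0.
rewrite !big_cons; case: ifP => // _; rewrite expND ?IH//; exact: sume_ge0.
Qed.

Lemma expN_decr x y : (0 <= x)%E -> (x <= y)%E -> expN y <= expN x.
Proof.
case: x => [r| |]//; case: y => [s| |]//; rewrite ?expN_EFin.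
- by rewrite !lee_fin => r0 rs; rewrite ler_expR lerN2.
- by move=> _ _; rewrite {1}/expN/= expR_ge0.
Qed.

Lemma measurable_expN : measurable_fun setT expN.
Proof.
apply: measurable_fun_ifT => //.
- apply: (@measurable_fun_bool _ _ _ _ true) => /=; rewrite setTI.
  rewrite (_ : _ @^-1` _ = ~` [set -oo%E] `&` ~` [set +oo%E]).
    by apply: measurableI; apply: measurableC; exact: emeasurable_set1.
  by apply/seteqP; split => -[r| |] //= [].
- by apply: measurableT_comp => //; apply: measurableT_comp => //.
Qed.

Lemma cvg_expN (u : (\bar R)^nat) (l : \bar R) : (forall n, 0 <= u n)%E ->
  u @ \oo --> l -> expN (u n) @[n --> \oo] --> expN l.
Proof.
move=> u0 ul.
have l0 : (0 <= l)%E by apply: (cvge_to_ge ul); exact: nearW.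
case: l l0 ul => [r| |]// r0 ul.
  have /fine_cvgP[fu cu] := ul.
  rewrite expN_EFin.
  apply: (@cvg_trans _ (expR (- fine (u n)) @[n --> \oo])).
    by apply: near_eq_cvg; near=> n; rewrite /expN ifT//; near: n.
  exact: (cvg_comp _ _ (cvgN cu) (@continuous_expR R (- r))).
rewrite {2}/expN/=; apply/cvgrPdist_le => e e0; rewrite /=.
near=> n; rewrite sub0r normrN ger0_norm ?expN_ge0//.
have : ((- ln e)%:E <= u n)%E by near: n; move/cvgeyPge: ul; exact.
have := u0 n; case: (u n) => [r _| |]//; last first.
  by rewrite {1}/expN/= => _ _; exact: ltW.
rewrite lee_fin expN_EFin => er.
by rewrite -[leRHS]lnK ?posrE// ler_expR lerNl.
Unshelve. all: by end_near. Qed.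

End ExpN.

Section PoissonSeries.
Context {R : realType}.

Lemma pois_ge0 (m : R) k : 0 <= m -> 0 <= pois m k.
Proof. by move=> m0; rewrite mulr_ge0 ?expR_ge0// divr_ge0// exprn_ge0. Qed.

Lemma pois_laplace_series (m a : R) : 0 <= m ->
  (\sum_(0 <= k <oo) (pois m k * expN (a%:E * k%:R%:E))%:E =
   (expR (- ((1 - expR (- a)) * m)))%:E)%E.
Proof.
move=> m0; have q0 : 0 <= m * expR (- a) by rewrite mulr_ge0// expR_ge0.
under eq_eseriesr => k _.
  have -> : pois m k * expN (a%:E * k%:R%:E) =
      expR (- m) * ((m * expR (- a)) ^+ k / k`!%:R).
    rewrite /pois -EFinM expN_EFin exprMn -expRM_natr mulNr.
    by ring.
  rewrite EFinM; over.
rewrite nneseriesZl; last by move=> k _; rewrite lee_fin divr_ge0// exprn_ge0.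
have -> : (\sum_(0 <= k <oo) ((m * expR (- a)) ^+ k / k`!%:R)%:E =
           (expR (m * expR (- a)))%:E)%E.
  rewrite /expR -EFin_lim; last exact: is_cvg_series_exp_coeff.
  apply/congr_lim/funext => n/=; rewrite /series/= -sumEFin//.
by rewrite -EFinM -expRD; congr (expR _)%:E; ring.
Qed.

Lemma pois_series (m : R) : 0 <= m -> (\sum_(0 <= k <oo) (pois m k)%:E = 1)%E.
Proof.
move=> m0; have := pois_laplace_series 0 m0.
rewrite oppr0 expR0 subrr mul0r oppr0 expR0 => <-.
by apply: eq_eseriesr => k _; rewrite mul0e expN_EFin oppr0 expR0 mulr1.
Qed.

End PoissonSeries.

Section PPP.
Context {R : realType}.
Local Notation pt := ((R * R) * R)%type.
Context d (T : measurableType d) (P : probability T R).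
Variables (N : T -> {measure set pt -> \bar R}) (mu : set pt -> \bar R).
Hypothesis hN : is_PPP P N mu.
Hypothesis mu0 : forall B, (0 <= mu B)%E.

Let mcount B y : measurable B -> measurable [set w | N w B = y%:E].
Proof.
move=> mB; have mNB := hN.1 B mB.
have -> : [set w | N w B = y%:E] = (fun w => N w B) @^-1` [set y%:E] by [].
rewrite -[X in measurable X]setTI; exact: mNB.
Qed.

(** The definition of the process prescribes the probability of each integer count; since the
    Poisson masses sum to 1, nothing is left for other values. *)
Let count_ae B : measurable B -> (mu B < +oo)%E ->
  P (~` \bigcup_k [set w | N w B = k%:R%:E]) = 0%E.
Proof.
move=> mB muB; have mk k := @mcount B k%:R mB.
rewrite probability_setC; last exact: bigcup_measurable.
rewrite measure_bigcup//; last first.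
  by move=> i j _ _ [w [/= -> [/eqP]]]; rewrite eqr_nat => /eqP.
rewrite (_ : (\sum_(0 <= i <oo | i \in setT) _)%E = 1%E) ?subee//.
rewrite -(pois_series (m := fine (mu B))) ?fine_ge0//.
under eq_eseriesl do rewrite in_setT.
apply: eq_eseriesr => k _.
have := hN.2 1%N (fun=> B) (fun=> k) (fun=> mB) (fun=> muB).
rewrite big_ord1 => <-.
  by congr (P _); apply/seteqP; split => w /= => [|/(_ ord0)].
by move=> i j; rewrite !ord1 eqxx.
Qed.

(** The definition of the process speaks only of exact values of finitely many counts. The functions
    [g i] are therefore brought in one at a time: after [m] steps the first [m] factors are
    arbitrary and the others are indicators of a value, and the next factor is reached by splitting
    the space according to its count, almost surely an integer. *)
Lemma PPP_indep_counts n (Bs : 'I_n -> set pt) (g : 'I_n -> \bar R -> R) (Z : 'I_n -> R) :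
  (forall i, measurable (Bs i)) -> (forall i, (mu (Bs i) < +oo)%E) ->
  (forall i j, i != j -> Bs i `&` Bs j = set0) ->
  (forall i, measurable_fun setT (g i)) -> (forall i y, 0 <= g i y) ->
  (forall i, (\sum_(0 <= k <oo) (pois (fine (mu (Bs i))) k * g i k%:R%:E)%:E = (Z i)%:E)%E) ->
  (\int[P]_w (\prod_(i < n) g i (N w (Bs i)))%:E = (\prod_(i < n) Z i)%:E)%E.
Proof.
move=> mB muB dB mg0 g00 gZ0.
pose dl (c : nat) (y : \bar R) : R := (y == c%:R%:E)%:R.
have mdl c : measurable_fun setT (dl c).
  rewrite (_ : dl c = \1_[set c%:R%:E]).
    exact: measurable_indic.
  apply/funext => y; rewrite indicE /dl; congr (nat_of_bool _)%:R.
  by apply/eqP/idP; rewrite inE.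
suff H m (cs : 'I_n -> nat) : (m <= n)%N ->
  forall (g : 'I_n -> \bar R -> R) (Z : 'I_n -> R),
  (forall i, measurable_fun setT (g i)) -> (forall i y, 0 <= g i y) ->
  (forall i : 'I_n, (i < m)%N -> (\sum_(0 <= k <oo) (pois (fine (mu (Bs i))) k * g i k%:R%:E)%:E = (Z i)%:E)%E) ->
  (forall i : 'I_n, (m <= i)%N -> g i = dl (cs i) /\ Z i = pois (fine (mu (Bs i))) (cs i)) ->
  (\int[P]_w (\prod_(i < n) g i (N w (Bs i)))%:E = (\prod_(i < n) Z i)%:E)%E.
  apply: (H n (fun=> 0%N) _ g Z) => // i; last by rewrite leqNgt ltn_ord.
elim: m cs => [|m IH] cs mn {mg0 g00 gZ0} g' Z' mg g0 gZ gd.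
  under [in RHS]eq_bigr do rewrite (gd _ _).2//.
  rewrite -(hN.2 n Bs cs)// -[X in P X]setIT -integral_indic//; last first.
    rewrite (_ : [set w | _] = \bigcap_(i in [set: 'I_n]) [set w | N w (Bs i) = (cs i)%:R%:E]).
      apply: fin_bigcap_measurable; first exact: finite_finset.
      by move=> i _; exact: mcount.
    by apply/seteqP; split => w /= H i; [move=> _|]; exact: H.
  apply: eq_integral => w _; congr EFin; rewrite indicE.
  case: (boolP (w \in _)); rewrite ?inE/= => H.
    by rewrite big1// => i _; rewrite (gd _ _).1// /dl H eqxx.
  have [i Hi] : exists i, N w (Bs i) <> (cs i)%:R%:E by apply/existsNP; move: H; rewrite notin_setE.
  rewrite (bigD1 i)//= (gd _ _).1// /dl; move/eqP: Hi => /negbTE ->.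
  by rewrite mul0r.
pose im := Ordinal mn.
pose gk k i := if i == im then dl k else g' i.
pose Zk k i := if i == im then pois (fine (mu (Bs im))) k else Z' i.
have Hk k : (\int[P]_w (\prod_(i < n) gk k i (N w (Bs i)))%:E = (\prod_(i < n) Zk k i)%:E)%E.
  apply: (IH (fun i => if i == im then k else cs i) (ltnW mn)) => i.
  - by rewrite /gk; case: ifP.
  - by move=> y; rewrite /gk; case: ifP => // _; rewrite /dl.
  - move=> im'; rewrite /gk /Zk ifF; last by apply/eqP => /(congr1 val)/=; lia.
    rewrite ifF; last by apply/eqP => /(congr1 val)/=; lia.
    by apply: gZ; lia.
  - move=> mi; rewrite /gk /Zk; case: eqP => [->//|/eqP ii].
    apply: gd; rewrite ltn_neqAle mi andbT; apply: contra_neqN ii => /eqP mi'.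
    exact: val_inj.
have mgN i : measurable_fun setT (fun w => g' i (N w (Bs i))).
  by apply: measurableT_comp => //; exact: (hN.1 _ (mB i)).
have mprod : measurable_fun setT (fun w => (\prod_(i < n) g' i (N w (Bs i)))%:E).
  by apply/measurable_EFinP; exact: measurable_prod.
have p0 w : (0 <= (\prod_(i < n) g' i (N w (Bs i)))%:E)%E.
  by rewrite lee_fin; apply: prodr_ge0.
pose E k := [set w | N w (Bs im) = k%:R%:E].
have mE k : measurable (E k) by exact: mcount.
have mUE : measurable (\bigcup_k E k) by exact: bigcup_measurable.
rewrite (ge0_negligible_integral _ _ mprod _ (count_ae (mB im) (muB im)))//; last exact: measurableC.
rewrite setDE setCK setTI ge0_integral_bigcup//; last 2 first.
- exact: measurable_funS mprod.
- by move=> i j _ _ [w [/= -> [/eqP]]]; rewrite eqr_nat => /eqP.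
rewrite [in RHS](bigD1 im)//= EFinM -gZ ?ltnSn// muleC.
rewrite -nneseriesZl; last first.
  by move=> k _; rewrite lee_fin mulr_ge0// pois_ge0// fine_ge0.
apply: eq_eseriesr => k _.
transitivity (((g' im k%:R%:E)%:E * \int[P]_w (\prod_(i < n) gk k i (N w (Bs i)))%:E)%E).
  rewrite integral_mkcond -ge0_integralZl//; last 3 first.
  - apply/measurable_EFinP; apply: measurable_prod => i _.
    apply: measurableT_comp; last exact: (hN.1 _ (mB i)).
    by rewrite /gk; case: ifP.
  - move=> w _; rewrite lee_fin; apply: prodr_ge0 => i _.
    by rewrite /gk; case: ifP => // _; rewrite /dl.
  - by rewrite lee_fin.
  apply: eq_integral => w _; rewrite patchE (bigD1 im)//= [in RHS](bigD1 im)//=.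
  rewrite {1}/gk eqxx /dl.
  have -> : (w \in E k) = (N w (Bs im) == k%:R%:E).
    by apply/idP/eqP; rewrite inE.
  case: eqP => [->|_]; last by rewrite mul0r mule0.
  rewrite mul1r EFinM; congr (_ * _%:E)%E.
  by apply: eq_bigr => i /negbTE ii; rewrite /gk ii.
rewrite Hk (bigD1 im)//= {1}/Zk eqxx -!EFinM; congr EFin.
have -> : \prod_(i < n | i != im) Zk k i = \prod_(i < n | i != im) Z' i.
  by apply: eq_bigr => i /negbTE ii; rewrite /Zk ii.
by ring.
Qed.

End PPP.

Section PPPLaplace.
Context {R : realType}.
Local Notation pt := ((R * R) * R)%type.
Context d (T : measurableType d) (P : probability T R).
Variables (N : T -> {measure set pt -> \bar R}) (mu : set pt -> \bar R).
Variables (m0 : {measure set pt -> \bar R}) (rho : pt -> \bar R).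
Hypothesis hN : is_PPP P N mu.
Hypothesis hmu : forall B, measurable B -> mu B = (\int[m0]_(z in B) rho z)%E.
Hypothesis mu0 : forall B, (0 <= mu B)%E.
Hypothesis mrho : measurable_fun setT rho.
Hypothesis rho0 : forall z, (0 <= rho z)%E.
Hypothesis rhofin : forall z, rho z \is a fin_num.

Import HBNNSimple.

Lemma PPP_laplace_nnsfun (h : {nnsfun pt >-> R}) :
  (forall r, 0 < r -> (mu (h @^-1` [set r]) < +oo)%E) ->
  (\int[P]_w (expN (\int[N w]_z (h z)%:E))%:E =
   (expN (\int[m0]_z ((1 - expR (- h z))%:E * rho z)))%:E)%E.
Proof.
move=> muh.
have frh : finite_set (range h) by exact: fimfunP.
(* The value 0 is left out: its level set may have infinite mean measure, and it contributes nothing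
   to either side. *)
pose s := [seq r <- finmap.enum_fset (fset_set (range h)) | r != 0].
have us : uniq s by apply: filter_uniq; exact: finmap.fset_uniq.
have mems z : h z != 0 -> h z \in s.
  by move=> hz; rewrite mem_filter hz/= in_fset_set// inE; exists z.
have s0 r : r \in s -> 0 < r.
  rewrite mem_filter => /andP[r0]; rewrite in_fset_set// inE => -[z _ zr].
  by rewrite lt0r r0 -zr fun_ge0.
have mh r : measurable (h @^-1` [set r]) by exact: measurable_sfunP.
have nths (i : 'I_(size s)) : 0 < s`_i by apply: s0; exact: mem_nth.
have intN w : (\int[N w]_z (h z)%:E = \sum_(r <- s) r%:E * N w (h @^-1` [set r]))%E.
  rewrite integralT_nnsfun sintegralE fsbig_finite//= big_filter [RHS]big_mkcond/=.
  by apply: eq_bigr => r _; case: eqP => //= ->; rewrite mul0e.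
pose Bs (i : 'I_(size s)) := h @^-1` [set s`_i].
have H := @PPP_indep_counts R _ _ P N mu hN mu0 (size s) Bs (fun i y => expN ((s`_i)%:E * y))
  (fun i => expR (- ((1 - expR (- s`_i)) * fine (mu (Bs i))))) (fun i => mh _).
transitivity (\int[P]_w (\prod_(i < size s) expN ((s`_i)%:E * N w (Bs i)))%:E)%E.
  apply: eq_integral => w _; rewrite intN (big_nth 0) big_mkord expN_sum// => i.
  by rewrite mule_ge0// lee_fin ltW.
rewrite H; first last.
- by move=> i; rewrite pois_laplace_series// fine_ge0.
- by move=> i y; exact: expN_ge0.
- move=> i; apply: measurableT_comp; first exact: measurable_expN.
  by apply: emeasurable_funM => //; exact: measurable_id.
- move=> i j ij; apply/seteqP; split => // z [/= hi hj].
  by move: ij; rewrite -val_eqE/= -(nth_uniq 0 (ltn_ord i) (ltn_ord j) us) -hi hj eqxx.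
- by move=> i; apply: muh.
have e0 r : 0 <= r -> 0 <= 1 - expR (- r) :> R.
  by move=> r0; rewrite subr_ge0 -expR0 ler_expR oppr_le0.
transitivity ((expN (\sum_(i < size s) (1 - expR (- s`_i))%:E * mu (Bs i))%E)%:E).
  congr EFin; rewrite expN_sum; last by move=> i; rewrite mule_ge0// lee_fin e0// ltW.
  apply: eq_bigr => i _; rewrite -[X in (_ * X)%E]fineK ?ge0_fin_numE ?muh//.
congr (expN _)%:E.
pose F r z := ((1 - expR (- r))%:E * ((\1_(h @^-1` [set r]) z)%:E * rho z))%E.
transitivity (\sum_(i < size s) \int[m0]_z F s`_i z)%E.
  apply: eq_bigr => i _.
  rewrite ge0_integralZl//; last 3 first.
  - by apply: emeasurable_funM => //; exact/measurable_EFinP.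
  - by move=> z _; rewrite mule_ge0.
  - by rewrite lee_fin e0// ltW.
  rewrite hmu; last exact: mh.
  rewrite [in LHS]integral_mkcond epatch_indic; congr (_ * _)%E.
  by apply: eq_integral => z _; rewrite muleC.
rewrite -ge0_integral_sum//; last 2 first.
- move=> i; apply: emeasurable_funM => //; apply: emeasurable_funM => //.
  exact/measurable_EFinP.
- move=> i z _; rewrite /F mule_ge0// ?mule_ge0// lee_fin e0// ltW//.
apply: eq_integral => z _.
rewrite -(big_mkord xpredT (fun i => F s`_i z)) -(big_nth 0 xpredT (fun r => F r z)).
have Fz r : r != h z -> F r z = 0%E.
  move=> /eqP rz; rewrite /F indicE memNset ?mul0e ?mule0// => /= zr.
  exact/rz/esym.
have [hz0|hz0] := eqVneq (h z) 0.
  rewrite hz0 oppr0 expR0 subrr mul0e big_seq big1// => r rs; apply: Fz.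
  by rewrite hz0 gt_eqF// s0.
rewrite (bigD1_seq (h z)) ?mems//= big1 ?adde0; last by move=> r; exact: Fz.
by rewrite /F indicE mem_set//= mul1e.
Qed.

(** The simple approximations of [f] are cut off outside [D n], so that their nonzero level sets
    have finite mean measure. Monotone convergence inside the exponentials and dominated convergence
    outside pass to the limit on both sides. *)
Lemma PPP_laplace (f : pt -> \bar R) (D : (set pt)^nat) :
  measurable_fun setT f -> (forall z, 0 <= f z)%E ->
  (forall n, measurable (D n)) -> (forall n, (mu (D n) < +oo)%E) ->
  {homo D : n m / (n <= m)%N >-> n `<=` m} -> \bigcup_n D n = setT ->
  (\int[P]_w (expN (\int[N w]_z f z))%:E =
   (expN (\int[m0]_z ((1 - expN (f z))%:E * rho z)))%:E)%E.
Proof.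
move=> mf f0 mD muD ndD UD.
pose h n := proj_nnsfun (nnsfun_approx measurableT mf n) (mD n).
have hE n z : h n z = nnsfun_approx measurableT mf n z * \1_(D n) z by [].
have h0 n z : 0 <= h n z by exact: fun_ge0.
have nd_h z : {homo (fun n => h n z) : n m / (n <= m)%N >-> n <= m}.
  move=> n m nm; rewrite !hE; apply: ler_pM => //.
    exact/lefP/nd_nnsfun_approx.
  rewrite !indicE; have [Dz|] := boolP (z \in D n); last by rewrite ler0n.
  by rewrite mem_set//; apply: ndD nm _ _; rewrite inE in Dz.
have ch z : (h n z)%:E @[n --> \oo] --> f z.
  have [n0 _ Dz] : (\bigcup_n D n) z by rewrite UD.
  apply: (@cvg_trans _ ((nnsfun_approx measurableT mf n z)%:E @[n --> \oo])).
    apply: near_eq_cvg; near=> n; rewrite hE indicE mem_set ?mulr1//.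
    by apply: (ndD n0) Dz; near: n; exact: nbhs_infty_ge.
  exact: cvg_nnsfun_approx.
have mhn n : measurable_fun setT (h n) by exact: measurable_funP.
have cN w : (\int[N w]_z (h n z)%:E @[n --> \oo] --> \int[N w]_z f z)%E.
  rewrite [X in _ --> X](_ : _ = \int[N w]_z (limn (fun n => (h n z)%:E)))%E; last first.
    by apply: eq_integral => z _; apply/esym/cvg_lim.
  apply: cvg_monotone_convergence => //.
  - by move=> n; exact/measurable_EFinP.
  - by move=> n z _; rewrite lee_fin.
  - by move=> z _ n m nm; rewrite lee_fin; exact: nd_h.
have mN (g : pt -> \bar R) : measurable_fun setT g -> (forall z, 0 <= g z)%E ->
    measurable_fun setT (fun w => \int[N w]_z g z)%E.
  by move=> mg g0; apply: measurable_fun_integral_kernel => //; exact: hN.1.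
have intN0 w n : (0 <= \int[N w]_z (h n z)%:E)%E.
  by apply: integral_ge0 => z _; rewrite lee_fin.
have L : (\int[P]_w (expN (\int[N w]_z (h n z)%:E))%:E @[n --> \oo] -->
    \int[P]_w (expN (\int[N w]_z f z))%:E)%E.
  have mh n : measurable_fun setT (fun w => \int[N w]_z (h n z)%:E)%E.
    by apply: mN => [|z]; [exact/measurable_EFinP|rewrite lee_fin].
  have [] := @dominated_convergence _ _ _ P setT measurableT
    (fun n w => (expN (\int[N w]_z (h n z)%:E))%:E)%E
    (fun w => (expN (\int[N w]_z f z))%:E)%E (cst 1%E) => //.
  - by move=> n; apply/measurable_EFinP; apply: measurableT_comp => //; exact: measurable_expN.
  - apply/measurable_EFinP; apply: measurableT_comp; first exact: measurable_expN.
    exact: mN.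
  - by apply: aeW => w _; apply: cvg_EFin; [exact: nearW|exact: cvg_expN].
  - exact: (finite_measure_integrable_cst P 1%R).
  - apply: aeW => w n _; rewrite gee0_abs lee_fin ?expN_ge0//; exact: expN_le1.
have e0 y : (0 <= y)%E -> 0 <= 1 - expN y :> R.
  by move=> y0; rewrite subr_ge0 expN_le1.
have muh n r : 0 < r -> (mu (h n @^-1` [set r]) < +oo)%E.
  move=> r0; apply: le_lt_trans (muD n).
  rewrite !hmu//; apply: ge0_subset_integral => //; first exact: measurable_funS mrho.
  move=> z; change (h n z = r -> D n z); rewrite hE indicE; have [|_] := boolP (z \in D n); first by rewrite inE.
  by rewrite mulr0 => /esym r0'; rewrite r0' ltxx in r0.
have Rr : (\int[m0]_z ((1 - expN (h n z)%:E)%:E * rho z) @[n --> \oo] -->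
    \int[m0]_z ((1 - expN (f z))%:E * rho z))%E.
  have cz z : ((1 - expN (h n z)%:E)%:E * rho z @[n --> \oo] --> (1 - expN (f z))%:E * rho z)%E.
    have c1 : (1 - expN (h n z)%:E) @[n --> \oo] --> 1 - expN (f z).
      apply: cvgB; first exact: cvg_cst.
      by apply: cvg_expN => // n; rewrite lee_fin.
    by apply: cvgeZr; [exact: rhofin|apply: cvg_EFin => //; exact: nearW].
  rewrite [X in _ --> X](_ : _ = \int[m0]_z (limn (fun n => (1 - expN (h n z)%:E)%:E * rho z)))%E; last first.
    by apply: eq_integral => z _; apply/esym/cvg_lim.
  apply: cvg_monotone_convergence => //.
  - move=> n; apply: emeasurable_funM => //; apply/measurable_EFinP.
    apply: measurable_funB => //; apply: measurableT_comp; first exact: measurable_expN.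
    exact/measurable_EFinP.
  - by move=> n z _; rewrite mule_ge0// lee_fin e0// lee_fin.
  - move=> z _ n m nm; apply: lee_wpmul2r => //; rewrite lee_fin lerD2l lerN2.
    by apply: expN_decr; rewrite lee_fin//; exact: nd_h.
have Rr' : ((expN (\int[m0]_z ((1 - expN (h n z)%:E)%:E * rho z)))%:E @[n --> \oo] -->
    (expN (\int[m0]_z ((1 - expN (f z))%:E * rho z)))%:E)%E.
  apply: cvg_EFin; first exact: nearW.
  apply: cvg_expN => // n; apply: integral_ge0 => z _.
  by rewrite mule_ge0// lee_fin e0// lee_fin.
have E n : (\int[P]_w (expN (\int[N w]_z (h n z)%:E))%:E =
   (expN (\int[m0]_z ((1 - expN (h n z)%:E)%:E * rho z)))%:E)%E.
  by rewrite PPP_laplace_nnsfun//; exact: muh.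
by rewrite (funext E) in L; exact: cvg_unique L Rr'.
Unshelve. all: by end_near. Qed.

End PPPLaplace.

(** * Polar coordinates and integration over the fading mark *)

Section Radial.
Context {R : realType}.
Local Notation leb := (@lebesgue_measure R).

(** The substitution [y = sqrt u * sin t] turns the integrand into [2 u cos^2 t], with primitive
    [u (t + sin t cos t)]. *)
Lemma integral_semicircle (u : R) : 0 < u ->
  (\int[leb]_(y in `[(- Num.sqrt u)%R, (Num.sqrt u)%R]) (2 * Num.sqrt (u - y ^+ 2))%:E = (pi * u)%:E)%E.
Proof.
move=> u0; set r := Num.sqrt u.
have r0 : 0 < r by rewrite sqrtr_gt0.
have r2 : r ^+ 2 = u by rewrite sqr_sqrtr// ltW.
pose F (t : R) := r * sin t.
have pih : - (pi / 2) < pi / 2 :> R.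
  by rewrite -subr_gt0 opprK -splitr pi_gt0.
have dF (t : R) : is_derive t 1 F (r * cos t).
  by apply: is_derive_eq; rewrite /GRing.scale/=; ring.
have F1 : F^`()%classic = (fun t => r * cos t).
  by apply/funext => t; rewrite derive1E; have [_ ->] := dF t.
have cF : continuous F.
  by move=> t; apply/differentiable_continuous/derivable1_diffP; have [] := dF t.
have cF1 : continuous (fun t => r * cos t).
  by move=> t; apply/differentiable_continuous/derivable1_diffP; apply: ex_derive.
have -> : - r = F (- (pi / 2)) by rewrite /F sinN sin_pihalf mulrN1.
have -> : r = F (pi / 2) by rewrite /F sin_pihalf mulr1.
rewrite integration_by_substitution_increasing; last first.
- apply: continuous_subspaceT => y.
  apply: cvgM; first exact: cvg_cst.
  apply: (@cvg_comp _ _ _ (fun y => u - y ^+ 2) Num.sqrt _ (nbhs (u - y ^+ 2))); last exact: sqrt_continuous.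
  by apply: cvgB; [exact: cvg_cst|exact: exprn_continuous].
- split.
  + by move=> t _; have [] := dF t.
  + by apply: cvg_at_right_filter; exact: cF.
  + by apply: cvg_at_left_filter; exact: cF.
- rewrite F1; apply/cvg_ex; eexists; apply: cvg_at_left_filter; exact: cF1.
- rewrite F1; apply/cvg_ex; eexists; apply: cvg_at_right_filter; exact: cF1.
- by rewrite F1 => t _; exact: cF1.
- move=> x y xI yI xy; rewrite /F ltr_pM2l//.
  by rewrite ltr_sin.
- exact: ltW.
pose G (t : R) := u * (t + sin t * cos t).
have dG (t : R) : is_derive t 1 G (2 * u * cos t ^+ 2).
  apply: is_derive_eq; rewrite /GRing.scale/=.
  have -> : 2 * u * cos t ^+ 2 = u * (1 + cos t ^+ 2 - sin t ^+ 2).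
    have -> : sin t ^+ 2 = 1 - cos t ^+ 2 by rewrite -(cos2Dsin2 t) addrC addKr.
    by ring.
  by ring.
rewrite (_ : (\int[_]_(x in _) _)%E =
   (\int[leb]_(t in `[(- (pi / 2))%R, (pi / 2)%R]) (2 * u * cos t ^+ 2)%:E)%E); last first.
  apply: eq_integral => t; rewrite inE/= in_itv/= => tI; congr EFin.
  rewrite F1; change (2 * Num.sqrt (u - (r * sin t) ^+ 2) * (r * cos t) = 2 * u * cos t ^+ 2).
  rewrite exprMn r2.
  have -> : u - u * sin t ^+ 2 = u * cos t ^+ 2 by have := cos2Dsin2 t; nra.
  have c0 : 0 <= cos t by apply: cos_ge0_pihalf.
  rewrite sqrtrM ?ltW// sqrtr_sqr ger0_norm// -/r.
  rewrite [LHS](_ : _ = 2 * r ^+ 2 * cos t ^+ 2); last by ring.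
  by rewrite r2.
rewrite (@continuous_FTC2 _ _ G)//.
- rewrite /G -EFinB sinN cosN cos_pihalf; congr EFin.
  by rewrite !mulr0 !addr0; field.
- apply: continuous_subspaceT => t.
  by apply/differentiable_continuous/derivable1_diffP; apply: ex_derive.
- have cG : continuous G.
    by move=> t; apply/differentiable_continuous/derivable1_diffP; have [] := dG t.
  split.
  + by move=> t _; have [] := dG t.
  + by apply: cvg_at_right_filter; exact: cG.
  + by apply: cvg_at_left_filter; exact: cG.
- by move=> t _; rewrite derive1E; have [_ ->] := dG t.
Qed.

Definition sqnorm2 (p : R * R) : R := p.1 ^+ 2 + p.2 ^+ 2.

Lemma measurable_sqnorm2 : measurable_fun setT sqnorm2.
Proof.
apply: measurable_funD; apply: measurable_funX;
  [exact: measurable_fst|exact: measurable_snd].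
Qed.

Lemma disk_area (u : R) :
  (leb \x leb)%E [set p | sqnorm2 p <= u] = (pi * Num.max u 0)%:E.
Proof.
have sec a : leb (xsection [set p | sqnorm2 p <= u] a) = (2 * Num.sqrt (u - a ^+ 2))%:E.
  have [ua|ua] := ltP (u - a ^+ 2) 0.
    rewrite (_ : xsection _ _ = set0).
      by rewrite measure0 ler0_sqrtr ?mulr0// ltW.
    apply/seteqP; split => // b; rewrite /xsection/= inE/= /sqnorm2/= => ab.
    by have := sqr_ge0 b; lra.
  rewrite (_ : xsection _ _ = `[- Num.sqrt (u - a ^+ 2), Num.sqrt (u - a ^+ 2)]%classic).
    rewrite lebesgue_measure_itv/= lte_fin; case: ltP => h.
      by rewrite -EFinB; congr EFin; ring.
    by congr EFin; have := sqrtr_ge0 (u - a ^+ 2); lra.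
  apply/seteqP; split => b; rewrite /xsection/= inE/= /sqnorm2/= in_itv/= -ler_norml => H.
    by rewrite -sqrtr_sqr ler_sqrt//; lra.
  by move: H; rewrite -sqrtr_sqr ler_sqrt//; lra.
rewrite /product_measure1/=; under eq_integral do rewrite sec.
have [u0|u0] := ltP 0 u; last first.
  rewrite mulr0; apply: integral0_eq => a _.
  by rewrite ler0_sqrtr ?mulr0//; have := sqr_ge0 a; lra.
rewrite -integral_semicircle// [RHS]integral_mkcond.
apply: eq_integral => a _; rewrite patchE; case: ifPn => //.
rewrite notin_setE/= in_itv/= -ler_norml => /negP; rewrite -ltNge => H.
rewrite ler0_sqrtr ?mulr0// subr_le0 -(real_normK (num_real a)).
by rewrite -[leLHS](sqr_sqrtr (ltW u0)) lerXn2r ?nnegrE ?sqrtr_ge0 ?normr_ge0 ?ltW.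
Qed.

(** In the squared radius the planar measure is uniform, since a disk of squared radius [u] has area
    [pi u]. Uniqueness of Lebesgue measure needs a comparison on the whole line, so the image
    divided by [pi] is completed by Lebesgue measure itself on the nonpositive half-line. *)
Lemma radial_image (A : set R) : measurable A ->
  (leb \x leb)%E (sqnorm2 @^-1` A) = (pi%:E * leb (A `&` `]0%R, +oo[))%E.
Proof.
move=> mA.
have mq B : measurable B -> measurable (sqnorm2 @^-1` B).
  by move=> mB; rewrite -[X in measurable X]setTI; exact: measurable_sqnorm2.
have pi0 : 0 <= pi^-1 :> R by rewrite invr_ge0 pi_ge0.
pose q := @measure_function_pushforward__canonical__measure_function_Measure
  _ _ _ (measurableTypeR R) _ (leb \x leb)%E sqnorm2 measurable_sqnorm2.
have mneg : measurable (`]-oo, 0] : set R) by exact: measurable_itv.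
pose m' := measure_add (mscale (NngNum pi0) q) (mrestr leb mneg).
have m'E B : m' B = ((pi^-1)%:E * (leb \x leb)%E (sqnorm2 @^-1` B) + leb (B `&` `]-oo, 0%R]))%E.
  by rewrite /m' /measure_add/= /msum big_ord_recl big_ord1/=.
have disk b : (leb \x leb)%E (sqnorm2 @^-1` `]-oo, b]) = (pi * Num.max b 0)%:E.
  by rewrite -disk_area; congr ((leb \x leb)%E _).
have lebm' B : measurable B -> leb B = m' B.
  move=> mB; apply: lebesgue_measure_unique => // _ [[a b] _ <-]/=.
  apply: (@etrans _ _ _ _ _ (esym (m'E _))).
  have [ab|ba] := ltP a b; last first.
    by rewrite set_itv_ge ?preimage_set0 ?set0I ?measure0 ?mule0 ?adde0// bnd_simp -leNgt.
  have -> : (leb \x leb)%E (sqnorm2 @^-1` `]a, b]) = (pi * Num.max b 0 - pi * Num.max a 0)%:E.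
    have -> : sqnorm2 @^-1` `]a, b] = sqnorm2 @^-1` `]-oo, b] `\` sqnorm2 @^-1` `]-oo, a].
      apply/seteqP; split => p /=; rewrite !in_itv/=.
        by move=> /andP[ap pb]; split => //; apply/negP; rewrite -ltNge.
      by move=> [-> /negP]; rewrite -ltNge => ->.
    rewrite measureD.
    - rewrite EFinB -(disk b) -(disk a) (_ : _ `&` _ = sqnorm2 @^-1` `]-oo, a])//.
      apply/seteqP; split => p /=; rewrite !in_itv/=; first by move=> [].
      by move=> pa; split => //; exact: le_trans pa (ltW ab).
    - by apply: mq; exact: measurable_itv.
    - by apply: mq; exact: measurable_itv.
    - by apply: (le_lt_trans (y := (pi * Num.max b 0)%:E)); rewrite ?ltry// -disk.
  have -> : leb (`]a, b] `&` `]-oo, 0%R]) = (Num.min b 0 - Num.min a 0)%:E.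
    rewrite (_ : _ `&` _ = `]a, (Num.min b 0)]%classic); last first.
      apply/seteqP; split => x /=; rewrite !in_itv/= le_min.
        by move=> [/andP[-> ->]].
      by move=> /and3P[-> -> ->].
    rewrite lebesgue_measure_itv/= lte_fin lt_min ab/=.
    by case: ltP => a0; rewrite // (min_r (ltW (le_lt_trans a0 ab))) subrr.
  rewrite lebesgue_measure_itv/= lte_fin ab -EFinB -EFinM -EFinD; congr EFin.
  rewrite mulrBr !mulrA mulVf ?gt_eqF ?pi_gt0// !mul1r.
  by rewrite /Num.max /Num.min; case: ifP; case: ifP; lra.
have mpos : measurable (`]0, +oo[ : set R) by exact: measurable_itv.
rewrite lebm'; last exact: measurableI.
rewrite m'E -setIA (_ : _ `&` `]-oo, 0] = set0) ?setI0 ?measure0 ?adde0; last first.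
  by apply/seteqP; split => // x /=; rewrite !in_itv/= andbT => -[]; lra.
rewrite muleA -EFinM mulfV ?gt_eqF ?pi_gt0// mul1e.
apply/eqP; rewrite eq_le; apply/andP; split; last first.
  apply: le_measure; rewrite ?inE; last by move=> p [].
    by apply: mq; exact: measurableI.
  exact: mq.
(* This preimage is the origin alone, so restricting to positive squared norms loses no mass. *)
have n0 : (leb \x leb)%E (sqnorm2 @^-1` `]-oo, 0]) = 0%E.
  by rewrite disk maxxx mulr0.
rewrite -[leRHS](measureU0 _ _ n0).
- apply: le_measure; rewrite ?inE.
  + exact: mq.
  + by apply: measurableU; [apply: mq; exact: measurableI|apply: mq; exact: measurable_itv].
  + move=> p Ap; have [p0|p0] := ltP 0 (sqnorm2 p).
      by left; split => //=; rewrite in_itv/= p0.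
    by right; rewrite /= in_itv.
- by apply: mq; exact: measurableI.
- apply: mq; exact: measurable_itv.
Qed.

Lemma integral_radial (g : R -> \bar R) :
  measurable_fun setT g -> (forall u, 0 <= g u)%E ->
  (\int[leb \x leb]_p g (sqnorm2 p) = pi%:E * \int[leb]_(u in `]0%R, +oo[) g u)%E.
Proof.
move=> mg g0.
transitivity (\int[leb \x leb]_p (g (sqnorm2 p) * 1))%E.
  by apply: eq_integral => p _; rewrite mule1.
rewrite (@eq_weighted_image_integral _ _ _ _ _ R R (leb \x leb)%E leb sqnorm2 idfun (cst 1%E)
   (fun u => pi%:E * (\1_(`]0, +oo[) u)%:E)%E g) //.
- rewrite [in RHS]integral_mkcond epatch_indic -ge0_integralZl//.
  + by apply: eq_integral => u _; rewrite /= muleCA.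
  + by apply: emeasurable_funM => //; exact/measurable_EFinP.
  + by move=> u _; rewrite mule_ge0// lee_fin.
  + by rewrite lee_fin pi_ge0.
- exact: measurable_sqnorm2.
- exact: measurable_id.
- by apply: emeasurable_funM => //; exact/measurable_EFinP.
- by move=> u; rewrite mule_ge0// lee_fin// pi_ge0.
- move=> A mA; rewrite integral_cst//; last first.
    by rewrite -[X in measurable X]setTI; exact: measurable_sqnorm2.
  rewrite mul1e; apply: (etrans (radial_image mA)).
  rewrite ge0_integralZl// ?lee_fin ?pi_ge0//; last first.
    exact/measurable_EFinP.
  by rewrite integral_indic// setIC.
Qed.

(** One minus the Laplace transform [1 / (1 + y)] of an Exp(1) mark; this is the density of the
    Laplace exponent at a point of normalized power [y]. *)
Lemma mark_integral (y : R) : 0 <= y ->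
  (\int[leb]_v ((1 - expR (- (v * y))) * exp1_dens v)%:E = (y / (1 + y))%:E)%E.
Proof.
move=> y0.
have y1 : 0 < 1 + y by lra.
pose f (v : R) := expR (- v) - expR (- ((1 + y) * v)).
pose F (v : R) := - expR (- v) + expR (- ((1 + y) * v)) / (1 + y).
have -> : (\int[leb]_v ((1 - expR (- (v * y))) * exp1_dens v)%:E =
    \int[leb]_(v in `[0%R, +oo[) (f v)%:E)%E.
  rewrite [RHS]integral_mkcond; apply: eq_integral => v _; rewrite patchE /exp1_dens.
  have -> : (v \in `[0, +oo[%classic) = (0 <= v) by rewrite mem_setE in_itv/= andbT.
  case: ifP => // v0; last by rewrite mulr0.
  congr EFin; rewrite /f mulrBl mul1r -expRD; congr (_ - expR _); ring.
have dF (v : R) : is_derive v 1 F (f v).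
  apply: is_derive_eq; rewrite /f /GRing.scale/=.
  by field; rewrite gt_eqF.
have cf : continuous f.
  by move=> v; apply/differentiable_continuous/derivable1_diffP; apply: ex_derive.
rewrite (@ge0_continuous_FTC2y _ _ F _ 0).
- rewrite /F mulr0 oppr0 expR0 -EFinB; congr EFin; field.
  by rewrite gt_eqF.
- move=> v v0; rewrite /f subr_ge0 ler_expR lerN2; nra.
- exact: continuous_subspaceT.
- rewrite -[X in _ --> X](_ : - 0 + 0 / (1 + y) = 0); last by rewrite oppr0 mul0r addr0.
  apply: cvgD; first by apply: cvgN; exact: cvgr_expR.
  apply: cvgMl.
  apply: (@cvg_comp _ _ _ (fun v => (1 + y) * v) (fun x => expR (- x)) _ (+oo)); last exact: cvgr_expR.
  exact: gt0_cvgMry.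
- by move=> v _; have [] := dF v.
- apply: cvg_at_right_filter.
  by apply/differentiable_continuous/derivable1_diffP; have [] := dF 0.
- by move=> v _; rewrite derive1E; have [_ ->] := dF v.
Qed.

End Radial.

(** * Ratio test, rising factorials and decay at infinity *)

Section RatioTest.
Context {R : realType}.

Lemma cvg0_ratio (u t : nat -> R) (w : R) :
  (forall n, 0 <= u n) -> (forall n, u n.+1 = u n * t n) -> (forall n, 0 <= t n) ->
  t @ \oo --> w -> w < 1 -> u @ \oo --> 0.
Proof.
move=> u0 ut t0 tw w1.
pose r := (w + 1) / 2.
have wr : w < r by rewrite /r; lra.
have r1 : r < 1 by rewrite /r; lra.
have w0 : 0 <= w by apply: (cvgr_to_ge tw); exact: nearW.
have [N _ tN] : \forall n \near \oo, t n <= r.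
  by apply: (cvgr_le w).
have uN k : u (k + N)%N <= u N * r ^+ k.
  elim: k => [|k IH]; first by rewrite mulr1.
  rewrite addSn ut exprSr mulrA; apply: ler_pM => //.
  by apply: tN; rewrite /=; lia.
rewrite -(cvg_shiftn N).
apply: (squeeze_cvgr (f := fun=> 0) (h := fun k => u N * r ^+ k)).
- by apply: nearW => k; rewrite u0 uN.
- exact: cvg_cst.
- apply: cvg_geometric; rewrite ger0_norm//; lra.
Qed.

Lemma cvg_ratio_shift (a b : R) : 0 < b ->
  (a + n%:R) / (b + n%:R) @[n --> \oo] --> (1 : R).
Proof.
move=> b0.
have H : (a - b) * (b + n%:R)^-1 @[n --> \oo] --> (a - b) * 0.
  apply: cvgMr; apply/gtr0_cvgV0; first by apply: nearW => n; rewrite ltr_wpDr.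
  apply/cvgryPge => A; near=> n; rewrite addrC -lerBlDr.
  by near: n; exact: nbhs_infty_ger.
have -> : (fun n : nat => (a + n%:R) / (b + n%:R)) = (fun n => 1 + (a - b) * (b + n%:R)^-1).
  by apply/funext => n; field; rewrite gt_eqF// ltr_wpDr.
rewrite -[X in _ --> X](_ : 1 + (a - b) * 0 = 1); last by rewrite mulr0 addr0.
exact: (cvgD (cvg_cst (1 : R)) H).
Unshelve. all: by end_near. Qed.

Lemma risingS (a : R) n : rising a n.+1 = rising a n * (a + n%:R).
Proof. by rewrite /rising big_ord_recr. Qed.

Lemma rising0 (a : R) : rising a 0 = 1.
Proof. by rewrite /rising big_ord0. Qed.

Lemma rising_gt0 (a : R) n : 0 < a -> 0 < rising a n.
Proof. by move=> a0; apply: prodr_gt0 => i _; rewrite ltr_wpDr. Qed.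

Lemma rising_ge0 (a : R) n : 0 <= a -> 0 <= rising a n.
Proof. by move=> a0; apply: prodr_ge0 => i _; rewrite addr_ge0. Qed.

Lemma risingSl (a : R) n : rising a n.+1 = a * rising (a + 1) n.
Proof.
rewrite /rising big_ord_recl addr0; congr (_ * _); apply: eq_bigr => i _.
by rewrite /= /bump/= add1n -natr1 addrAC addrA.
Qed.

Lemma rising1 n : rising 1 n = n`!%:R :> R.
Proof.
elim: n => [|n IH]; first by rewrite rising0.
by rewrite risingS IH factS natrM mulrC nat1r.
Qed.

End RatioTest.

Section PowerTail.
Context {R : realType}.

Lemma cvg_powRN (a : R) : 0 < a -> u `^ (- a) @[u --> +oo] --> (0 : R).
Proof.
move=> a0; apply/cvgrPdist_le => e e0; near=> u.
have u0 : 0 < u by near: u; exact: nbhs_pinfty_gt.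
rewrite sub0r normrN ger0_norm ?powR_ge0// powRN.
rewrite -[leRHS]invrK lef_pV2 ?posrE ?invr_gt0 ?powR_gt0//.
have : (e^-1) `^ (a^-1) <= u by near: u; apply: nbhs_pinfty_ge; exact: num_real.
move=> H; rewrite -[leLHS]powRr1 ?invr_ge0 ?(ltW e0)// -(mulVf (lt0r_neq0 a0)) powRrM.
by apply: ge0_ler_powR; rewrite ?nnegrE ?powR_ge0 ?(ltW a0) ?(ltW u0).
Unshelve. all: by end_near. Qed.

End PowerTail.

Section DeriveX.
Context {R : realType}.

Lemma is_derive_fun_exp (f : R -> R) (n : nat) (x df : R) :
  is_derive x 1 f df ->
  is_derive x 1 (fun u => f u ^+ n.+1) (n.+1%:R * f x ^+ n * df).
Proof. by move=> H; have := @is_deriveX _ _ f n.+1 x 1 df H; rewrite exprfctE. Qed.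

End DeriveX.

(** * Hypergeometric integrals *)

Section Hyper.
Context {R : realType}.
Local Notation leb := (@lebesgue_measure R).
Variables (al kap u0 : R).
Hypothesis al2 : 2 < al.
Hypothesis kap0 : 0 < kap.
Hypothesis u00 : 0 < u0.

Local Notation de := (2 / al).
(** The transform variable times the mean received power, as a function of the squared distance [u];
    [kap] collects the transform variable and the transmit power. Its value [tau] at the edge [u0]
    becomes the hypergeometric argument. *)
Definition decay (u : R) : R := kap * u `^ (- (al / 2)).
Local Notation y := decay.
Local Notation tau := (decay u0).

Local Lemma al0 : 0 < al. Proof. exact: lt_trans al2. Qed.
Local Lemma de01 : 0 < de < 1. Proof. by apply/andP; split; [rewrite divr_gt0// al0|rewrite ltr_pdivrMr ?al0// mul1r]. Qed.
Local Lemma de0 : 0 < de. Proof. by case/andP: de01. Qed.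
Local Lemma de1 : de < 1. Proof. by case/andP: de01. Qed.

Local Lemma pde p : (0 < p)%N -> 0 < p%:R - de.
Proof.
move=> p0; have p1 : 1 <= p%:R :> R by rewrite ler1n.
by have := de1; lra.
Qed.

Lemma decay_gt0 u : 0 < u -> 0 < decay u.
Proof. by move=> u1; rewrite mulr_gt0// powR_gt0. Qed.

Lemma decay_ge0 u : 0 <= decay u.
Proof. by rewrite mulr_ge0// ?powR_ge0// ltW. Qed.

Lemma decay_nincr u v : 0 < u -> u <= v -> decay v <= decay u.
Proof.
move=> u1 uv; rewrite /decay ler_pM2l// !powRN lef_pV2 ?posrE ?powR_gt0//; last by lra.
apply: ge0_ler_powR; rewrite ?nnegrE; [|lra|lra|lra].
by rewrite divr_ge0// (ltW al0).
Qed.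

Local Lemma tau0 : 0 < tau. Proof. exact: decay_gt0. Qed.

Local Lemma is_derive_decay (u : R) : 0 < u -> is_derive u 1 y (- (al / 2) * y u / u).
Proof.
move=> u1; have H := @is_derive1_powR _ (- (al / 2)) u u1.
apply: is_derive_eq; rewrite /GRing.scale/= /y /decay powRD ?(gt_eqF u1) ?implybT//.
by rewrite powR_inv1 ?ltW//; ring.
Qed.

(** The primitive of [y^(p+1)] that vanishes at infinity; its denominator is positive because
    [al > 2]. *)
Local Definition decay_prim p (u : R) := - (u * y u ^+ p.+1) / ((al / 2) * p.+1%:R - 1).

Local Lemma A0 p : 0 < (al / 2) * p.+1%:R - 1.
Proof.
have p1 : 1 <= p.+1%:R :> R by rewrite ler1n.
by have := al2; nra.
Qed.

Local Lemma is_derive_decay_prim p (u : R) : 0 < u -> is_derive u 1 (decay_prim p) (y u ^+ p.+1).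
Proof.
move=> u1; have Hy := is_derive_decay u1; have Ap := A0 p.
have Hp := is_derive_fun_exp p Hy.
rewrite /decay_prim; apply: is_derive_eq; rewrite /GRing.scale/= exprS.
move: (p.+1%:R) Ap => q Ap.
have Ap' : al * q - 2 != 0 by rewrite gt_eqF//; move: Ap; lra.
field.
by rewrite Ap' (gt_eqF u1).
Qed.

(** The boundary term of the integration by parts that relates the exponents [(p+1, q+1)] to
    [(p+2, q+2)]. *)
Local Definition decay_parts p q (u : R) := u * y u ^+ p.+1 * ((1 + y u) ^+ q.+1)^-1.

Local Lemma is_derive_decay_parts p q (u : R) : 0 < u -> is_derive u 1 (decay_parts p q)
  ((1 - (al / 2) * p.+1%:R) * (y u ^+ p.+1 / (1 + y u) ^+ q.+1)
   + (al / 2) * q.+1%:R * (y u ^+ p.+2 / (1 + y u) ^+ q.+2)).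
Proof.
move=> u1; have Hy := is_derive_decay u1; have y1 : 0 < 1 + y u by rewrite addr_gt0// decay_gt0.
have HV : is_derive u 1 (fun v => ((1 + y v) ^+ q.+1)^-1)
    (- (q.+1%:R * (1 + y u) ^+ q * (- (al / 2) * y u / u)) / ((1 + y u) ^+ q.+1) ^+ 2).
  have := @is_deriveV _ (fun v => (1 + y v) ^+ q.+1) u
     (q.+1%:R * (1 + y u) ^+ q * (- (al / 2) * y u / u)) 1.
  rewrite /GRing.scale/= => H; apply: is_derive_eq.
    apply: H; first by rewrite gt_eqF// exprn_gt0.
    have H1 : is_derive u 1 (fun v => 1 + y v) (- (al / 2) * y u / u).
      apply: is_derive_eq.
      by rewrite add0r mul1r.
    exact: is_derive_fun_exp.
  by ring.
have Hp := is_derive_fun_exp p Hy.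
rewrite /decay_parts; apply: is_derive_eq; rewrite /GRing.scale/= !exprS.
have yq : (1 + y u) ^+ q != 0 by rewrite gt_eqF// exprn_gt0.
by field; rewrite yq !gt_eqF.
Qed.

Definition decay_int (p q : nat) : \bar R :=
  (\int[leb]_(u in `[u0, +oo[) (y u ^+ p / (1 + y u) ^+ q)%:E)%E.

Lemma measurable_decay_ratio p q : measurable_fun setT (fun u => y u ^+ p / (1 + y u) ^+ q).
Proof.
have my : measurable_fun setT y.
  by apply: measurable_funM => //; exact: measurable_powR.
apply: measurable_funM; first exact: measurable_funX.
rewrite (_ : (fun x => _) = (fun x => (1 + y x) `^ (- q%:R))); last first.
  by apply/funext => x; rewrite powR_invn// addr_ge0// decay_ge0.
by apply: (measurableT_comp (measurable_powR _)); exact: measurable_funD.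
Qed.

Local Lemma int_ge0 p q u : 0 <= y u ^+ p / (1 + y u) ^+ q.
Proof. by rewrite divr_ge0// exprn_ge0// ?addr_ge0// decay_ge0. Qed.

Local Lemma cvg_decay_prim p : decay_prim p u @[u --> +oo] --> 0.
Proof.
rewrite -[X in _ --> X](_ : - 0 / ((al / 2) * p.+1%:R - 1) = 0); last by rewrite oppr0 mul0r.
apply: cvgMl; apply: cvgN.
have -> : 0 = kap ^+ p.+1 * 0 :> R by rewrite mulr0.
apply: (@cvg_trans _ (kap ^+ p.+1 * u `^ (- ((al / 2) * p.+1%:R - 1)) @[u --> +oo])).
  apply: near_eq_cvg; near=> u.
  have u1 : 0 < u by near: u; exact: nbhs_pinfty_gt.
  rewrite /decay exprMn -(@powR_mulrn _ (u `^ _)) ?powR_ge0// -powRrM mulrCA; congr (_ * _).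
  rewrite -[X in _ = X * _](@powRr1 _ u (ltW u1)) -powRD ?(gt_eqF u1) ?implybT//.
  by congr powR; ring.
by apply: cvgMr; apply: cvg_powRN; exact: A0.
Unshelve. all: by end_near. Qed.

Lemma decay_int0 p : decay_int p.+1 0 = (u0 * de * tau ^+ p.+1 / (p.+1%:R - de))%:E.
Proof.
have Ap := A0 p.
rewrite /decay_int; under eq_integral do rewrite expr0 divr1.
rewrite (@ge0_continuous_FTC2y _ _ (decay_prim p) _ 0).
- rewrite -EFinB /decay_prim; congr EFin.
  move: (p.+1%:R) Ap => q Ap.
  have Ap' : al * q - 2 != 0 by rewrite gt_eqF//; move: Ap; lra.
  have Aq : q * al - 2 != 0 by rewrite mulrC.
  field.
  by rewrite Aq gt_eqF// al0.
- by move=> u _; rewrite exprn_ge0// decay_ge0.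
- apply: continuous_in_subspaceT => u; rewrite inE/= in_itv/= andbT => uu.
  have Hp := is_derive_fun_exp p (is_derive_decay (lt_le_trans u00 uu)).
  by apply/differentiable_continuous/derivable1_diffP; have [] := Hp.
- exact: cvg_decay_prim.
- by move=> u uu; have [] := is_derive_decay_prim p (lt_trans u00 uu).
- apply: cvg_at_right_filter; apply/differentiable_continuous/derivable1_diffP.
  by have [] := is_derive_decay_prim p u00.
- move=> u; rewrite in_itv/= andbT => uu; rewrite derive1E.
  by have [_ ->] := is_derive_decay_prim p (lt_trans u00 uu).
Qed.

Lemma decay_int_split p q : (decay_int p q = decay_int p q.+1 + decay_int p.+1 q.+1)%E.
Proof.
rewrite /decay_int -ge0_integralD//; last 4 first.
- by move=> u _; rewrite lee_fin int_ge0.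
- by apply/measurable_EFinP; exact: measurable_funS (measurable_decay_ratio _ _).
- by move=> u _; rewrite lee_fin int_ge0.
- by apply/measurable_EFinP; exact: measurable_funS (measurable_decay_ratio _ _).
apply: eq_integral => u _; rewrite -EFinD; congr EFin.
have y1 : 1 + y u != 0 by rewrite gt_eqF// ltr_pwDl// decay_ge0.
by rewrite !exprS; field; rewrite y1 expf_neq0.
Qed.

Lemma decay_int_le p q : (decay_int p q <= decay_int p 0)%E.
Proof.
elim: q => // q; apply: le_trans; rewrite (decay_int_split p q) leeDl//.
by apply: integral_ge0 => u _; rewrite lee_fin int_ge0.
Qed.

Local Lemma fin_int p q : decay_int p.+1 q \is a fin_num.
Proof.
rewrite ge0_fin_numE; last by apply: integral_ge0 => u _; rewrite lee_fin int_ge0.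
by apply: le_lt_trans (decay_int_le _ _) _; rewrite decay_int0 ltry.
Qed.

Local Definition decay_val p q := fine (decay_int p q).

Local Lemma decay_valE p q : decay_int p.+1 q = (decay_val p.+1 q)%:E.
Proof. by rewrite fineK// fin_int. Qed.

Local Lemma decay_val_ge0 p q : 0 <= decay_val p q.
Proof. by apply: fine_ge0; apply: integral_ge0 => u _; rewrite lee_fin int_ge0. Qed.

Local Definition decay_head p := u0 * de * tau ^+ p / (p%:R - de).

Local Lemma decay_val0 p : decay_val p.+1 0 = decay_head p.+1. Proof. by rewrite /decay_val decay_int0. Qed.

Local Lemma decay_val_split p q : decay_val p.+1 q = decay_val p.+1 q.+1 + decay_val p.+2 q.+1.
Proof. by apply: EFin_inj; rewrite EFinD -!decay_valE -decay_int_split. Qed.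

Local Lemma decay_val_le p q : decay_val p.+1 q <= decay_head p.+1.
Proof. by rewrite -lee_fin -decay_valE -decay_val0 -decay_valE decay_int_le. Qed.

(** Integration by parts that raises both exponents at once. Each application splits off one
    boundary term, and these terms will form the Pfaff-transformed hypergeometric series. *)
Local Lemma decay_val_rec p q : decay_val p.+1 q.+1 = de / (p.+1%:R - de) * (u0 * tau ^+ p.+1 / (1 + tau) ^+ q.+1)
   + q.+1%:R / (p.+1%:R - de) * decay_val p.+2 q.+2.
Proof.
have y1 u : 0 < 1 + y u by rewrite ltr_pwDl// decay_ge0.
pose A := al / 2 * p.+1%:R - 1; pose B := al / 2 * q.+1%:R.
have Apos : 0 < A by exact: A0.
have Bpos : 0 < B by rewrite mulr_gt0// divr_gt0// al0.
(* The derivative of [- decay_parts] has no definite sign. Adding [B] times the primitive of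
   [y^(p+1)], whose integral is explicit, makes the integrand nonnegative, as integration over a
   half-line by primitives requires here. *)
pose F (u : R) := - decay_parts p q u + B * decay_prim p u.
pose f (u : R) := A * (y u ^+ p.+1 / (1 + y u) ^+ q.+1)
  - B * (y u ^+ p.+2 / (1 + y u) ^+ q.+2) + B * (y u ^+ p.+1).
have dF (u : R) : 0 < u -> is_derive u 1 F (f u).
  move=> u1; have dGu := is_derive_decay_parts p q u1; have dWu := is_derive_decay_prim p u1.
  apply: is_derive_eq; rewrite /GRing.scale/= /f /A /B; ring.
have f0 u : 0 <= f u.
  have b_le : y u ^+ p.+2 / (1 + y u) ^+ q.+2 <= y u ^+ p.+1.
    rewrite ler_pdivrMr ?exprn_gt0// exprSr ler_wpM2l ?exprn_ge0 ?decay_ge0//.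
    apply: (le_trans (y := 1 + y u)); first by rewrite lerDr.
    by apply: ler_eXnr => //; rewrite lerDl decay_ge0.
  have a0 := int_ge0 p.+1 q.+1 u.
  rewrite /f -addrA addr_ge0//; first by rewrite mulr_ge0// ltW.
  by rewrite addrC subr_ge0 ler_pM2l.
have cG : decay_parts p q u @[u --> +oo] --> 0.
  have c1 : - A * decay_prim p u @[u --> +oo] --> 0.
    by rewrite -[X in _ --> X](mulr0 (- A)); apply: cvgMr; exact: cvg_decay_prim.
  apply: (squeeze_cvgr (f := fun=> 0) (h := fun u => - A * decay_prim p u)) => //; last exact: cvg_cst.
  near=> u; have u1 : 0 < u by near: u; exact: nbhs_pinfty_gt.
  have q1 : 1 <= (1 + y u) ^+ q.+1 by rewrite exprn_ege1// lerDl decay_ge0.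
  rewrite /decay_parts divr_ge0 ?exprn_ge0 ?(ltW (y1 u)) ?mulr_ge0 ?exprn_ge0 ?decay_ge0 ?(ltW u1)//=.
  have -> : - A * decay_prim p u = u * y u ^+ p.+1.
    by rewrite /decay_prim -/A mulrA mulrNN mulrAC mulfV ?mul1r// gt_eqF.
  rewrite ler_pdivrMr ?(lt_le_trans ltr01)// ler_peMr//.
  by rewrite mulr_ge0 ?exprn_ge0 ?decay_ge0 ?(ltW u1).
have intf : (\int[leb]_(u in `[u0, +oo[) (f u)%:E = (decay_parts p q u0 - B * decay_prim p u0)%:E)%E.
  rewrite (@ge0_continuous_FTC2y _ _ F _ 0)//.
  - by rewrite -EFinB /F; congr EFin; ring.
  - apply: continuous_in_subspaceT => u; rewrite inE/= in_itv/= andbT => uu.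
    have u1 := lt_le_trans u00 uu.
    have Hy := is_derive_decay u1.
    have cy : {for u, continuous y}.
      by apply/differentiable_continuous/derivable1_diffP; apply: ex_derive.
    have cpow (h : R -> R) a : {for u, continuous h} -> {for u, continuous (fun v => h v ^+ a)}.
      move=> ch; exact: (@continuous_comp _ _ _ h (fun x => x ^+ a) u ch (@exprn_continuous _ _ _)).
    have cq (a b : nat) : {for u, continuous (fun v => y v ^+ a / (1 + y v) ^+ b)}.
      apply: continuousM; first exact: cpow.
      apply: continuousV; first by rewrite expf_neq0// gt_eqF.
      by apply: (cpow (fun v => 1 + y v)); apply: continuousD => //; exact: cst_continuous.
    have cc (c : R) (h : R -> R) : {for u, continuous h} -> {for u, continuous (fun v => c * h v)}.
      by move=> ch; apply: continuousM => //; exact: cst_continuous.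
    rewrite /f; apply: cvgD; last exact: (cc _ _ (cpow _ _ cy)).
    by apply: cvgB; exact: (cc _ _ (cq _ _)).
  - rewrite -[X in _ --> X](_ : - 0 + B * 0 = 0); last by rewrite oppr0 mulr0 addr0.
    by apply: cvgD; [exact: cvgN|apply: cvgMr; exact: cvg_decay_prim].
  - by move=> u uu; have [] := dF u (lt_trans u00 uu).
  - apply: cvg_at_right_filter; apply/differentiable_continuous/derivable1_diffP.
    by have [] := dF u0 u00.
  - move=> u; rewrite in_itv/= andbT => uu; rewrite derive1E.
    by have [_ ->] := dF u (lt_trans u00 uu).
have mE a b : measurable_fun `[u0, +oo[ (fun u => (y u ^+ a / (1 + y u) ^+ b)%:E).
  by apply/measurable_EFinP; exact: measurable_funS (measurable_decay_ratio _ _).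
have sc c a b : 0 <= c -> (\int[leb]_(u in `[u0, +oo[) (c * (y u ^+ a.+1 / (1 + y u) ^+ b))%:E =
    (c * decay_val a.+1 b)%:E)%E.
  move=> c0; under eq_integral do rewrite EFinM.
  rewrite ge0_integralZl_EFin//; [by rewrite EFinM -decay_valE| |exact: mE].
  by move=> u _; rewrite lee_fin int_ge0.
have key : A * decay_val p.+1 q.+1 + B * decay_val p.+1 0 = (decay_parts p q u0 - B * decay_prim p u0) + B * decay_val p.+2 q.+2.
  apply: EFin_inj; rewrite EFinD [in RHS]EFinD -intf -!sc ?ltW//.
  have mf : measurable_fun `[u0, +oo[ (fun u => (f u)%:E).
    apply/measurable_EFinP; apply: measurable_funD; first apply: measurable_funB;
      apply: measurable_funM => //.
    - exact: measurable_funS (measurable_decay_ratio _ _).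
    - exact: measurable_funS (measurable_decay_ratio _ _).
    - rewrite (_ : (fun x => y x ^+ p.+1) = (fun u => y u ^+ p.+1 / (1 + y u) ^+ 0)).
        exact: measurable_funS (measurable_decay_ratio _ _).
      by apply/funext => u; rewrite expr0 divr1.
  have mc c a b : measurable_fun `[u0, +oo[ (fun u => (c * (y u ^+ a / (1 + y u) ^+ b))%:E).
    apply/measurable_EFinP; apply: measurable_funM => //.
    exact: measurable_funS (measurable_decay_ratio _ _).
  rewrite -!ge0_integralD//; try exact: mf; try exact: mc;
    try (by move=> u _; rewrite lee_fin ?f0// mulr_ge0 ?int_ge0// ltW).
  by apply: eq_integral => u _; rewrite -!EFinD; congr EFin; rewrite /f expr0 divr1; ring.
have WD : decay_prim p u0 = - decay_head p.+1.
  rewrite /decay_prim /decay_head; have := A0 p; move: (p.+1%:R) => r Ar.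
  have Aq : r * al - 2 != 0 by rewrite gt_eqF//; move: Ar; lra.
  by field; rewrite Aq gt_eqF// al0.
rewrite decay_val0 WD /decay_parts in key.
have rd : p.+1%:R - de != 0 by rewrite gt_eqF// pde.
have k1 : A * decay_val p.+1 q.+1 = u0 * tau ^+ p.+1 / (1 + tau) ^+ q.+1 + B * decay_val p.+2 q.+2.
  by move: key; lra.
have AE : A = (p.+1%:R - de) / de.
  by rewrite /A; field; rewrite gt_eqF// al0.
have BE : B = q.+1%:R / de by rewrite /B; field; rewrite gt_eqF// al0.
rewrite AE BE in k1.
apply: (mulfI (x := (p.+1%:R - de) / de)); first by rewrite mulf_neq0// invr_eq0 gt_eqF// de0.
rewrite k1; have dn : de != 0 by rewrite gt_eqF// de0.
move: rd dn; move: (p.+1%:R) (de) => P d' rd dn.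
by field; rewrite rd dn expf_neq0// gt_eqF.
Unshelve. all: by end_near. Qed.

Local Lemma tau1 : 0 < 1 + tau. Proof. by rewrite addr_gt0// tau0. Qed.
Local Notation ww := (tau / (1 + tau)).

(** On the domain [y / (1 + y)] is at most its value [tau / (1 + tau)] at [u0]. This factor, smaller
    than 1, makes the remainder of the iterated recursion decay geometrically. *)
Local Lemma decay_val_decr p q : decay_val p.+2 q.+2 <= ww * decay_val p.+1 q.+1.
Proof.
have y1 u : 0 < 1 + y u by rewrite ltr_pwDl// decay_ge0.
have w0 : 0 <= ww by rewrite divr_ge0// ltW ?tau1 ?tau0.
rewrite -lee_fin EFinM -!decay_valE -ge0_integralZl//; last 2 first.
- by apply/measurable_EFinP; exact: measurable_funS (measurable_decay_ratio _ _).
- by move=> u _; rewrite lee_fin int_ge0.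
apply: ge0_le_integral => //.
- by move=> u _; rewrite lee_fin int_ge0.
- by apply/measurable_EFinP; exact: measurable_funS (measurable_decay_ratio _ _).
- apply: emeasurable_funM => //.
  by apply/measurable_EFinP; exact: measurable_funS (measurable_decay_ratio _ _).
- move=> u; rewrite /= in_itv/= andbT => uu; rewrite -EFinM lee_fin.
  have -> : y u ^+ p.+2 / (1 + y u) ^+ q.+2 =
      (y u / (1 + y u)) * (y u ^+ p.+1 / (1 + y u) ^+ q.+1).
    rewrite [y u ^+ p.+2]exprS [(1 + y u) ^+ q.+2]exprS.
    by field; rewrite expf_neq0 !gt_eqF.
  apply: ler_wpM2r; first exact: int_ge0.
  have := decay_nincr u00 uu; rewrite ler_pdivrMr// mulrAC ler_pdivlMr ?tau1//.
  by move=> ?; rewrite !mulrDr !mulr1 mulrC lerD2r.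
Qed.

Local Lemma decay_val_decrn p q M : decay_val (p + M).+1 (q + M).+1 <= ww ^+ M * decay_val p.+1 q.+1.
Proof.
elim: M => [|M IH]; first by rewrite !addn0 mul1r.
rewrite !addnS exprS -mulrA; apply: le_trans (decay_val_decr _ _) _.
by rewrite ler_wpM2l// divr_ge0// ltW ?tau1 ?tau0.
Qed.

Local Lemma decay_val_pfaff p q M : decay_val p.+1 q.+1 =
  \sum_(0 <= m < M) (de * u0 * rising q.+1%:R m / rising (p.+1%:R - de) m.+1
      * (tau ^+ (p + m).+1 / (1 + tau) ^+ (q + m).+1))
  + rising q.+1%:R M / rising (p.+1%:R - de) M * decay_val (p + M).+1 (q + M).+1.
Proof.
elim: M => [|M IH]; first by rewrite big_geq// !rising0 !addn0 divr1 mul1r add0r.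
rewrite IH big_nat_recr//= -addrA; congr (_ + _).
rewrite !addnS decay_val_rec !risingS.
have b0 : 0 < p.+1%:R - de by exact: pde.
have r0 : rising (p.+1%:R - de) M != 0 by rewrite gt_eqF// rising_gt0.
have e1 : (p + M).+1%:R = p.+1%:R + M%:R :> R by rewrite -natrD addSn.
have e2 : (q + M).+1%:R = q.+1%:R + M%:R :> R by rewrite -natrD addSn.
rewrite e1 e2.
have bM : p.+1%:R - de + M%:R != 0 by rewrite gt_eqF// ltr_wpDr.
have bM' : p.+1%:R + M%:R - de != 0 by rewrite addrAC.
move: r0 bM bM'; move: (rising (p.+1%:R - de) M) (p.+1%:R) (de) => r P d' r0 bM bM'.
have t1 := tau1.
have tq : (1 + tau) ^+ (q + M).+1 != 0 by rewrite expf_neq0// gt_eqF.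
move: tq; move: ((1 + tau) ^+ (q + M).+1) => z z0.
field.
by rewrite r0 bM z0.
Qed.

(** The iterated recursion produces term by term the series of [2F1(q+1, 1; b+1; w)] at
    [w = tau / (1 + tau)]. Its remainder is at most a quotient of rising factorials times [w^M], and
    it vanishes for every [tau > 0] because [w < 1]. *)
Local Lemma decay_val_pfaff_series p q :
  decay_val p.+1 q.+1 = u0 * de * tau ^+ p.+1 / ((p.+1%:R - de) * (1 + tau) ^+ q.+1)
     * hyp2F1_series q.+1%:R 1 (p.+1%:R - de + 1) ww.
Proof.
set b := p.+1%:R - de; have b0 : 0 < b by exact: pde.
have t1 := tau1; have t0 := tau0.
set C := u0 * de * tau ^+ p.+1 / (b * (1 + tau) ^+ q.+1).
have C0 : 0 < C.
  rewrite /C; apply: divr_gt0; last by rewrite mulr_gt0// exprn_gt0.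
  by rewrite mulr_gt0 ?exprn_gt0// mulr_gt0// de0.
have w0 : 0 <= ww by rewrite divr_ge0// ltW.
have w1 : ww < 1 by rewrite ltr_pdivrMr// mul1r ltrDr.
apply: (mulfI (x := C^-1)); first by rewrite invr_eq0 gt_eqF.
rewrite mulKf ?gt_eqF//; apply/esym/cvg_lim => //.
pose rem M := rising q.+1%:R M / rising b M * decay_val (p + M).+1 (q + M).+1.
have -> : series (fun m => rising q.+1%:R m * rising 1 m / (rising (b + 1) m * m`!%:R) * ww ^+ m)
    = (fun M => C^-1 * (decay_val p.+1 q.+1 - rem M)).
  apply/funext => M; rewrite (decay_val_pfaff p q M) /rem addrK /series/= mulr_sumr.
  apply: eq_big_nat => m _; rewrite rising1 risingSl -/b -!addSn !exprD expr_div_n /C.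
  have r0 : rising (b + 1) m != 0 by rewrite gt_eqF// rising_gt0// addr_gt0.
  have f0 : m`!%:R != 0 :> R by rewrite pnatr_eq0 -lt0n fact_gt0.
  have x0 : (1 + tau) ^+ q.+1 != 0 by rewrite expf_neq0// gt_eqF.
  have x1 : (1 + tau) ^+ m != 0 by rewrite expf_neq0// gt_eqF.
  have x2 : tau ^+ p.+1 != 0 by rewrite expf_neq0// gt_eqF.
  have x3 : b != 0 by rewrite gt_eqF.
  have x4 : u0 != 0 by rewrite gt_eqF.
  have x5 : de != 0 by rewrite gt_eqF ?de0.
  move: r0 f0 x0 x1 x2 x3 x4 x5; move: (rising (b + 1) m) (m`!%:R) ((1 + tau) ^+ q.+1)
     ((1 + tau) ^+ m) (tau ^+ p.+1) (tau ^+ m) (b) (de) => z1 z2 z3 z4 z5 z6 z7 z8 *.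
  field; repeat (apply/andP; split => //).
have crem : rem M @[M --> \oo] --> 0.
  have c0 : rising q.+1%:R M / rising b M * ww ^+ M @[M --> \oo] --> 0.
    apply: (cvg0_ratio (t := fun M => (q.+1%:R + M%:R) / (b + M%:R) * ww) (w := ww)) => //.
    - by move=> n; rewrite mulr_ge0 ?exprn_ge0// divr_ge0 ?rising_ge0// ltW.
    - move=> n; rewrite !risingS exprSr.
      have r0 : rising b n != 0 by rewrite gt_eqF// rising_gt0.
      have bn : b + n%:R != 0 by rewrite gt_eqF// ltr_wpDr.
      by field; rewrite r0 bn gt_eqF.
    - by move=> n; rewrite mulr_ge0// divr_ge0// addr_ge0// ltW.
    - by rewrite -[X in _ --> X]mul1r; apply: cvgMl; exact: cvg_ratio_shift.
  apply: (squeeze_cvgr (f := fun=> 0)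
     (h := fun M => rising q.+1%:R M / rising b M * ww ^+ M * decay_val p.+1 q.+1)).
  - apply: nearW => M; rewrite /rem mulr_ge0 ?decay_val_ge0//=; last first.
      by rewrite divr_ge0 ?rising_ge0// ltW.
    rewrite -[leRHS]mulrA ler_wpM2l ?decay_val_decrn//.
    by rewrite divr_ge0 ?rising_ge0// ltW.
  - exact: cvg_cst.
  - by rewrite -[X in _ --> X](mul0r (decay_val p.+1 q.+1)); apply: cvgMl.
rewrite -[X in _ --> X](_ : C^-1 * (decay_val p.+1 q.+1 - 0) = _); last by rewrite subr0.
by apply: cvgMr; apply: cvgB => //; exact: cvg_cst.
Qed.

Local Notation cf q m := (rising (q%:R : R) m / m`!%:R).
(** The binomial expansion of [(1 + y)^(-q)] in powers of [y], multiplied by [y^(p+1)] and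
    integrated term by term up to order [M]; [decay_head (p + m).+1] is the integral of
    [y^(p+m+1)]. *)
Local Definition alt_sum M p q : R := \sum_(0 <= m < M) cf q m * (-1) ^+ m * decay_head (p + m).+1.

Local Lemma cfS q m : cf q.+1 m.+1 = cf q m.+1 + cf q.+1 m.
Proof.
rewrite (risingSl q%:R) natr1 risingS factS natrM.
have f0 : m`!%:R != 0 :> R by rewrite pnatr_eq0 -lt0n fact_gt0.
have m0 : m.+1%:R != 0 :> R by rewrite pnatr_eq0.
move: f0 m0; rewrite -[q.+1%:R]natr1 -[m.+1%:R]natr1 => f0 m0.
by field; rewrite f0 m0.
Qed.

Local Lemma alt_sum_rec M p q : alt_sum M.+1 p q.+1 = alt_sum M.+1 p q - alt_sum M p.+1 q.+1.
Proof.
rewrite /alt_sum big_nat_recl// [in X in _ = X - _]big_nat_recl// !rising0 -addrA.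
congr (_ + _); rewrite -sumrB; apply: eq_big_nat => m _.
by rewrite cfS addSnnS exprS; ring.
Qed.

(* The remainder of the alternating series is controlled by its first omitted
   term, because it satisfies the same two-term recursion as the integrals. *)
Local Lemma decay_val_alt q M p :
  0 <= (-1) ^+ M * (decay_val p.+1 q - alt_sum M p q) <= cf q M * decay_head (p + M).+1.
Proof.
elim: q M p => [|q IHq] M p.
  case: M => [|M].
    by rewrite expr0 mul1r /alt_sum big_geq// subr0 decay_val_ge0 rising0 divr1 mul1r addn0 decay_val_le.
  have r0 m : rising (0%:R : R) m.+1 = 0 by rewrite risingSl mul0r.
  rewrite /alt_sum big_nat_recl// rising0 divr1 mul1r expr0 mul1r addn0 decay_val0.
  rewrite big1; last by move=> m _; rewrite r0 !mul0r.
  by rewrite addr0 subrr mulr0 r0 !mul0r lexx.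
elim: M p => [|M IHM] p.
  by rewrite expr0 mul1r /alt_sum big_geq// subr0 decay_val_ge0 rising0 divr1 mul1r addn0 decay_val_le.
have -> : (-1) ^+ M.+1 * (decay_val p.+1 q.+1 - alt_sum M.+1 p q.+1) =
    (-1) ^+ M.+1 * (decay_val p.+1 q - alt_sum M.+1 p q) + (-1) ^+ M * (decay_val p.+2 q.+1 - alt_sum M p.+1 q.+1).
  by rewrite alt_sum_rec (decay_val_split p q) exprS; ring.
have /andP[a1 a2] := IHq M.+1 p; have /andP[b1 b2] := IHM p.+1.
rewrite addr_ge0//= cfS mulrDl; apply: lerD => //.
by rewrite addSnnS in b2.
Qed.

(** Up to the factor [C] the alternating sums are the partial sums of the hypergeometric series. The
    first omitted term bounds the error, and it tends to 0 by the ratio test since [tau < 1]. *)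
Local Lemma decay_val_series p q : tau < 1 ->
  decay_val p.+1 q.+1 = u0 * de * tau ^+ p.+1 / (p.+1%:R - de)
     * hyp2F1_series q.+1%:R (p.+1%:R - de) (p.+1%:R - de + 1) (- tau).
Proof.
move=> tl1; set b := p.+1%:R - de; have b0 : 0 < b by exact: pde.
have t0 := tau0.
set C := u0 * de * tau ^+ p.+1 / b.
have C0 : 0 < C by rewrite /C divr_gt0// mulr_gt0 ?exprn_gt0// mulr_gt0// de0.
apply: (mulfI (x := C^-1)); first by rewrite invr_eq0 gt_eqF.
rewrite mulKf ?gt_eqF//; apply/esym/cvg_lim => //.
have -> : series (fun m => rising q.+1%:R m * rising b m / (rising (b + 1) m * m`!%:R) * (- tau) ^+ m)
    = (fun M => C^-1 * alt_sum M p q.+1).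
  apply/funext => M; rewrite /series/= /alt_sum mulr_sumr.
  apply: eq_big_nat => m _; rewrite /decay_head [(- tau) ^+ m]exprNn.
  have -> : (p + m).+1%:R - de = b + m%:R by rewrite /b -addSn natrD addrAC.
  have H : rising b m * (b + m%:R) = b * rising (b + 1) m by rewrite -risingS risingSl.
  have r0 : rising (b + 1) m != 0 by rewrite gt_eqF// rising_gt0// addr_gt0.
  have bm : b + m%:R != 0 by rewrite gt_eqF// ltr_wpDr.
  have -> : rising b m = b * rising (b + 1) m / (b + m%:R) by rewrite -H mulfK.
  rewrite -addSn exprD /C.
  have f0 : m`!%:R != 0 :> R by rewrite pnatr_eq0 -lt0n fact_gt0.
  have x2 : tau ^+ p.+1 != 0 by rewrite expf_neq0// gt_eqF.
  have x3 : b != 0 by rewrite gt_eqF.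
  have x4 : u0 != 0 by rewrite gt_eqF.
  have x5 : de != 0 by rewrite gt_eqF ?de0.
  move: r0 bm f0 x2 x3 x4 x5; move: (rising (b + 1) m) (m`!%:R) (b + m%:R)
     (tau ^+ p.+1) (tau ^+ m) (b) (de) => z1 z2 z3 z4 z5 z6 z7 *.
  by field; repeat (apply/andP; split => //).
have cS : alt_sum M p q.+1 @[M --> \oo] --> decay_val p.+1 q.+1.
  have c0 : cf q.+1 M * tau ^+ M @[M --> \oo] --> 0.
    apply: (cvg0_ratio (t := fun M => (q.+1%:R + M%:R) / (1 + M%:R) * tau) (w := tau)) => //.
    - by move=> n; rewrite mulr_ge0 ?exprn_ge0 ?(ltW t0)// divr_ge0// rising_ge0.
    - move=> n; rewrite risingS exprSr factS natrM -[n.+1%:R]nat1r.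
      have f0 : n`!%:R != 0 :> R by rewrite pnatr_eq0 -lt0n fact_gt0.
      have n1 : 1 + n%:R != 0 :> R by rewrite nat1r pnatr_eq0.
      by field; rewrite f0 n1.
    - by move=> n; rewrite mulr_ge0 ?(ltW t0)// divr_ge0// addr_ge0.
    - by rewrite -[X in _ --> X]mul1r; apply: cvgMl; exact: cvg_ratio_shift.
  have Dle M : decay_head (p + M).+1 <= C * tau ^+ M.
    rewrite /decay_head /C -addSn exprD [leRHS]mulrAC !mulrA.
    apply: ler_pM.
    - by rewrite !mulr_ge0 ?exprn_ge0 ?invr_ge0 ?(ltW al0) ?(ltW t0) ?(ltW u00).
    - by rewrite invr_ge0 ltW// pde.
    - by [].
    - rewrite lef_pV2 ?posrE// ?pde//.
      by rewrite /b lerD2r ler_nat leq_addr.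
  have e0 : C * (cf q.+1 M * tau ^+ M) @[M --> \oo] --> C * 0 by apply: cvgMr.
  rewrite mulr0 in e0.
  apply/cvgrPdist_le.
  move=> e epos; move/cvgrPdist_le: e0 => /(_ e epos); apply: filterS => M.
  rewrite sub0r normrN => H; apply: le_trans H.
  have /andP[a1 a2] := decay_val_alt q.+1 M p.
  rewrite -[leLHS]mul1r -[X in X * _](normr_sign _ M) -normrM ger0_norm//.
  apply: (le_trans a2); apply: le_trans (ler_norm _).
  rewrite [leRHS]mulrCA; apply: ler_wpM2l; last exact: Dle.
  by rewrite divr_ge0// rising_ge0.
by apply: cvgMr.
Qed.

(** The two branches of [hyp2F1] match the two series: the power series at [-tau] for [tau < 1], and
    for [tau >= 1] the Pfaff form, whose second parameter [c - b] is here equal to 1 and whose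
    argument is [tau / (1 + tau)]. *)
Lemma decay_intE p q : decay_int p.+1 q.+1 =
  (u0 * (de * tau ^+ p.+1 * hyp2F1 q.+1%:R (p.+1%:R - de) (p.+2%:R - de) (- tau)
     / (p.+1%:R - de)))%:E.
Proof.
rewrite decay_valE; congr EFin.
have t0 := tau0; have t1 := tau1.
have ce : p.+2%:R - de = p.+1%:R - de + 1 by rewrite -[p.+2%:R]natr1 addrAC.
have b0 : p.+1%:R - de != 0 by rewrite gt_eqF// pde.
rewrite /hyp2F1 normrN (gtr0_norm t0) ce; case: ifPn => [tl1|].
  by rewrite (decay_val_series p q tl1); ring.
rewrite -leNgt => tg1; rewrite lerN2 tg1 (decay_val_pfaff_series p q).
have -> : p.+1%:R - de + 1 - (p.+1%:R - de) = 1 by ring.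
have -> : - tau / (- tau - 1) = tau / (1 + tau).
  by rewrite -opprD invrN mulrNN addrC.
rewrite opprK powR_invn ?ltW//.
have x0 : (1 + tau) ^+ q.+1 != 0 by rewrite expf_neq0// gt_eqF.
move: (hyp2F1_series q.+1%:R 1 (p.+1%:R - de + 1) (tau / (1 + tau))) => z1.
move: x0 b0; move: ((1 + tau) ^+ q.+1) (p.+1%:R - de) => z2 z3 x0 b0.
have a0 : al != 0 by rewrite gt_eqF// al0.
by field; repeat (apply/andP; split => //).
Qed.

End Hyper.

(** * Interference of one tier *)

Section Tier.
Context {R : realType}.
Local Notation leb := (@lebesgue_measure R).
Local Notation pt := ((R * R) * R)%type.
Implicit Types (pw al r : R).

Definition outside r : set pt := [set z : pt | (r < pdist z)%R /\ (0 <= z.2)%R].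

Definition contribution pw al (z : pt) : R := pw * z.2 * pdist z `^ (- al).

Definition tier_interference pw al r (m : {measure set pt -> \bar R}) : \bar R :=
  (\int[m]_(z in outside r) (contribution pw al z)%:E)%E.

Lemma measurable_sqnorm_pos : measurable_fun setT (fun z : pt => sqnorm2 z.1).
Proof. by apply: (measurableT_comp measurable_sqnorm2); exact: measurable_fst. Qed.

Lemma measurable_pdist : measurable_fun setT (@pdist R).
Proof.
apply: (measurableT_comp _ measurable_sqnorm_pos).
by apply: continuous_measurable_fun; exact: sqrt_continuous.
Qed.

Lemma measurable_outside r : measurable (outside r).
Proof.
have -> : outside r = (@pdist R) @^-1` `]r, +oo[ `&` snd @^-1` `[0, +oo[.
  by apply/seteqP; split => z; rewrite /outside/= !in_itv/= !andbT.
apply: measurableI; rewrite -[X in measurable X]setTI.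
  by apply: measurable_pdist => //; exact: measurable_itv.
by apply: measurable_snd => //; exact: measurable_itv.
Qed.

Lemma measurable_contribution pw al : measurable_fun setT (contribution pw al).
Proof.
apply: measurable_funM; first by apply: measurable_funM => //; exact: measurable_snd.
exact: (measurableT_comp (measurable_powR _) measurable_pdist).
Qed.

Lemma contribution_ge0 pw al r z : 0 <= pw -> outside r z -> 0 <= contribution pw al z.
Proof. by move=> p0 [_ z0]; rewrite /contribution !mulr_ge0// powR_ge0. Qed.

Lemma tier_interference_ge0 pw al r m : 0 <= pw -> (0 <= tier_interference pw al r m)%E.
Proof.
by move=> p0; apply: integral_ge0 => z Sz; rewrite lee_fin (contribution_ge0 _ p0 Sz).
Qed.

Lemma measurable_tier_interference d (T : measurableType d)
    (N : T -> {measure set pt -> \bar R}) pw al r : 0 <= pw ->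
  (forall B, measurable B -> measurable_fun setT (fun w => N w B : \bar R)) ->
  measurable_fun setT (fun w => tier_interference pw al r (N w)).
Proof.
move=> p0 mN; rewrite /tier_interference.
under eq_fun do rewrite integral_mkcond.
apply: measurable_fun_integral_kernel => //.
- move=> z; rewrite patchE; case: ifPn => // /set_mem Sz.
  by rewrite lee_fin (contribution_ge0 _ p0 Sz).
- apply/(measurable_restrictT _ (measurable_outside r)).
  by apply/measurable_EFinP; exact: measurable_funS (measurable_contribution _ _).
Qed.

Lemma tier_interference_nincr pw al r r' m : 0 <= pw -> r <= r' ->
  (tier_interference pw al r' m <= tier_interference pw al r m)%E.
Proof.
move=> p0 rr'; apply: ge0_subset_integral.
- exact: measurable_outside.
- exact: measurable_outside.
- by apply/measurable_EFinP; exact: measurable_funS (measurable_contribution _ _).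
- by move=> z Sz; rewrite lee_fin (contribution_ge0 _ p0 Sz).
- by move=> z [rz z0]; split => //; exact: le_lt_trans rz.
Qed.

(** The inequality in [outside] is strict, so when the radii decrease to [r] the domains increase to
    [outside r]. The interference is thus continuous from the right in the radius, for any measure
    [m]. *)
Lemma cvg_tier_interference pw al r (rn : nat -> R) m : 0 <= pw ->
  (forall n, r <= rn n) -> {homo rn : i j / (i <= j)%N >-> j <= i} ->
  rn @ \oo --> r ->
  tier_interference pw al (rn n) m @[n --> \oo] --> tier_interference pw al r m.
Proof.
move=> p0 rrn ndr crn.
have -> : tier_interference pw al r m =
    (\int[m]_(z in \bigcup_n outside (rn n)) (contribution pw al z)%:E)%E.
  congr (integral _ _ _); apply/seteqP; split => z.
    move=> [rz z0].
    have [n _ /(_ n (leqnn n)) nz] : \forall n \near \oo, rn n < pdist z by apply: (cvgr_lt r).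
    by exists n.
  by move=> [n _ [rz z0]]; split => //; exact: le_lt_trans rz.
apply: ge0_nondecreasing_set_cvg_integral.
- move=> i j ij; apply/subsetPset => z [rz z0]; split => //.
  by apply: le_lt_trans rz; exact: ndr.
- by move=> n; exact: measurable_outside.
- by move=> n; apply/measurable_EFinP; exact: measurable_funS (measurable_contribution _ _).
- by move=> n z Sz; rewrite lee_fin (contribution_ge0 _ p0 Sz).
Qed.

Lemma exp1_dens_ge0 (v : R) : 0 <= exp1_dens v.
Proof. by rewrite /exp1_dens; case: ifP => // _; rewrite expR_ge0. Qed.

Local Notation m3 := ((leb \x leb) \x leb)%E.

Let leb3_set0 : leb3 set0 = 0%E :> \bar R.
Proof. exact: (measure0 m3). Qed.

Let leb3_ge0 (B : set pt) : (0 <= leb3 B)%E.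
Proof. exact: (measure_ge0 m3). Qed.

Let leb3_sigma_additive : semi_sigma_additive (leb3 : set pt -> \bar R).
Proof. exact: (@measure_semi_sigma_additive _ _ _ m3). Qed.

(* The display of the Borel structure on R as a realType differs from the one
   carried by Lebesgue measure, so leb3 has to be declared a measure again. *)
HB.instance Definition _ := isMeasure.Build _ pt R leb3
  leb3_set0 leb3_ge0 leb3_sigma_additive.

Lemma measurable_disk (u : R) : measurable ([set p | sqnorm2 p <= u] : set (R * R)).
Proof.
rewrite (_ : [set p | _] = sqnorm2 @^-1` `]-oo, u]).
  by rewrite -[X in measurable X]setTI; apply: measurable_sqnorm2 => //; exact: measurable_itv.
by apply/seteqP; split => p /=; rewrite in_itv.
Qed.

Definition leb2 : set (measurableTypeR R * measurableTypeR R) -> \bar R := (leb \x leb)%E.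

HB.instance Definition _ := Measure.on leb2.

Let leb2_sigma_finite : sigma_finite setT leb2.
Proof.
exists (fun n => [set p | sqnorm2 p <= n%:R]).
  apply/seteqP; split => // p _; exists (Num.truncn (sqnorm2 p)).+1 => //=.
  by rewrite ltW// truncnS_gt.
move=> n; split; first exact: measurable_disk.
by rewrite /leb2 disk_area ltry.
Qed.

HB.instance Definition _ := Measure_isSigmaFinite.Build _ _ _ leb2
  leb2_sigma_finite.

(** The identity map carries [leb3] to the product of [leb2] and [leb], to which Tonelli's theorem
    applies; the two differ only in the measurable structure declared on the line. *)
Lemma integral_leb3 (f : pt -> \bar R) : measurable_fun setT f -> (forall z, 0 <= f z)%E ->
  (\int[leb3]_z f z = \int[leb \x leb]_p \int[leb]_v f (p, v))%E.
Proof.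
move=> mf f0.
have E := @fubini_tonelli1 _ _ _ _ R leb2 leb f mf f0.
apply: etrans E; transitivity (\int[leb3]_z (f z * 1))%E.
  by apply: eq_integral => z _; rewrite mule1.
have H := @eq_weighted_image_integral _ _ _ _ _ _ R leb3 (leb2 \x leb)%E idfun idfun
  (cst 1%E) (cst 1%E) f.
apply: (etrans (H _ _ _ _ _ _ _ _ _)) => //.
- exact: measurable_id.
- exact: (@measurable_id _ (measurableTypeR R * measurableTypeR R * measurableTypeR R)%type).
- by move=> A mA; rewrite !integral_cst.
- by apply: eq_integral => z _; rewrite mule1.
Qed.

Lemma marked_mean_ge0 (c : R) B : 0 <= c -> (0 <= marked_mean c B)%E.
Proof.
move=> c0; rewrite /marked_mean; apply: mule_ge0; first by rewrite lee_fin.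
apply: integral_ge0 => z _.
by rewrite lee_fin exp1_dens_ge0.
Qed.

Lemma measurable_exp1_dens : measurable_fun setT (fun v : R => exp1_dens v).
Proof.
apply: measurable_fun_ifT => //.
- apply: (@measurable_fun_bool _ _ _ _ true) => /=; rewrite setTI.
  rewrite (_ : _ @^-1` _ = `[0, +oo[%classic); first exact: measurable_itv.
  by apply/seteqP; split => v /=; rewrite in_itv/= andbT.
- by apply: measurableT_comp => //; exact: measurable_funN.
Qed.

Lemma exp1_dens_le1 (v : R) : exp1_dens v <= 1.
Proof. by rewrite /exp1_dens; case: ifP => // v0; rewrite -expR0 ler_expR oppr_le0. Qed.

Context d (T : measurableType d) (P : probability T R).
Variables (N : T -> {measure set pt -> \bar R}) (c pw al r t : R).
Hypothesis c0 : 0 <= c.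
Hypothesis hN : is_PPP P N (marked_mean c).
Hypothesis pw0 : 0 < pw.
Hypothesis al2 : 2 < al.
Hypothesis r0 : 0 < r.
Hypothesis t0 : 0 < t.

Local Notation tfun := ((fun z : pt => (t * contribution pw al z)%:E) \_ (outside r)).

Local Lemma tfun_ge0 z : (0 <= tfun z)%E.
Proof.
rewrite patchE; case: ifPn => // /set_mem Sz.
by rewrite lee_fin mulr_ge0 ?(ltW t0)// (contribution_ge0 _ (ltW pw0) Sz).
Qed.

Local Lemma measurable_tfun : measurable_fun setT tfun.
Proof.
apply/(measurable_restrictT _ (measurable_outside r)).
apply/measurable_EFinP; apply: measurable_funM => //.
exact: measurable_funS (measurable_contribution _ _).
Qed.

Local Lemma expN_tfun_le1 z : 0 <= 1 - expN (tfun z) :> R.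
Proof. by rewrite subr_ge0 expN_le1// tfun_ge0. Qed.

Lemma tier_exponent :
  (\int[leb3]_z ((1 - expN (tfun z))%:E * (c * exp1_dens z.2)%:E) =
   (c * pi)%:E * decay_int al (t * pw) (r ^+ 2) 1 1)%E.
Proof.
have r20 : 0 < r ^+ 2 by rewrite exprn_gt0.
pose y := decay al (t * pw).
have tp0 : 0 < t * pw by rewrite mulr_gt0.
have y0 u : 0 <= y u by exact: decay_ge0.
(* The integrand once the mark is integrated out, as a function of the squared distance; it is 0 in
   the exclusion disk. *)
pose g u : \bar R := (if r ^+ 2 < u then c * (y u / (1 + y u)) else 0)%:E.
have gE p : (\int[leb]_v ((1 - expN (tfun (p, v)))%:E * (c * exp1_dens v)%:E))%E =
    g (sqnorm2 p).
  rewrite /g.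
  have rp v : (r < pdist (p, v)) = (r ^+ 2 < sqnorm2 p).
    have s0 : 0 <= sqnorm2 p by rewrite addr_ge0 ?sqr_ge0.
    rewrite /pdist/= -/(sqnorm2 p) -[in RHS](sqr_sqrtr s0).
    by rewrite ltr_pXn2r// nnegrE ?sqrtr_ge0// ltW.
  case: ifPn => rs; last first.
    apply: integral0_eq => v _; rewrite patchE memNset; last by move=> [/=]; rewrite rp (negbTE rs).
    by rewrite expN_EFin oppr0 expR0 subrr mul0e.
  have yp v : t * contribution pw al (p, v) = v * y (sqnorm2 p).
    rewrite /contribution /y /decay /pdist/= -/(sqnorm2 p) -powR12_sqrt.
      by rewrite -powRrM (_ : 2^-1 * - al = - (al / 2)); ring.
    by rewrite addr_ge0 ?sqr_ge0.
  have -> : (c * (y (sqnorm2 p) / (1 + y (sqnorm2 p))))%:E =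
      (c%:E * \int[leb]_v ((1 - expR (- (v * y (sqnorm2 p)))) * exp1_dens v)%:E)%E.
    by rewrite mark_integral// EFinM.
  rewrite -ge0_integralZl//; last 2 first.
  - apply/measurable_EFinP; apply: measurable_funM; last exact: measurable_exp1_dens.
    apply: measurable_funB => //; apply: measurableT_comp => //.
    by apply: measurable_funN; apply: measurable_funM.
  - move=> v _; rewrite lee_fin /exp1_dens; case: ifP => v0; last by rewrite mulr0.
    by rewrite mulr_ge0 ?expR_ge0// subr_ge0 -expR0 ler_expR oppr_le0 mulr_ge0.
  apply: eq_integral => v _; rewrite patchE.
  have [v0|v0] := leP 0 v.
    rewrite mem_set; last by split => //=; rewrite rp.
    by rewrite yp expN_EFin -!EFinM; congr EFin; ring.
  by rewrite /exp1_dens/= leNgt v0/= !mulr0 !mule0.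
rewrite integral_leb3; last 2 first.
- apply: emeasurable_funM; apply/measurable_EFinP.
    apply: measurable_funB => //; apply: (measurableT_comp measurable_expN).
    exact: measurable_tfun.
  by apply: measurable_funM => //; exact: (measurableT_comp measurable_exp1_dens measurable_snd).
- by move=> z; rewrite mule_ge0// lee_fin ?expN_tfun_le1// mulr_ge0// exp1_dens_ge0.
under eq_integral do rewrite gE.
have mdec : measurable_fun setT (fun u => y u / (1 + y u)).
  have := measurable_decay_ratio al tp0 1 1.
  by under eq_fun do rewrite !expr1.
rewrite integral_radial; last 2 first.
- apply/measurable_EFinP; apply: measurable_fun_ifT => //; last exact: measurable_funM.
  exact: measurable_fun_ltr.
- by move=> u; rewrite lee_fin; case: ifP => // _; rewrite mulr_ge0// divr_ge0// addr_ge0.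
rewrite mulrC EFinM -muleA; congr (_ * _)%E.
rewrite /decay_int -integral_itv_obnd_cbnd; last first.
  by apply/measurable_EFinP; apply: measurable_funS (measurable_decay_ratio al tp0 1 1).
rewrite -ge0_integralZl//; last 2 first.
- by apply/measurable_EFinP; apply: measurable_funS (measurable_decay_ratio al tp0 1 1).
- by move=> u _; rewrite lee_fin divr_ge0// exprn_ge0// ?addr_ge0// ?decay_ge0.
rewrite [LHS]integral_mkcond [RHS]integral_mkcond; apply: eq_integral => u _.
rewrite !patchE /g !mem_setE !in_itv/= !andbT.
have [ru|ru] := ltP (r ^+ 2) u; last by case: ifP.
by rewrite (lt_trans r20 ru) -EFinM !expr1.
Qed.

Lemma tier_laplace :
  (\int[P]_w (expN (t%:E * tier_interference pw al r (N w)))%:E =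
   (expN ((c * pi)%:E * decay_int al (t * pw) (r ^+ 2) 1 1))%:E)%E.
Proof.
have mrho : measurable_fun setT (fun z : pt => (c * exp1_dens z.2)%:E).
  apply/measurable_EFinP; apply: measurable_funM => //.
  exact: (measurableT_comp measurable_exp1_dens measurable_snd).
have rho0 (z : pt) : (0 <= (c * exp1_dens z.2)%:E)%E.
  by rewrite lee_fin mulr_ge0// exp1_dens_ge0.
have hmu B : measurable B -> marked_mean c B = (\int[leb3]_(z in B) (c * exp1_dens z.2)%:E)%E.
  move=> mB; rewrite /marked_mean; under [RHS]eq_integral do rewrite EFinM.
  rewrite [RHS]ge0_integralZl//.
  - apply/measurable_EFinP; apply: measurable_funS (measurableT_comp measurable_exp1_dens measurable_snd) => //.
  - by move=> z _; rewrite lee_fin exp1_dens_ge0.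
(* Bounded cylinders exhaust the space, and they have finite mean measure because the mark density
   is at most 1. *)
pose D n : set pt := [set p | sqnorm2 p <= n%:R] `*` `[- n%:R, n%:R].
have mA n := measurable_disk n%:R.
have mD n : measurable (D n) by apply: measurableX => //; exact: measurable_itv.
rewrite -tier_exponent.
rewrite -(@PPP_laplace R _ T P N (marked_mean c) leb3 _ hN hmu _ mrho rho0 _ tfun D)//.
- apply: eq_integral => w _; congr (expN _)%:E.
  rewrite /tier_interference -ge0_integralZl//; last 4 first.
  + exact: measurable_outside.
  + by apply/measurable_EFinP; exact: measurable_funS (measurable_contribution _ _).
  + by move=> z Sz; rewrite lee_fin (contribution_ge0 _ (ltW pw0) Sz).
  + by rewrite lee_fin ltW.
  by rewrite integral_mkcond; apply: eq_integral => z _; rewrite !patchE.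
- by move=> B; exact: marked_mean_ge0.
- exact: measurable_tfun.
- exact: tfun_ge0.
- move=> n; rewrite hmu//.
  apply: (@le_lt_trans _ _ (\int[leb3]_(z in D n) c%:E)%E).
    apply: ge0_le_integral => //.
    + exact: measurable_funS mrho.
    + by move=> z _; rewrite lee_fin ler_piMr// exp1_dens_le1.
  rewrite integral_cst//.
  pose Bn : set R := `[- n%:R, n%:R]%classic.
  rewrite [X in (_ * X)%E](_ : _ = ((leb \x leb)%E [set p | (sqnorm2 p <= n%:R)%R] * leb Bn)%E); last first.
    by apply: (product_measure1E leb2 leb); [exact: mA|exact: measurable_itv].
  rewrite disk_area /Bn lebesgue_measure_itv/=.
  by case: ifP => _; rewrite -?EFinD -?EFinM ?mule0 ?ltry.
- move=> n m nm z [/= z1]; rewrite !in_itv/= => /andP[z2 z3]; split => /=.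
    by apply: le_trans z1 _; rewrite ler_nat.
  rewrite in_itv/= (le_trans z3) ?ler_nat// andbT.
  by apply: le_trans z2; rewrite lerN2 ler_nat.
- apply/seteqP; split => // z _.
  have [n nz] : exists n, sqnorm2 z.1 + `|z.2| <= n%:R.
    by exists (Num.truncn (sqnorm2 z.1 + `|z.2|)).+1; rewrite ltW// truncnS_gt.
  have s0 : 0 <= sqnorm2 z.1 by rewrite addr_ge0 ?sqr_ge0.
  exists n => //; split => /=; first by move: (normr_ge0 z.2); lra.
  by rewrite in_itv/= -ler_norml; lra.
Qed.

End Tier.

(** * Moments from a Laplace transform by comparison of polynomials *)

Section ExpTaylor.
Context {R : realType}.

Lemma exp_taylor_le (y : R) M : 0 <= y -> \sum_(0 <= n < M) y ^+ n / n`!%:R <= expR y.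
Proof.
move=> y0; have := @nondecreasing_cvgn_le _ (series (exp_coeff y)) _ (is_cvg_series_exp_coeff y) M.
apply; apply/nondecreasing_seqP => n; rewrite /series/= big_nat_recr//= lerDl.
by rewrite /exp_coeff/= divr_ge0// exprn_ge0.
Qed.

(** By [M! k! <= (M + k)!], the tail of the series is bounded term by term by [y^M / M!] times the
    exponential series. *)
Lemma exp_taylor_rem (y : R) M : 0 <= y ->
  expR y - \sum_(0 <= n < M) y ^+ n / n`!%:R <= y ^+ M / M`!%:R * expR y.
Proof.
move=> y0; rewrite lerBlDr.
have cv := is_cvg_series_exp_coeff y.
apply: (@cvgr_to_le _ _ _ _ (series (exp_coeff y))) cv _.
near=> n.
have Mn : (M <= n)%N by near: n; exact: nbhs_infty_ge.
rewrite /series/= (big_cat_nat (n := M))//= addrC lerD2r.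
rewrite -{1}[M]addn0 -{1}(subnK Mn) addnC big_addn.
rewrite addnK.
apply: le_trans (_ : y ^+ M / M`!%:R * \sum_(0 <= k < n - M) y ^+ k / k`!%:R <= _); last first.
  by rewrite ler_wpM2l ?exp_taylor_le// divr_ge0// exprn_ge0.
rewrite mulr_sumr; apply: ler_sum => k _.
rewrite /exp_coeff/= addnC exprD mulrACA ler_wpM2l ?mulr_ge0 ?exprn_ge0//.
rewrite -invfM lef_pV2 ?posrE ?mulr_gt0 ?ltr0n ?fact_gt0// -natrM ler_nat.
rewrite -(@bin_fact (M + k) M) ?leq_addr// addKn.
by rewrite leq_pmull// bin_gt0 leq_addr.
Unshelve. all: by end_near. Qed.

Lemma pow_fact_le_exp (y : R) M : 0 <= y -> y ^+ M / M`!%:R <= expR y.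
Proof.
move=> y0; apply: le_trans (exp_taylor_le M.+1 y0).
rewrite big_nat_recr//= lerDr; apply: sumr_ge0 => n _.
by rewrite divr_ge0// exprn_ge0.
Qed.

Lemma expRN_sub1_le (x : R) : `|expR (- x) - 1| <= `|x| * expR `|x|.
Proof.
have H (u : R) : 0 <= u -> expR u - 1 <= u * expR u.
  move=> u0; have := @exp_taylor_rem u 1 u0.
  by rewrite big_nat1 expr0 expr1 fact0 divr1 divr1.
have [x0|x0] := leP 0 x.
  rewrite ler0_norm; last by rewrite subr_le0 -expR0 ler_expR oppr_le0.
  rewrite opprB (ger0_norm x0).
  have e1 := @expR_ge1Dx _ (- x).
  have e2 : 1 <= expR x by rewrite -expR0 ler_expR.
  nra.
rewrite (ltr0_norm x0) ger0_norm ?H ?oppr_ge0 ?(ltW x0)//.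
by rewrite subr_ge0 -expR0 ler_expR oppr_ge0 ltW.
Qed.

End ExpTaylor.

Section PolyUnique.
Context {R : realType}.

Lemma horner_bound (Q : {poly R}) (z : R) : 0 <= z <= 1 ->
  `|Q.[z]| <= \sum_(i < size Q) `|Q`_i|.
Proof.
move=> /andP[z0 z1]; rewrite horner_coef; apply: le_trans (ler_norm_sum _ _ _) _.
apply: ler_sum => i _; rewrite normrM ler_piMr// normrX exprn_ile1//.
by rewrite ger0_norm.
Qed.

(** The constant term is the limit at 0, hence 0 when [M > 0]; dividing by [z] lowers [M] by one. *)
Lemma poly_coef0_small (M : nat) (Q : {poly R}) (C : R) :
  (forall z, 0 < z <= 2^-1 -> `|Q.[z]| <= C * z ^+ M) ->
  forall n, (n < M)%N -> Q`_n = 0.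
Proof.
elim: M Q C => [//|M IH] Q C H n nM.
pose Q' := drop_poly 1 Q.
have QE z : Q.[z] = Q`_0 + Q'.[z] * z.
  rewrite -{1}(poly_take_drop 1 Q) hornerD hornerM hornerX; congr (_ + _).
  by rewrite /take_poly poly_def big_ord1 expr0 alg_polyC hornerC.
have q0 : Q`_0 = 0.
  pose S := \sum_(i < size Q') `|Q'`_i|.
  have S0 : 0 <= S by apply: sumr_ge0.
  apply/eqP; rewrite -normr_eq0; apply/eqP/le_anti; rewrite normr_ge0 andbT.
  apply/ler_addgt0Pl => e e0; rewrite addr0.
  pose z := Num.min 2^-1 (e / (`|C| + S + 1)).
  have d0 : 0 < `|C| + S + 1 by rewrite ltr_wpDl// addr_ge0.
  have z0 : 0 < z by rewrite lt_min invr_gt0 ltr0n divr_gt0.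
  have z2 : z <= 2^-1 by rewrite ge_min lexx.
  have ze : z * (`|C| + S + 1) <= e by rewrite -ler_pdivlMr// ge_min lexx orbT.
  have z1 : z <= 1 by apply: le_trans z2 _; rewrite invf_le1// ler1n.
  have -> : Q`_0 = Q.[z] - Q'.[z] * z by rewrite QE addrK.
  apply: le_trans (ler_normB _ _) _.
  have h1 : `|Q.[z]| <= `|C| * z.
    apply: le_trans (H z _) _; first by rewrite z0.
    apply: le_trans (ler_norm _) _; rewrite normrM ler_wpM2l// normrX ger0_norm ?(ltW z0)//.
    by rewrite exprS ler_piMr ?(ltW z0)// exprn_ile1// ltW.
  have h2 : `|Q'.[z] * z| <= S * z.
    rewrite normrM (gtr0_norm z0) ler_wpM2r ?(ltW z0)//.
    by apply: horner_bound; rewrite (ltW z0).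
  nra.
case: n nM => [//|n nM].
have -> : Q`_n.+1 = Q'`_n by rewrite coef_drop_poly addn1.
apply: (IH Q' C) => // z /andP[z0 z2].
have := H z; rewrite z0 z2 QE q0 add0r normrM (gtr0_norm z0) exprSr mulrA.
by move=> /(_ isT); rewrite ler_pM2r.
Qed.

End PolyUnique.

Section Toeplitz.
Context {R : realType}.

(** The constant coefficient is removed, like the diagonal of the Toeplitz matrix; [g 0] appears
    separately, in the exponent. *)
Definition gen_poly (M : nat) (g : nat -> R) : {poly R} :=
  \poly_(p < M) (if p == 0%N then 0 else g p).

(** The first column of a product of lower triangular Toeplitz matrices is a Cauchy product, and
    truncating the polynomial at the size of the matrix does not affect the coefficients that are
    read. *)
Lemma toeplitz_pow (M : nat) (g : nat -> R) (i : nat) (n : 'I_M.+1) :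
  ((\matrix_(p < M.+1, q < M.+1) (if (q < p)%N then g (p - q)%N else 0)) ^+ i) n ord0 =
  ((gen_poly M.+1 g) ^+ i)`_n.
Proof.
elim: i n => [|i IH] n.
  by rewrite !expr0 mxE coef1 -val_eqE/=; case: eqP.
rewrite !exprS mxE coefMr.
rewrite (big_ord_widen M.+1 (fun j => (gen_poly M.+1 g)`_(n - j) * ((gen_poly M.+1 g) ^+ i)`_j)) ?ltn_ord//.
rewrite [RHS]big_mkcond/=; apply: eq_bigr => q _; rewrite mxE IH ltnS coef_poly.
have -> : (n - q < M.+1)%N by have := ltn_ord n; lia.
case: (ltngtP q n) => [qn|qn|qn].
- by rewrite subn_eq0 leqNgt qn.
- by rewrite mul0r.
- by rewrite qn subnn eqxx.
Qed.

End Toeplitz.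

Section LaplaceMoments.
Context {R : realType} d (T : measurableType d) (P : probability T R).

Lemma laplace_moments (X : T -> R) (h : R -> R) (g : nat -> R) (M : nat) (C : R) :
  measurable_fun setT X -> (forall w, 0 <= X w) ->
  (forall p, 0 <= g p) -> 0 <= C -> (0 < M)%N ->
  (forall z, 0 <= z <= 2^-1 ->
    (\int[P]_w (expR (- (X w * (1 - z))))%:E = (expR (- h z))%:E)%E) ->
  (forall z, 0 <= z <= 2^-1 ->
    `|h z - (g 0 - (gen_poly M g).[z])| <= C * z ^+ M) ->
  forall n, (n < M)%N ->
  (\int[P]_w (X w ^+ n / n`!%:R * expR (- X w))%:E =
   (expR (- g 0) * \sum_(0 <= i < M) ((gen_poly M g) ^+ i)`_n / i`!%:R)%:E)%E.
Proof.
move=> mX X0 g0 C0 M0 hL hE.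
set G := gen_poly M g.
pose u n w := X w ^+ n / n`!%:R * expR (- X w).
have u_ge0 n w : 0 <= u n w by rewrite mulr_ge0 ?expR_ge0// divr_ge0// exprn_ge0.
have mu n : measurable_fun setT (u n).
  apply: measurable_funM; last by apply: measurableT_comp => //; exact: measurable_funN.
  by apply: measurable_funM => //; exact: measurable_funX.
have u_le1 n w : u n w <= 1.
  rewrite /u expRN ler_pdivrMr ?expR_gt0// mul1r; exact: pow_fact_le_exp.
have int1 (f : T -> R) (c : R) : measurable_fun setT f -> (forall w, 0 <= f w <= c) ->
    (0 <= \int[P]_w (f w)%:E <= c%:E)%E.
  move=> mf fc; have f0 w : 0 <= f w by have /andP[] := fc w.
  have fc' w : f w <= c by have /andP[] := fc w.
  rewrite integral_ge0/=; last by move=> w _; rewrite lee_fin.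
  rewrite -[leRHS]mule1 -(@probability_setT _ _ _ P) -integral_cst//.
  apply: ge0_le_integral => //.
  - by move=> w _; rewrite lee_fin.
  - exact/measurable_EFinP.
  - by move=> w _; rewrite lee_fin.
pose a n := fine (\int[P]_w (u n w)%:E)%E.
have fin1 (f : T -> R) (c : R) : measurable_fun setT f -> (forall w, 0 <= f w <= c) ->
    (\int[P]_w (f w)%:E \is a fin_num)%E.
  move=> mf fc; have /andP[i0 ic] := int1 f c mf fc.
  by rewrite ge0_fin_numE// (le_lt_trans ic)// ltry.
have aE n : (\int[P]_w (u n w)%:E = (a n)%:E)%E.
  by rewrite fineK// (fin1 _ 1)// => w; rewrite u_ge0 u_le1.
pose A := \poly_(n < M) a n.
(* For [z <= 1/2] the Taylor remainder of [e^(X z)] still leaves the factor [e^(-X/2)]. The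
   inequality [y^M / M! <= e^y] at [y = X / 2] then absorbs [X^M], whence the constant [2^M]. *)
have A_bound z : 0 <= z <= 2^-1 -> `|expR (- h z) - A.[z]| <= 2 ^+ M * z ^+ M.
  move=> /andP[z0 z2]; have := hL z; rewrite z0 z2 => /(_ isT) hz.
  pose r w := expR (- (X w * (1 - z))) - \sum_(0 <= n < M) z ^+ n * u n w.
  have sumE w : \sum_(0 <= n < M) z ^+ n * u n w =
      expR (- X w) * \sum_(0 <= n < M) (X w * z) ^+ n / n`!%:R.
    rewrite mulr_sumr; apply: eq_bigr => n _; rewrite /u exprMn; ring.
  have eE w : expR (- (X w * (1 - z))) = expR (- X w) * expR (X w * z).
    by rewrite -expRD; congr expR; ring.
  have Xz w : 0 <= X w * z by rewrite mulr_ge0.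
  have r01 w : 0 <= r w <= 2 ^+ M * z ^+ M.
    rewrite /r eE sumE -mulrBr mulr_ge0 ?expR_ge0 ?subr_ge0 ?exp_taylor_le//=.
    have t1 := exp_taylor_rem M (Xz w).
    apply: (le_trans (ler_wpM2l (expR_ge0 _) t1)).
    rewrite mulrCA -expRD exprMn.
    have e1 : expR (- X w + X w * z) <= expR (- (X w / 2)).
      by rewrite ler_expR; have := X0 w; nra.
    have e2 : (X w / 2) ^+ M / M`!%:R * expR (- (X w / 2)) <= 1.
      rewrite expRN ler_pdivrMr ?expR_gt0// mul1r; apply: pow_fact_le_exp.
      by rewrite divr_ge0.
    have -> : X w ^+ M * z ^+ M / M`!%:R = 2 ^+ M * z ^+ M * ((X w / 2) ^+ M / M`!%:R).
      rewrite expr_div_n; have : (2 : R) ^+ M != 0 by rewrite expf_neq0.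
      have : M`!%:R != 0 :> R by rewrite pnatr_eq0 -lt0n fact_gt0.
      by move=> f0 t0; field; rewrite t0 f0.
    have z2M : 0 <= 2 ^+ M * z ^+ M by rewrite mulr_ge0 ?exprn_ge0.
    have p0 : 0 <= (X w / 2) ^+ M / M`!%:R by rewrite divr_ge0// exprn_ge0// divr_ge0.
    rewrite -[leLHS]mulrA -[leRHS]mulr1 ler_wpM2l//.
    by apply: le_trans e2; rewrite ler_wpM2l.
  have msum : measurable_fun setT (fun w => \sum_(0 <= n < M) z ^+ n * u n w).
    by apply: measurable_sum => n; exact: measurable_funM.
  have mr : measurable_fun setT r.
    apply: measurable_funB => //; apply: measurableT_comp => //.
    by apply: measurable_funN; exact: measurable_funM.
  have split_int : (\int[P]_w (expR (- (X w * (1 - z))))%:E =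
      (A.[z])%:E + \int[P]_w (r w)%:E)%E.
    transitivity (\int[P]_w ((\sum_(0 <= n < M) z ^+ n * u n w)%:E + (r w)%:E))%E.
      by apply: eq_integral => w _; rewrite -EFinD; congr EFin; rewrite /r [RHS]addrC subrK.
    rewrite ge0_integralD//; last 4 first.
    - by move=> w _; rewrite lee_fin; apply: sumr_ge0 => n _; rewrite mulr_ge0 ?exprn_ge0.
    - exact/measurable_EFinP.
    - by move=> w _; rewrite lee_fin; have /andP[] := r01 w.
    - exact/measurable_EFinP.
    congr (_ + _)%E.
    under eq_integral do rewrite -sumEFin.
    rewrite ge0_integral_sum//; last 2 first.
    - by move=> n; apply/measurable_EFinP; exact: measurable_funM.
    - by move=> n w _; rewrite lee_fin mulr_ge0 ?exprn_ge0.
    rewrite /A horner_poly big_mkord -sumEFin; apply: eq_bigr => n _.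
    under eq_integral do rewrite EFinM.
    rewrite ge0_integralZl_EFin ?exprn_ge0//; last 2 first.
    - by move=> w _; rewrite lee_fin.
    - exact/measurable_EFinP.
    by rewrite aE mulrC EFinM.
  have /andP[i0 iM] := int1 r _ mr r01.
  have fr := fin1 r _ mr r01.
  rewrite hz -(fineK fr) -EFinD in split_int.
  move: split_int => [->].
  rewrite addrAC subrr add0r ger0_norm ?fine_ge0//.
  by rewrite -lee_fin fineK.
(* [G] has no constant term, so [G^i] is [O(z^i)] and the exponential series may be cut at
   [i < M]. *)
pose B := expR (- g 0) *: \sum_(0 <= i < M) i`!%:R^-1 *: G ^+ i.
pose K := \sum_(0 <= p < M) g p.
have K0 : 0 <= K by apply: sumr_ge0.
have G_bound z : 0 <= z <= 2^-1 -> 0 <= G.[z] <= K * z.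
  move=> /andP[z0 z2]; rewrite /G horner_poly /K big_mkord mulr_suml; apply/andP; split.
    by apply: sumr_ge0 => p _; rewrite mulr_ge0 ?exprn_ge0//; case: ifP.
  apply: ler_sum => -[[|p] pM] _ /=; first by rewrite mul0r mulr_ge0.
  rewrite ler_wpM2l// exprS ler_piMr// exprn_ile1//.
  by apply: le_trans z2 _; rewrite invf_le1// ler1n.
(* [K z] bounds [G.[z]]. The first summand comes from the error [r] in the exponent, by
   [|e^(-r) - 1| <= |r| e^|r|] with [|r| <= C z^M <= C]; the second comes from cutting the
   exponential series at order [M]. *)
pose CB := expR (- g 0) * (expR K * (C * expR C) + K ^+ M * expR K).
have B_bound z : 0 <= z <= 2^-1 -> `|expR (- h z) - B.[z]| <= CB * z ^+ M.
  move=> zz; have /andP[z0 z2] := zz; have /andP[G0 GK] := G_bound z zz.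
  have z1 : z <= 1 by apply: le_trans z2 _; rewrite invf_le1// ler1n.
  have zM : z ^+ M <= 1 by rewrite exprn_ile1.
  have zM0 : 0 <= z ^+ M by rewrite exprn_ge0.
  pose rr := h z - (g 0 - G.[z]).
  have rC : `|rr| <= C * z ^+ M by exact: hE.
  have rC1 : `|rr| <= C by apply: le_trans rC _; rewrite ler_piMr.
  have GK1 : G.[z] <= K by apply: le_trans GK _; rewrite ler_piMr.
  have -> : expR (- h z) = expR (- g 0) * (expR G.[z] * expR (- rr)).
    by rewrite -!expRD; congr expR; rewrite /rr; ring.
  have -> : B.[z] = expR (- g 0) * \sum_(0 <= i < M) G.[z] ^+ i / i`!%:R.
    rewrite /B hornerZ horner_sum; congr (_ * _); apply: eq_bigr => i _.
    by rewrite hornerZ horner_exp mulrC.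
  rewrite -mulrBr normrM (ger0_norm (expR_ge0 _)) /CB -mulrA ler_wpM2l ?expR_ge0//.
  set S := \sum_(0 <= i < M) _.
  have -> : expR G.[z] * expR (- rr) - S = expR G.[z] * (expR (- rr) - 1) + (expR G.[z] - S) by ring.
  apply: le_trans (ler_normD _ _) _; rewrite mulrDl; apply: lerD.
    rewrite normrM (ger0_norm (expR_ge0 _)) -mulrA; apply: ler_pM => //.
    - by rewrite ler_expR.
    - apply: le_trans (expRN_sub1_le _) _; rewrite mulrAC.
      by apply: ler_pM => //; rewrite ler_expR.
  have S1 := exp_taylor_le M G0.
  rewrite ger0_norm ?subr_ge0//.
  apply: le_trans (exp_taylor_rem M G0) _; rewrite [leRHS]mulrAC.
  apply: ler_pM.
  - by rewrite divr_ge0// exprn_ge0.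
  - exact: expR_ge0.
  - rewrite -exprMn; apply: (@le_trans _ _ (G.[z] ^+ M)); last by rewrite lerXn2r// nnegrE// mulr_ge0.
    rewrite ler_pdivrMr ?ltr0n ?fact_gt0// ler_peMr ?exprn_ge0//.
    by rewrite ler1n fact_gt0.
  - by rewrite ler_expR.
move=> n nM.
rewrite -/(u n _) aE; congr EFin.
have AB : (A - B)`_n = 0.
  apply: (poly_coef0_small (M := M) (C := 2 ^+ M + CB)) => // z /andP[z0 z2].
  have zz : 0 <= z <= 2^-1 by rewrite (ltW z0).
  rewrite hornerD hornerN mulrDl.
  have -> : A.[z] - B.[z] = (expR (- h z) - B.[z]) - (expR (- h z) - A.[z]) by ring.
  rewrite [leRHS]addrC; apply: le_trans (ler_normB _ _) _.
  by apply: lerD; [exact: B_bound|exact: A_bound].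
move: AB; rewrite coefB /A coef_poly nM => /eqP; rewrite subr_eq0 => /eqP ->.
rewrite /B coefZ coef_sum; congr (_ * _); apply: eq_bigr => i _.
by rewrite coefZ mulrC.
Qed.

End LaplaceMoments.

Section DecayExpansion.
Context {R : realType}.

(** With [x = z y / (1 + y)] one has [1 + (1 - z) y = (1 + y) (1 - x)], so the geometric series in
    [x] attaches [y^p / (1 + y)^(p+1)] to [z^p]. Its remainder [x^M / (1 + (1 - z) y)] lies between
    0 and [z^M y / (1 + y)], which integrates to the bound. *)
Lemma decay_int_expansion (al kap u0 : R) (M : nat) (z : R) :
  2 < al -> 0 < kap -> 0 < u0 -> (0 < M)%N -> 0 <= z <= 2^-1 ->
  `|fine (decay_int al (kap * (1 - z)) u0 1 1) -
    (fine (decay_int al kap u0 1 1)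
      - (gen_poly M (fun p => fine (decay_int al kap u0 p p.+1))).[z])|
   <= fine (decay_int al kap u0 1 1) * z ^+ M.
Proof.
move=> al2 k0 u00 M0 /andP[z0 z2].
have z1 : 0 < 1 - z by move: z2; lra.
have kz0 : 0 < kap * (1 - z) by rewrite mulr_gt0.
set y := decay al kap; set y1 := decay al (kap * (1 - z)).
have y0 u : 0 <= y u by exact: decay_ge0.
have y1E u : y1 u = (1 - z) * y u by rewrite /y1 /y /decay; ring.
pose h (p : nat) u := if p == 0%N then 0 else z ^+ p * (y u ^+ p / (1 + y u) ^+ p.+1).
pose rem u := y u ^+ 1 / (1 + y u) ^+ 1 - y1 u ^+ 1 / (1 + y1 u) ^+ 1 - \sum_(0 <= p < M) h p u.
have remE u : rem u = (y u / (1 + y u)) ^+ M * z ^+ M / (1 + (1 - z) * y u).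
  have a0 : 1 + y u != 0 by rewrite gt_eqF// ltr_pwDl.
  have b0 : 1 + (1 - z) * y u != 0 by rewrite gt_eqF// ltr_pwDl// mulr_ge0// ltW.
  pose x := y u / (1 + y u) * z.
  have xE : (1 - x) = (1 + (1 - z) * y u) / (1 + y u) by rewrite /x; field.
  have x0 : 1 - x != 0 by rewrite xE mulf_neq0// invr_eq0.
  have hE : \sum_(0 <= p < M) h p u = (\sum_(p < M) x ^+ p - 1) / (1 + y u).
    rewrite -(prednK M0) big_nat_recl// big_ord_recl {1}/h eqxx expr0 add0r addrAC subrr add0r.
    rewrite mulr_suml big_mkord; apply: eq_bigr => p _; rewrite /h/= /bump/= add1n /x.
    rewrite [in RHS]exprMn [in RHS]expr_div_n [(1 + y u) ^+ p.+2]exprS.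
    have c0 : (1 + y u) ^+ p.+1 != 0 by rewrite expf_neq0.
    by field; rewrite a0 c0.
  have geo : \sum_(p < M) x ^+ p = (1 - x ^+ M) / (1 - x).
    have := subrX1 x M; move=> sX.
    apply: (mulIf x0); rewrite divfK//; apply: oppr_inj.
    by rewrite -mulrN !opprB mulrC -sX.
  rewrite /rem hE geo !expr1 y1E xE -exprMn -/x.
  by field; rewrite a0 b0.
have q01 u : 0 <= y u / (1 + y u) <= 1.
  rewrite divr_ge0 ?addr_ge0//= ler_pdivrMr ?ltr_pwDl// mul1r.
  by rewrite lerDr.
have rem01 u : 0 <= rem u <= z ^+ M * (y u ^+ 1 / (1 + y u) ^+ 1).
  have /andP[qa qb] := q01 u.
  have d1 : 1 <= 1 + (1 - z) * y u by rewrite lerDl mulr_ge0// ltW.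
  have d0 := lt_le_trans ltr01 d1.
  rewrite remE divr_ge0 ?mulr_ge0 ?exprn_ge0 ?(ltW d0)//=.
  rewrite ler_pdivrMr// !expr1 mulrC -[leRHS]mulrA ler_wpM2l ?exprn_ge0//.
  apply: (@le_trans _ _ (y u / (1 + y u))); last by rewrite ler_peMr.
  by rewrite -(prednK M0) exprS ler_piMr// exprn_ile1.
have h0 p u : 0 <= h p u.
  rewrite /h; case: ifP => // _.
  by rewrite mulr_ge0 ?exprn_ge0// divr_ge0 ?exprn_ge0// addr_ge0.
pose Dm : set R := `[u0, +oo[%classic.
have mJ (kk : R) p q : 0 < kk -> measurable_fun Dm (fun u => decay al kk u ^+ p / (1 + decay al kk u) ^+ q).
  by move=> kk0; apply: measurable_funS (measurable_decay_ratio al kk0 p q).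
have mh p : measurable_fun Dm (h p).
  rewrite /h; case: (p == 0%N); first exact: measurable_cst.
  by apply: measurable_funM => //; exact: mJ.
have msum : measurable_fun Dm (fun u => \sum_(0 <= p < M) h p u) by exact: measurable_sum.
have mrem : measurable_fun Dm rem.
  by apply: measurable_funB => //; apply: measurable_funB; exact: mJ.
have mDm : measurable Dm by exact: measurable_itv.
have fJ (kk : R) p q : 0 < kk -> decay_int al kk u0 p.+1 q.+1 = (fine (decay_int al kk u0 p.+1 q.+1))%:E.
  by move=> kk0; rewrite decay_intE.
have J0 (kk : R) p q u : 0 < kk -> 0 <= decay al kk u ^+ p / (1 + decay al kk u) ^+ q.
  by move=> kk0; rewrite divr_ge0// exprn_ge0// ?addr_ge0// decay_ge0.
have key : (decay_int al kap u0 1 1 = decay_int al (kap * (1 - z)) u0 1 1 +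
    ((gen_poly M (fun p => fine (decay_int al kap u0 p p.+1))).[z])%:E +
    \int[lebesgue_measure]_(u in Dm) (rem u)%:E)%E.
  rewrite /decay_int.
  transitivity (\int[lebesgue_measure]_(u in Dm)
     (((y1 u ^+ 1 / (1 + y1 u) ^+ 1)%:E + (\sum_(0 <= p < M) h p u)%:E) + (rem u)%:E))%E.
    have split3 (a b c : R) : a = b + c + (a - b - c) by ring.
    by apply: eq_integral => u _; rewrite -!EFinD; congr EFin; exact: split3.
  rewrite ge0_integralD//; last 4 first.
  - by move=> u _; rewrite lee_fin addr_ge0 ?J0 ?sumr_ge0.
  - by apply: emeasurable_funD; apply/measurable_EFinP => //; exact: mJ.
  - by move=> u _; rewrite lee_fin; have /andP[] := rem01 u.
  - exact/measurable_EFinP.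
  congr (_ + _)%E; rewrite ge0_integralD//; last 4 first.
  - by move=> u _; rewrite lee_fin J0.
  - by apply/measurable_EFinP; exact: mJ.
  - by move=> u _; rewrite lee_fin sumr_ge0.
  - exact/measurable_EFinP.
  congr (_ + _)%E; under eq_integral do rewrite -sumEFin.
  rewrite ge0_integral_sum//; last 2 first.
  - by move=> p; apply/measurable_EFinP; exact: (mh p).
  - by move=> p u _; rewrite lee_fin.
  rewrite horner_poly big_mkord -sumEFin; apply: eq_bigr => -[[|p] pM] _; rewrite /h/=.
    by rewrite mul0r integral0.
  under eq_integral do rewrite EFinM.
  rewrite ge0_integralZl_EFin ?exprn_ge0//; last 2 first.
  - by move=> u _; rewrite lee_fin J0.
  - by apply/measurable_EFinP; exact: mJ.
  by rewrite muleC EFinM -fJ.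
have r_ge0 : (0 <= \int[lebesgue_measure]_(u in Dm) (rem u)%:E)%E.
  by apply: integral_ge0 => u _; rewrite lee_fin; have /andP[] := rem01 u.
have r_le : (\int[lebesgue_measure]_(u in Dm) (rem u)%:E <= (z ^+ M * fine (decay_int al kap u0 1 1))%:E)%E.
  rewrite EFinM -fJ// /decay_int -ge0_integralZl_EFin ?exprn_ge0//; last 2 first.
  - by move=> u _; rewrite lee_fin J0.
  - by apply/measurable_EFinP; exact: mJ.
  apply: ge0_le_integral => //.
  - by move=> u _; rewrite lee_fin; have /andP[] := rem01 u.
  - exact/measurable_EFinP.
  - by apply: emeasurable_funM => //; apply/measurable_EFinP; exact: mJ.
  - by move=> u _; rewrite -EFinM lee_fin; have /andP[] := rem01 u.
have r_fin : (\int[lebesgue_measure]_(u in Dm) (rem u)%:E)%E \is a fin_num.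
  by rewrite ge0_fin_numE// (le_lt_trans r_le)// ltry.
move: r_le r_ge0 key; rewrite -(fineK r_fin) !lee_fin; set rr := fine _ => rl r0.
rewrite (fJ kap 0%N 0%N k0) (fJ _ 0%N 0%N kz0) -!EFinD => -[].
set a := fine _; set b := fine _; set gz := (gen_poly _ _).[z] => ab.
have -> : b - (a - gz) = - rr by rewrite ab; ring.
by rewrite normrN ger0_norm// mulrC.
Qed.

End DecayExpansion.

(** * Logarithm, Gamma tail and substitutions *)

Section LogLayer.
Context {R : realType}.
Local Notation leb := (@lebesgue_measure R).

Lemma ln1p_layer (s : R) : 0 <= s ->
  (\int[leb]_(b in Ioo0inf) ((b < s)%R%:R / (1 + b))%:E = (ln (1 + s))%:E)%E.
Proof.
move=> s0.
have inv_cont (t : R) : 0 <= t -> {for t, continuous (fun b : R => (1 + b)^-1)}.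
  move=> t0; apply: cvgV; first by rewrite gt_eqF// ltr_pwDl.
  by apply: cvgD; [exact: cvg_cst|exact: cvg_id].
have dF (t : R) : 0 <= t -> is_derive t 1 (fun b : R => ln (1 + b)) (1 + t)^-1.
  move=> t0; have t1 : 0 < 1 + t by rewrite ltr_pwDl.
  have H1 : is_derive t 1 (fun b : R => 1 + b) (0 + 1) by exact: is_deriveD.
  rewrite add0r in H1.
  have := @is_derive1_comp _ (@ln R) (fun b => 1 + b) t _ _ (is_derive1_ln t1) H1.
  by rewrite mulr1.
have cF (t : R) : 0 <= t -> {for t, continuous (fun b : R => ln (1 + b))}.
  by move=> t0; apply/differentiable_continuous/derivable1_diffP; have [] := dF t t0.
have cinv (D : set R) : D `<=` `[0, +oo[ -> {within D, continuous (fun b : R => (1 + b)^-1)}.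
  move=> D0; apply: continuous_in_subspaceT => t /set_mem/D0.
  by rewrite /= in_itv/= andbT; exact: inv_cont.
have -> : (\int[leb]_(b in Ioo0inf) ((b < s)%R%:R / (1 + b))%:E =
    \int[leb]_(b in `]0%R, s[) ((1 + b)^-1)%:E)%E.
  rewrite [LHS]integral_mkcond [RHS]integral_mkcond; apply: eq_integral => b _.
  rewrite !patchE /Ioo0inf !mem_setE !in_itv/= andbT.
  by case: ltP => //= b0; case: ltP => //= bs; rewrite ?mul1r ?mul0r.
have minv (D : set R) : measurable D -> D `<=` `[0, +oo[ ->
    measurable_fun D (EFin \o (fun b : R => (1 + b)^-1)).
  move=> mD D0; apply/measurable_EFinP.
  by apply: subspace_continuous_measurable_fun => //; exact: cinv.
rewrite integral_itv_bndo_bndc; last first.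
  by apply: minv => // b; rewrite /= !in_itv/= => /andP[/ltW ->].
rewrite integral_itv_obnd_cbnd; last first.
  by apply: minv => // b; rewrite /= !in_itv/= => /andP[/ltW ->].
have [->|sN0] := eqVneq s 0.
  by rewrite set_itv1 integral_set1 addr0 ln1.
have sp : 0 < s by rewrite lt_neqAle eq_sym sN0.
rewrite (@continuous_FTC2 _ _ (fun b : R => ln (1 + b)))//.
- by rewrite addr0 ln1 sube0.
- by apply: cinv => b; rewrite /= !in_itv/= => /andP[->].
- split.
  + by move=> b; rewrite in_itv/= => /andP[/ltW b0 _]; have [] := dF b b0.
  + exact: cvg_at_right_filter (cF 0 (lexx 0)).
  + exact: cvg_at_left_filter (cF s s0).
- move=> b; rewrite in_itv/= => /andP[/ltW b0 _]; rewrite derive1E.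
  by have [_ ->] := dF b b0.
Qed.

End LogLayer.

Section ErlangTail.
Context {R : realType}.
Local Notation leb := (@lebesgue_measure R).

(** The probability that a Gamma([M], 1) variable exceeds [y >= 0], or that a Poisson variable of
    mean [y] is less than [M]. *)
Definition erlang_tail (M : nat) (y : R) : R :=
  (\sum_(0 <= m < M) y ^+ m / m`!%:R) * expR (- y).

Lemma erlang_tail_ge0 M y : 0 <= y -> 0 <= erlang_tail M y.
Proof.
by move=> y0; rewrite mulr_ge0 ?expR_ge0// sumr_ge0// => m _; rewrite divr_ge0// exprn_ge0.
Qed.

Lemma erlang_tail_le1 M y : 0 <= y -> erlang_tail M y <= 1.
Proof.
move=> y0; rewrite /erlang_tail expRN ler_pdivrMr ?expR_gt0// mul1r.
exact: exp_taylor_le.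
Qed.

Lemma is_derive_erlang_tail M (y : R) :
  is_derive y 1 (erlang_tail M.+1) (- (y ^+ M / M`!%:R * expR (- y))).
Proof.
have dN : is_derive y 1 (fun h : R => expR (- h)) (- expR (- y)).
  have H : is_derive y 1 (fun h : R => - h) (-1) by exact: is_deriveN.
  have := @is_derive1_comp _ (@expR R) (fun h => - h) y _ _ (is_derive_expR _) H.
  by rewrite mulrN1.
elim: M => [|M IH].
  rewrite (_ : erlang_tail 1 = fun h => expR (- h)); last first.
    by apply/funext => h; rewrite /erlang_tail big_nat1 expr0 fact0 divr1 mul1r.
  by rewrite expr0 fact0 divr1 mul1r.
rewrite (_ : erlang_tail M.+2 = fun h => erlang_tail M.+1 h +
    h ^+ M.+1 * (M.+1`!%:R^-1 * expR (- h))); last first.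
  by apply/funext => h; rewrite /erlang_tail big_nat_recr//= mulrDl -mulrA.
have Hx : is_derive y 1 (fun h : R => h ^+ M.+1) (M.+1%:R * y ^+ M).
  by have := @is_derive_fun_exp _ (fun h => h) M y 1 (is_derive_id _ _); rewrite mulr1.
apply: is_derive_eq; rewrite /GRing.scale/= factS natrM exprS.
have f0 : M`!%:R != 0 :> R by rewrite pnatr_eq0 -lt0n fact_gt0.
have m0 : M.+1%:R != 0 :> R by rewrite pnatr_eq0.
by move: (M.+1%:R) m0 => q q0; field; rewrite f0 q0.
Qed.

Lemma continuous_erlang_tail M : continuous (erlang_tail M).
Proof.
case: M => [|M] y.
  rewrite (_ : erlang_tail 0 = cst 0); first exact: cvg_cst.
  by apply/funext => h; rewrite /erlang_tail big_geq// mul0r.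
apply/differentiable_continuous/derivable1_diffP.
by have [] := is_derive_erlang_tail M y.
Qed.

Lemma cvg_erlang_tail M : erlang_tail M y @[y --> +oo] --> (0 : R).
Proof.
(* From [y^(m+1) / (m+1)! <= e^y], the term of index [m] is at most [(m + 1) / y]. *)
pose C : R := \sum_(0 <= m < M) m.+1%:R.
apply: (@squeeze_cvgr _ _ _ _ (fun=> 0) (fun y : R => C * y `^ (- 1))).
- near=> y; have y0 : 0 < y by near: y; exact: nbhs_pinfty_gt.
  rewrite erlang_tail_ge0 ?(ltW y0)//= /erlang_tail /C !mulr_suml; apply: ler_sum => m _.
  rewrite powR_inv1 ?(ltW y0)// ler_pdivlMr//.
  have := pow_fact_le_exp m.+1 (ltW y0).
  rewrite expRN ler_pdivrMr ?ltr0n ?fact_gt0// => H.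
  rewrite mulrAC ler_pdivrMr ?expR_gt0// mulrAC -exprSr ler_pdivrMr ?ltr0n ?fact_gt0//.
  by apply: le_trans H _; rewrite factS natrM mulrCA mulrA.
- exact: cvg_cst.
- by rewrite -[X in _ --> X](mulr0 C); apply: cvgMr; exact: cvg_powRN.
Unshelve. all: by end_near. Qed.

Lemma gamma_tail M (y : R) : 0 <= y ->
  (\int[leb]_(h in `]y, +oo[) (h ^+ M * expR (- h) / M`!%:R)%:E = (erlang_tail M.+1 y)%:E)%E.
Proof.
move=> y0.
pose f (h : R) : R := h ^+ M * expR (- h) / M`!%:R.
have dF (h : R) : is_derive h 1 (fun t => - erlang_tail M.+1 t) (f h).
  have := is_derive_erlang_tail M h => H.
  by apply: is_derive_eq; rewrite opprK /f mulrAC.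
have cf : continuous f.
  move=> h; apply: cvgMl; apply: cvgM; first exact: exprn_continuous.
  apply: (@continuous_comp _ _ _ (fun t : R => - t) expR); first exact: opp_continuous.
  exact: continuous_expR.
rewrite integral_itv_obnd_cbnd; last first.
  by apply/measurable_EFinP; apply: measurable_funTS; exact: continuous_measurable_fun.
rewrite (@ge0_continuous_FTC2y _ f (fun t => - erlang_tail M.+1 t) y 0).
- by rewrite -EFinB sub0r opprK.
- move=> h yh; rewrite /f divr_ge0// mulr_ge0 ?expR_ge0// exprn_ge0//.
  exact: le_trans yh.
- by apply: continuous_subspaceT.
- by rewrite -oppr0; apply: cvgN; exact: cvg_erlang_tail.
- by move=> h _; have [] := dF h.
- by apply: cvg_at_right_filter; apply: cvgN; exact: continuous_erlang_tail.
- by move=> h _; rewrite derive1E; have [_ ->] := dF h.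
Qed.

End ErlangTail.

Section SquareSubstitution.
Context {R : realType}.
Local Notation leb := (@lebesgue_measure R).

(** The Jacobian of squaring, cut at 0: the negative half-line carries no mass, so squaring is
    injective where the mass lies. *)
Let wt (x : R) : \bar R := (2 * Num.max x 0)%:E.

Let wt_ge0 x : (0 <= wt x)%E.
Proof. by rewrite lee_fin mulr_ge0// le_max lexx orbT. Qed.

Let mwt : measurable_fun setT wt.
Proof. by apply/measurable_EFinP; apply: measurable_funM => //; exact: measurable_maxr. Qed.

Let dwt (A : set (measurableTypeR R)) : \bar R := (\int[leb]_(x in A) wt x)%E.

Let dwt0 : dwt set0 = 0%E. Proof. exact: integral_set0. Qed.

Let dwt_ge0 A : (0 <= dwt A)%E. Proof. by apply: integral_ge0. Qed.

Let dwt_sigma : semi_sigma_additive dwt.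
Proof. exact: semi_sigma_additive_nng_induced. Qed.

HB.instance Definition _ := isMeasure.Build _ (measurableTypeR R) R dwt dwt0 dwt_ge0 dwt_sigma.

Let sq (x : measurableTypeR R) : measurableTypeR R := x ^+ 2.

Let msq : measurable_fun setT sq.
Proof. exact: (@measurable_funX _ (measurableTypeR R) R setT idfun 2 (@measurable_id _ _ _)). Qed.

Let dwt_itv (a b : R) : a < b ->
  dwt (sq @^-1` `]a, b]) = (Num.max b 0 - Num.max a 0)%:E.
Proof.
move=> ab; set a' := Num.max a 0; set b' := Num.max b 0.
have a'0 : 0 <= a' by rewrite le_max lexx orbT.
have b'0 : 0 <= b' by rewrite le_max lexx orbT.
have -> : dwt (sq @^-1` `]a, b]) = (\int[leb]_(x in `](Num.sqrt a'), (Num.sqrt b')]) (2 * x)%:E)%E.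
  rewrite /dwt [LHS]integral_mkcond [RHS]integral_mkcond; apply: eq_integral => x _.
  rewrite !patchE /wt [in RHS]mem_setE [in RHS]in_itv/=.
  have [x0|x0] := ltP 0 x; last first.
    rewrite mulr0 (le_gtF (le_trans x0 (sqrtr_ge0 _)))/=.
    by case: ifP.
  have -> : (x \in sq @^-1` `]a, b]) = (a < x ^+ 2) && (x ^+ 2 <= b).
    by apply/idP/idP => [/set_mem|H]; [|apply/mem_set]; rewrite /= in_itv.
  have xx : x = Num.sqrt (x ^+ 2) by rewrite sqrtr_sqr gtr0_norm.
  have x20 : 0 < x ^+ 2 by rewrite exprn_gt0.
  have -> : (Num.sqrt a' < x) = (a' < x ^+ 2) by rewrite {1}xx ltr_sqrt.
  have -> : (x <= Num.sqrt b') = (x ^+ 2 <= b') by rewrite {1}xx ler_sqrt.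
  by rewrite /a' /b' gt_max x20 andbT le_max [x ^+ 2 <= 0]leNgt x20 orbF.
have [ab'|ab'] := ltP (Num.sqrt a') (Num.sqrt b'); last first.
  rewrite set_itv_ge ?bnd_simp -?leNgt// integral_set0.
  have : b' <= a' by rewrite -(sqr_sqrtr a'0) -(sqr_sqrtr b'0) lerXn2r// nnegrE.
  have : a' <= b' by rewrite /a' /b' ge_max !le_max (ltW ab) lexx orbT.
  by move=> H1 H2; congr EFin; lra.
have c2 : continuous (fun x : R => 2 * x) by move=> x; apply: cvgMr; exact: cvg_id.
have dF (x : R) : is_derive x 1 (fun x : R => x ^+ 2) (2 * x).
  by have := @is_derive_fun_exp _ (fun h => h) 1 x 1 (is_derive_id _ _); rewrite mulr1.
rewrite integral_itv_obnd_cbnd; last first.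
  by apply/measurable_EFinP; apply: measurable_funTS; exact: continuous_measurable_fun.
rewrite (@continuous_FTC2 _ _ (fun x : R => x ^+ 2))//.
- by rewrite !sqr_sqrtr.
- exact: continuous_subspaceT.
- split.
  + by move=> x _; have [] := dF x.
  + by apply: cvg_at_right_filter; exact: exprn_continuous.
  + by apply: cvg_at_left_filter; exact: exprn_continuous.
- by move=> x _; rewrite derive1E; have [_ ->] := dF x.
Qed.

(** The image of the weighted measure is Lebesgue measure on the positive half-line. As for the
    squared norm in the plane, it is completed on the nonpositive half-line so that uniqueness of
    Lebesgue measure applies. *)
Let dwt_image (A : set R) : measurable A -> dwt (sq @^-1` A) = leb (A `&` `]0%R, +oo[).
Proof.
move=> mA.
pose q := @measure_function_pushforward__canonical__measure_function_Measure
  _ _ _ (measurableTypeR R) _ dwt sq msq.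
have mneg : measurable (`]-oo, 0] : set R) by exact: measurable_itv.
pose m' := measure_add q (mrestr leb mneg).
have m'E B : m' B = (dwt (sq @^-1` B) + leb (B `&` `]-oo, 0%R]))%E.
  by rewrite /m' /measure_add/= /msum big_ord_recl big_ord1/=.
have lebm' B : measurable B -> leb B = m' B.
  move=> mB; apply: lebesgue_measure_unique => // _ [[a b] _ <-]/=.
  apply: (@etrans _ _ _ _ _ (esym (m'E _))).
  have [ab|ba] := ltP a b; last first.
    by rewrite set_itv_ge ?preimage_set0 ?set0I ?measure0 ?adde0// bnd_simp -leNgt.
  rewrite dwt_itv//.
  have -> : leb (`]a, b] `&` `]-oo, 0%R]) = (Num.min b 0 - Num.min a 0)%:E.
    rewrite (_ : _ `&` _ = `]a, (Num.min b 0)]%classic); last first.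
      apply/seteqP; split => x /=; rewrite !in_itv/= le_min.
        by move=> [/andP[-> ->]].
      by move=> /and3P[-> -> ->].
    rewrite lebesgue_measure_itv/= lte_fin lt_min ab/=.
    by case: ltP => a0; rewrite // (min_r (ltW (le_lt_trans a0 ab))) subrr.
  rewrite lebesgue_measure_itv/= lte_fin ab -EFinB -EFinD; congr EFin.
  by rewrite /Num.max /Num.min; case: ifP; case: ifP; lra.
have mpos : measurable (`]0, +oo[ : set R) by exact: measurable_itv.
rewrite lebm'; last exact: measurableI.
apply: esym; apply: (etrans (m'E _)).
rewrite -setIA (_ : `]0, +oo[ `&` `]-oo, 0] = set0 :> set R) ?setI0 ?measure0 ?adde0; last first.
  by apply/seteqP; split => x //=; rewrite !in_itv/= andbT => -[x0]; rewrite leNgt x0.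
rewrite /dwt [LHS]integral_mkcond [RHS]integral_mkcond; apply: eq_integral => x _.
rewrite !patchE.
have [x0|x0] := ltP 0 x; last first.
  by rewrite /wt (max_r x0) mulr0; case: ifP; case: ifP.
congr (if _ then _ else _); apply/idP/idP => /set_mem H; apply/mem_set.
  by case: H.
by split => //=; rewrite in_itv/= andbT exprn_gt0.
Qed.

Lemma integral_sqr_subst (g : R -> \bar R) : measurable_fun setT g -> (forall y, 0 <= g y)%E ->
  (\int[leb]_x (g (x ^+ 2)%R * (2 * Num.max x 0)%:E) = \int[leb]_(y in `]0%R, +oo[) g y)%E.
Proof.
move=> mg g0.
have mpos : measurable (`]0, +oo[ : set R) by exact: measurable_itv.
rewrite [RHS]integral_mkcond epatch_indic.
have m1 : measurable_fun setT (fun x : R => (\1_(`]0, +oo[ : set R) x)%:E : \bar R).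
  by apply/measurable_EFinP; exact: measurable_indic.
rewrite -(@eq_weighted_image_integral _ _ _ (measurableTypeR R) (measurableTypeR R)
  (measurableTypeR R) R leb leb sq idfun wt
  (fun x => (\1_(`]0, +oo[ : set R) x)%:E) g) //.
- exact: (@measurable_id _ (measurableTypeR R)).
- move=> A mA; rewrite integral_indic//.
  rewrite setIC; exact: dwt_image.
Qed.

End SquareSubstitution.

(** * Products of independent factors; size and measurability of the decay integrals *)

Section IndependentProduct.
Context d (T : measurableType d) (R : realType) (P : probability T R).

(** By induction on [s]: the product of the remaining factors is measurable for the sigma-algebra
    generated by the families other than that of the head, hence independent of the head. *)
Lemma mutually_indep_prod (I : finType) (F : I -> set (set T)) (Z : I -> T -> R) (z : I -> R)
    (s : seq I) :
  mutually_indep P F -> (forall i, F i `<=` measurable) ->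
  (forall i, F i setT) -> (forall i, setI_closed (F i)) -> uniq s ->
  (forall i, i \in s -> forall A, measurable A -> F i (Z i @^-1` A)) ->
  (forall i w, 0 <= Z i w) ->
  (forall i, i \in s -> (\int[P]_w (Z i w)%:E = (z i)%:E)%E) ->
  (\int[P]_w (\prod_(i <- s) Z i w)%:E = (\prod_(i <- s) z i)%:E)%E.
Proof.
move=> indF mF FT FI us FZ Z0 hz.
have mZ i : i \in s -> measurable_fun setT (Z i).
  by move=> si _ A mA; rewrite setTI; apply: mF (FZ i si A mA).
elim: s us FZ hz mZ => [|i s IH]/=.
  by move=> *; under eq_integral do rewrite big_nil; rewrite big_nil integral_cst//= probability_setT mule1.
move=> /andP[iNs us] FZ hz mZ.
under eq_integral do rewrite big_cons EFinM.
have mp : measurable_fun setT (fun w => \prod_(j <- s) Z j w).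
  by apply: measurable_prod => j js; apply: mZ; rewrite inE js orbT.
rewrite indep_integralM.
- rewrite hz ?mem_head// IH//.
  + by rewrite -EFinM big_cons.
  + by move=> j js; apply: FZ; rewrite inE js orbT.
  + by move=> j js; apply: hz; rewrite inE js orbT.
  + by move=> j js; apply: mZ; rewrite inE js orbT.
- by apply/measurable_EFinP; apply: mZ; rewrite mem_head.
- by move=> w; rewrite lee_fin.
- exact/measurable_EFinP.
- by move=> w; rewrite lee_fin prodr_ge0.
- move=> A B mA mB.
  have mE (C : set (\bar R)) : measurable C -> measurable (@EFin R @^-1` C).
    by move=> mC; rewrite -[X in measurable X]setTI; exact: EFin_measurable.
  apply: (mutually_indep_group indF mF FT FI (i0 := i)).
    exact: (FZ _ (mem_head _ _) _ (mE A mA)).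
  pose G := \bigcup_(j in [set j | j != i]) F j.
  have mGp : measurable_fun [set: g_sigma_algebraType G] (fun w => \prod_(j <- s) Z j w).
    apply: measurable_prod => j js _ C mC; rewrite setTI; apply: sub_sigma_algebra.
    exists j => /=; last by apply: FZ => //; rewrite inE js orbT.
    by apply: contra iNs => /eqP <-.
  by have := mGp measurableT _ (mE B mB); rewrite setTI.
Qed.

End IndependentProduct.

Section DecayBounds.
Context {R : realType}.
Local Notation leb := (@lebesgue_measure R).

(** Since [y / (1 + y) <= y], the bound is linear in [t]. The Laplace exponent therefore vanishes as
    [t] tends to 0, which will give almost sure finiteness of the interference. *)
Lemma decay_int11_le (al t u0 : R) : 2 < al -> 0 < t -> 0 < u0 ->
  fine (decay_int al t u0 1 1) <= t * (u0 * (2 / al) * u0 `^ (- (al / 2)) / (1 - 2 / al)).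
Proof.
move=> al2 t0 u00; rewrite -lee_fin fineK; last by rewrite decay_intE.
apply: le_trans (decay_int_le _ _ _ _ _) _ => //.
rewrite decay_int0// lee_fin le_eqVlt; apply/orP; left; apply/eqP.
by rewrite /decay expr1 !mulrA; ring.
Qed.

(** For [t = A^(al/2)] the decay is at least 1 up to [A], so the integrand is at least 1/2 on an
    interval of length [2 L]. Unboundedness of the Laplace exponent will give almost sure positivity
    of the interference. *)
Lemma decay_int11_large (al u0 L : R) : 2 < al -> 0 < u0 -> 0 < L ->
  exists2 t, 0 < t & L <= fine (decay_int al t u0 1 1).
Proof.
move=> al2 u00 L0.
pose A := u0 + 2 * L.
have A0 : 0 < A by rewrite /A; lra.
have uA : u0 < A by rewrite /A; lra.
exists (A `^ (al / 2)); first by rewrite powR_gt0.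
set t := A `^ _; have t0 : 0 < t by rewrite powR_gt0.
rewrite -lee_fin fineK; last by rewrite decay_intE.
have -> : L%:E = (\int[leb]_(u in `[u0, A]) (2^-1)%:E)%E.
  rewrite integral_cst//= lebesgue_measure_itv/= lte_fin uA -EFinB -EFinM.
  by congr EFin; rewrite /A; field.
apply: (@le_trans _ _ (\int[leb]_(u in `[u0, A]) (decay al t u ^+ 1 / (1 + decay al t u) ^+ 1)%:E)%E).
  apply: ge0_le_integral => //.
  - by apply/measurable_EFinP; exact: measurable_funS (measurable_decay_ratio al t0 1 1).
  - move=> u; rewrite /= in_itv/= => /andP[uu uA'].
    have yA : 1 <= decay al t u.
      apply: le_trans (decay_nincr al2 t0 (lt_le_trans u00 uu) uA').
      by rewrite /decay /t -powRD ?subrr ?powRr0// (gt_eqF A0) implybT.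
    rewrite lee_fin !expr1 ler_pdivlMr; last by lra.
    lra.
apply: ge0_subset_integral => //.
- by apply/measurable_EFinP; exact: measurable_funS (measurable_decay_ratio al t0 1 1).
- by move=> u _; rewrite lee_fin divr_ge0// exprn_ge0// ?addr_ge0// decay_ge0.
- by move=> u; rewrite /= !in_itv/= => /andP[->].
Qed.

(* The maximum with 0 makes the map measurable on the whole line. *)
Lemma measurable_decay_int (al u0 : R) p q :
  measurable_fun setT (fun t : R => decay_int al (Num.max t 0) u0 p q).
Proof.
rewrite /decay_int; under eq_fun do rewrite integral_mkcond.
pose f (z : measurableTypeR R * measurableTypeR R) : \bar R :=
  ((decay al (Num.max z.1 0) z.2 ^+ p / (1 + decay al (Num.max z.1 0) z.2) ^+ q)
    * \1_(`[u0, +oo[ : set R) z.2)%:E.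
have d0 (z : R * R) : 0 <= decay al (Num.max z.1 0) z.2.
  by rewrite mulr_ge0 ?powR_ge0// le_max lexx orbT.
have md : measurable_fun setT (fun z : measurableTypeR R * measurableTypeR R =>
    decay al (Num.max z.1 0) z.2).
  apply: measurable_funM.
    apply: (measurable_maxr (f := fst) (g := cst 0)) => //.
  exact: (measurableT_comp (measurable_powR (- (al / 2))) measurable_snd).
have mf : measurable_fun setT f.
  apply/measurable_EFinP; apply: measurable_funM; last first.
    have mi : measurable_fun setT (\1_(`[u0, +oo[ : set R) : measurableTypeR R -> R).
      by apply: measurable_indic; exact: measurable_itv.
    exact: (measurableT_comp mi measurable_snd).
  apply: measurable_funM; first exact: measurable_funX.
  rewrite (_ : (fun x => _) = (fun z => (1 + decay al (Num.max z.1 0) z.2) `^ (- q%:R))); last first.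
    by apply/funext => z; rewrite powRN powR_mulrn// addr_ge0.
  by apply: (measurableT_comp (measurable_powR _)); exact: measurable_funD.
have f0 z : (0 <= f z)%E.
  by rewrite lee_fin mulr_ge0// divr_ge0// exprn_ge0// addr_ge0.
have := @measurable_fun_fubini_tonelli_F _ _ _ _ R leb f mf f0.
rewrite /fubini_F; apply: eq_measurable_fun => t _.
apply: eq_integral => u _; rewrite epatch_indic /f/= EFinM.
by [].
Qed.

End DecayBounds.

Section GenPolyMeasurable.
Context {R : realType} d (T : measurableType d).

Lemma measurable_gen_poly_pow M (g : nat -> T -> R) i n :
  (forall p, measurable_fun setT (g p)) ->
  measurable_fun setT (fun z => ((gen_poly M (fun p => g p z)) ^+ i)`_n).
Proof.
move=> mg.
have mc p : measurable_fun setT (fun z => (gen_poly M (fun p => g p z))`_p).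
  rewrite /gen_poly; under eq_fun do rewrite coef_poly.
  case: (p < M)%N; last exact: measurable_cst.
  by case: (p == 0%N); [exact: measurable_cst|exact: mg].
elim: i n => [|i IH] n; first by (under eq_fun do rewrite expr0); exact: measurable_cst.
rewrite (_ : (fun z => _) = fun z => \sum_(0 <= j < n.+1)
    (gen_poly M (g^~ z))`_j * ((gen_poly M (g^~ z)) ^+ i)`_(n - j)); last first.
  by apply/funext => z; rewrite exprS coefM big_mkord.
by apply: measurable_sum => j; exact: measurable_funM.
Qed.

End GenPolyMeasurable.

(** The upper bound on [f] matters: the real integral is a [fine], which would send an infinite
    value to 0. *)
Lemma Rintegral_itv_gt0 (R : realType) (f : R -> R) (r a : R) :
  0 < r -> 0 < a -> measurable_fun setT f -> (forall x, 0 <= x <= r -> a <= f x) ->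
  (forall x, f x <= 1) -> 0 < \int[@lebesgue_measure R]_(x in `[0, r]) f x.
Proof.
move=> r0 a0 mf lo hi.
have m0 : measurable (`[0, r] : set R) by exact: measurable_itv.
have lc (b : R) : (\int[@lebesgue_measure R]_(x in `[0%R, r]) b%:E = (b * r)%:E)%E.
  by rewrite integral_cst//= lebesgue_measure_itv/= lte_fin r0 sube0.
have mE : measurable_fun `[0, r] (fun x => (f x)%:E).
  by apply/measurable_EFinP; exact: measurable_funS mf.
have f0 (x : R) : `[0, r]%classic x -> 0 <= f x.
  by rewrite /= in_itv/= => /lo; apply: le_trans; exact: ltW.
have L : ((a * r)%:E <= \int[@lebesgue_measure R]_(x in `[0%R, r]) (f x)%:E)%E.
  rewrite -lc; apply: ge0_le_integral => //.
  by move=> x _; rewrite lee_fin ltW.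
have U : (\int[@lebesgue_measure R]_(x in `[0%R, r]) (f x)%:E <= (1 * r)%:E)%E.
  by rewrite -lc; apply: ge0_le_integral => // x; rewrite lee_fin//; exact: f0.
rewrite /Rintegral; apply: fine_gt0; apply/andP; split.
  by apply: lt_le_trans L; rewrite lte_fin mulr_gt0.
by apply: le_lt_trans U _; rewrite ltry.
Qed.

(** * The network parameters *)

Section NetworkFacts.
Context {R : realType}.
Variables (K : nat) (lam Pw Bb alpha : 'I_K -> R) (Mant : 'I_K -> nat)
  (lam_u eps : R).
Hypotheses (hlam : forall j, 0 < lam j) (hlam_u : 0 < lam_u)
  (hPw : forall j, 0 < Pw j) (hBb : forall j, 0 < Bb j)
  (halpha : forall j, 2 < alpha j) (hMant : forall j, (0 < Mant j)%N)
  (heps : 0 < eps).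

Local Notation leb := (@lebesgue_measure R).
Local Notation Om := (Omega Pw Bb Mant).
Local Notation de := (delta alpha).
Local Notation Rd := (Rad Pw Bb alpha Mant eps).
Local Notation excl := (excl_radius Pw Bb alpha Mant).
Local Notation Act := (Aact lam Pw Bb alpha Mant lam_u eps).

Lemma alpha_gt0 j : 0 < alpha j.
Proof. by apply: lt_trans (halpha j). Qed.

Lemma Omega_gt0 j : 0 < Om j.
Proof. by rewrite /Omega !mulr_gt0// ltr0n. Qed.

Lemma Omega_ratio_gt0 j k : 0 < Om j / Om k.
Proof. by rewrite divr_gt0// Omega_gt0. Qed.

Lemma delta_gt0 j : 0 < de j.
Proof. by rewrite divr_gt0// alpha_gt0. Qed.

Lemma Rad_gt0 k : 0 < Rd k.
Proof. by rewrite powR_gt0// divr_gt0// Omega_gt0. Qed.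

Lemma measurable_powR_sum (a b : 'I_K -> R) :
  measurable_fun setT (fun x : R => \sum_(j < K) a j * x `^ b j).
Proof.
apply: measurable_sum => j; apply: measurable_funM => //; exact: measurable_powR.
Qed.

Lemma measurable_assoc_exp k : measurable_fun setT (assoc_exp lam Pw Bb alpha Mant k).
Proof.
apply: measurableT_comp => //; apply: measurable_funN; apply: measurable_funM => //.
exact: measurable_powR_sum.
Qed.

Lemma assoc_int_gt0 k : 0 < assoc_int lam Pw Bb alpha Mant eps k.
Proof.
have r0 : 0 < Rd k ^+ 2 by rewrite exprn_gt0// Rad_gt0.
apply: (@Rintegral_itv_gt0 _ _ _ (assoc_exp lam Pw Bb alpha Mant k (Rd k ^+ 2)) r0
  (expR_gt0 _) (measurable_assoc_exp k)).
  move=> x /andP[x0 xr]; rewrite ler_expR lerN2 ler_pM2l ?pi_gt0//.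
  apply: ler_sum => j _; apply: ler_wpM2l.
    by rewrite mulr_ge0 ?powR_ge0// ltW.
  have e0 : 0 <= de j / de k by rewrite divr_ge0// ltW// delta_gt0.
  by apply: ge0_ler_powR; rewrite ?nnegrE//; exact: ltW r0.
move=> x; rewrite /assoc_exp -expR0 ler_expR oppr_le0 mulr_ge0 ?pi_ge0// sumr_ge0// => j _.
by rewrite !mulr_ge0 ?powR_ge0// ltW.
Qed.

Lemma Tassoc_gt0 k : 0 < Tassoc lam Pw Bb alpha Mant eps k.
Proof. by rewrite !mulr_gt0 ?pi_gt0// assoc_int_gt0. Qed.

Lemma Aact_gt0 k : 0 < Act k.
Proof.
rewrite /Aact subr_gt0 -expR0 ltr_expR oppr_lt0 !mulr_gt0 ?pi_gt0//.
exact: assoc_int_gt0.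
Qed.

Lemma excl_radius_gt0 j k (x : R) : 0 < x -> 0 < excl j k x.
Proof. by move=> x0; rewrite mulr_gt0// powR_gt0// Omega_ratio_gt0. Qed.

Lemma excl_radius_homo j k (x y : R) : 0 <= x -> x <= y -> excl j k x <= excl j k y.
Proof.
move=> x0 xy; rewrite ler_wpM2l ?powR_ge0//.
have e0 : 0 <= alpha k / alpha j by rewrite divr_ge0// ltW// alpha_gt0.
by apply: ge0_ler_powR; rewrite ?nnegrE//; exact: le_trans xy.
Qed.

Lemma cvg_powR_seq (b x : R) (u : R^nat) : 0 < x -> u @ \oo --> x ->
  u n `^ b @[n --> \oo] --> x `^ b.
Proof.
move=> x0 ux.
have c : {for x, continuous (fun y : R => expR (b * ln y))}.
  apply: (@continuous_comp _ _ _ (fun y : R => b * ln y) expR); last exact: continuous_expR.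
  by apply: cvgMr; exact: continuous_ln.
have := @cvg_comp _ _ _ u (fun y : R => expR (b * ln y)) _ _ _ ux c.
rewrite [x `^ b]/powR (gt_eqF x0) => H; apply: cvg_trans H; apply: near_eq_cvg.
near=> n; rewrite /powR gt_eqF//.
by near: n; apply: (cvgr_gt x).
Unshelve. all: by end_near. Qed.

Lemma cvg_excl_radius j k (x : R) : 0 < x ->
  excl j k (updyadic n x) @[n --> \oo] --> excl j k x.
Proof.
move=> x0; apply: cvgMr; apply: cvg_powR_seq => //.
by apply: cvg_updyadic; rewrite ltW.
Qed.

(** A default value: [ln] is 0 at negative arguments, so a negative base raised to any power gives
    1. This lets measurability of the interference be proved for an arbitrary real [X]. *)
Lemma excl_radius_lt0 j k (x : R) : x < 0 -> excl j k x = excl j k (-1).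
Proof.
move=> x0; rewrite /excl_radius /powR oppr_eq0 oner_eq0 (lt_eqF x0).
by rewrite (ln0 (ltW x0)) (ln0 (lerN10 R)).
Qed.

Lemma excl_radius_sqr j k (x : R) : 0 <= x ->
  excl j k x ^+ 2 = (Om j / Om k) `^ de j * (x ^+ 2) `^ (de j / de k).
Proof.
move=> x0.
have sqE (y p : R) : (y `^ p) ^+ 2 = y `^ (p * 2).
  by rewrite -powR_mulrn ?powR_ge0// -powRrM.
rewrite exprMn !sqE -[in RHS](powR_mulrn 2 x0) -[in RHS]powRrM; congr (_ `^ _ * _ `^ _).
  by rewrite mulrC.
by rewrite /delta; field; rewrite !gt_eqF// alpha_gt0.
Qed.

(** At the edge of the exclusion disk the biased received powers of tiers [j] and [k] are equal. The
    distance and the transmit powers cancel, and only the threshold and the ratios of antennas and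
    biases remain. *)
Lemma decay_excl_radius j k (x b : R) : 0 < x ->
  decay (alpha j) (b * x `^ alpha k / Pw k * Pw j) (excl j k x ^+ 2) = tauf Bb Mant j k b.
Proof.
move=> x0; rewrite excl_radius_sqr ?(ltW x0)// /decay powRM ?powR_ge0// -!powRrM.
rewrite (_ : de j * - (alpha j / 2) = -1); last by rewrite /delta; field; rewrite !gt_eqF// alpha_gt0.
rewrite -powR_mulrn ?(ltW x0)// -powRrM.
rewrite (_ : 2%:R * (de j / de k * - (alpha j / 2)) = - alpha k); last first.
  by rewrite /delta; field; rewrite !gt_eqF// alpha_gt0.
rewrite powR_inv1 ?(ltW (Omega_ratio_gt0 _ _))// powRN /tauf /Omega.
have := powR_gt0 (alpha k) x0; move: (x `^ alpha k) => y y0.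
have mj : (Mant j)%:R != 0 :> R by rewrite pnatr_eq0 -lt0n.
have mk : (Mant k)%:R != 0 :> R by rewrite pnatr_eq0 -lt0n.
by field; rewrite mj mk !gt_eqF.
Qed.

(* The (n, n+1) moment of the decay integral, with the (1,1) one for n = 0. *)
Lemma gf_decay_int k n (x b : R) : 0 < x -> 0 < b ->
  pi * gf lam Pw Bb alpha Mant lam_u eps k n (x ^+ 2) b =
  \sum_(j < K) Act j * lam j * pi *
    fine (decay_int (alpha j) (b * x `^ alpha k / Pw k * Pw j) (excl j k x ^+ 2) (maxn n 1) n.+1).
Proof.
move=> x0 b0; rewrite /gf mulr_sumr; apply: eq_bigr => j _.
have e0 : 0 < excl j k x ^+ 2 by rewrite exprn_gt0// excl_radius_gt0.
have k0 : 0 < b * x `^ alpha k / Pw k * Pw j.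
  by rewrite mulr_gt0// divr_gt0// mulr_gt0// powR_gt0.
have phE : fine (decay_int (alpha j) (b * x `^ alpha k / Pw k * Pw j) (excl j k x ^+ 2) (maxn n 1) n.+1)
    = excl j k x ^+ 2 * phif Bb alpha Mant j k n b.
  rewrite /phif; case: n => [|n].
    rewrite /= (@decay_intE _ _ _ _ (halpha j) k0 e0 0 0) decay_excl_radius//.
  rewrite (_ : maxn n.+1 1 = n.+1); last by rewrite maxnE; lia.
  by rewrite (@decay_intE _ _ _ _ (halpha j) k0 e0 n n.+1) decay_excl_radius.
rewrite phE excl_radius_sqr ?(ltW x0)//; ring.
Qed.

End NetworkFacts.

(** * Total interference *)

Section MeasurableInterference.
Context {R : realType}.
Local Notation pt := ((R * R) * R)%type.
Variables (K : nat) (Pw Bb alpha : 'I_K -> R) (Mant : 'I_K -> nat) (k : 'I_K).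
Hypotheses (hPw : forall j, 0 < Pw j) (halpha : forall j, 2 < alpha j).
Context d (T : measurableType d) (N : 'I_K -> T -> {measure set pt -> \bar R}).
Hypothesis mN : forall j B, measurable B -> measurable_fun setT (fun w => N j w B : \bar R).

Local Notation excl := (excl_radius Pw Bb alpha Mant).
Local Notation I_ x w := (interference Pw Bb alpha Mant k (fun=> x) N w).

Lemma interference_tiers (x : R) w :
  I_ x w = (\sum_(j < K) tier_interference (Pw j) (alpha j) (excl j k x) (N j w))%E.
Proof. by []. Qed.

Lemma interference_ge0 (x : R) w : (0 <= I_ x w)%E.
Proof. by apply: sume_ge0 => j _; exact: tier_interference_ge0 (ltW (hPw j)). Qed.

Lemma measurable_interference_cst (x : R) : measurable_fun setT (fun w => I_ x w).
Proof.
apply: emeasurable_sum => j.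
exact: (measurable_tier_interference _ _ (ltW (hPw j)) (mN j)).
Qed.

Lemma interference_nincr (x y : R) w : 0 <= x -> x <= y -> (I_ y w <= I_ x w)%E.
Proof.
move=> x0 xy; apply: lee_sum => j _.
by apply: tier_interference_nincr; [exact: ltW|exact: excl_radius_homo].
Qed.

Lemma cvg_interference (x : R) w : 0 < x -> I_ (updyadic n x) w @[n --> \oo] --> I_ x w.
Proof.
move=> x0; apply: (@cvg_nnesum _ _ _ _ _ _
  (fun j n => tier_interference (Pw j) (alpha j) (excl j k (updyadic n x)) (N j w))) => j _.
  by apply: nearW => n; exact: tier_interference_ge0 (ltW (hPw j)).
have up0 n : 0 <= updyadic n x by apply: ltW; exact: lt_trans (updyadic_gt _ _).
apply: cvg_tier_interference; first exact: ltW.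
- by move=> n; apply: excl_radius_homo => //; rewrite ltW// updyadic_gt.
- by move=> m n mn; apply: excl_radius_homo => //; exact: updyadic_nincr.
- exact: cvg_excl_radius.
Qed.

(** Dyadic approximation works at positive distances, so [X] is replaced by 1 elsewhere. What is
    left are two constant distances: 0, and -1 standing for all negative ones. *)
Lemma measurable_interference (X : T -> R) : measurable_fun setT X ->
  measurable_fun setT (fun w => interference Pw Bb alpha Mant k X N w).
Proof.
move=> mX.
pose X' w := if 0 < X w then X w else 1.
have mX' : measurable_fun setT X'.
  by apply: measurable_fun_ifT => //; exact: measurable_fun_ltr.
have X'0 w : 0 < X' w by rewrite /X'; case: ifP.
have mI : measurable_fun setT (fun w => I_ (X' w) w).
  apply: (@measurable_fun_freeze _ _ _ X' (fun x w => I_ x w)) => //.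
    exact: measurable_interference_cst.
  by move=> w; exact: cvg_interference.
rewrite (_ : (fun w => _) = fun w => if 0 < X w then I_ (X' w) w else
    if X w < 0 then I_ (-1) w else I_ 0 w).
  apply: measurable_fun_ifT => //; first exact: measurable_fun_ltr.
  apply: measurable_fun_ifT; first exact: measurable_fun_ltr.
    exact: measurable_interference_cst.
  exact: measurable_interference_cst.
apply/funext => w; rewrite /X'; case: (ltgtP 0 (X w)) => X0.
- by [].
- by rewrite !interference_tiers; apply: eq_bigr => j _; rewrite [excl_radius _ _ _ _ _ _ (X w)]excl_radius_lt0.
- by rewrite /interference -X0.
Qed.

End MeasurableInterference.

Section EventFamilies.
Context {R : realType} d (T : measurableType d).
Local Notation pt := ((R * R) * R)%type.

Lemma events_of_real_measurable (X : T -> R) : measurable_fun setT X ->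
  events_of_real X `<=` measurable.
Proof. by move=> mX _ [A mA ->]; rewrite -[X in measurable X]setTI; exact: mX. Qed.

Lemma events_of_real_setT (X : T -> R) : events_of_real X setT.
Proof. by exists setT; rewrite ?preimage_setT. Qed.

Lemma events_of_real_setI (X : T -> R) : setI_closed (events_of_real X).
Proof.
by move=> _ _ [A mA ->] [B mB ->]; exists (A `&` B); [exact: measurableI|rewrite preimage_setI].
Qed.

Variable N : T -> {measure set pt -> \bar R}.

Lemma events_of_pp_measurable :
  (forall B, measurable B -> measurable_fun setT (fun w => (N w B : \bar R))) ->
  events_of_pp N `<=` measurable.
Proof.
move=> mN; apply: smallest_sub; first exact: sigma_algebra_measurable.
by move=> _ [B [S [mB mS ->]]]; rewrite -[X in measurable X]setTI; exact: mN.
Qed.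

Lemma events_of_pp_setT : events_of_pp N setT.
Proof. exact: (@measurableT _ (g_sigma_algebraType _)). Qed.

Lemma events_of_pp_setI : setI_closed (events_of_pp N).
Proof. exact: (@measurableI _ (g_sigma_algebraType _)). Qed.

Lemma events_of_pp_count B S : measurable B -> measurable S ->
  events_of_pp N ((fun w => N w B) @^-1` S).
Proof. by move=> mB mS; apply: sub_sigma_algebra; exists B, S. Qed.

End EventFamilies.

(** * Laplace transform, almost sure finiteness and positivity of the interference *)

Section InterferenceLaw.
Context {R : realType}.
Local Notation pt := ((R * R) * R)%type.
Variables (K : nat) (Pw Bb alpha : 'I_K -> R) (Mant : 'I_K -> nat) (k : 'I_K).
Hypotheses (hPw : forall j, 0 < Pw j) (hBb : forall j, 0 < Bb j)
  (halpha : forall j, 2 < alpha j) (hMant : forall j, (0 < Mant j)%N).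
Context d (T : measurableType d) (P : probability T R).
Variables (X H : T -> R) (N : 'I_K -> T -> {measure set pt -> \bar R}) (c : 'I_K -> R).
Hypotheses (mX : measurable_fun setT X) (mH : measurable_fun setT H)
  (hc : forall j, 0 < c j) (hN : forall j, is_PPP P (N j) (marked_mean (c j))).

Local Notation excl := (excl_radius Pw Bb alpha Mant).
Local Notation I_ x w := (interference Pw Bb alpha Mant k (fun=> x) N w).
Local Notation F := (fun o : option (option 'I_K) =>
            match o with
            | None => events_of_real X
            | Some None => events_of_real H
            | Some (Some j) => events_of_pp (N j)
            end).

Hypothesis hind : mutually_indep P F.

Local Lemma tier_count_measurable j B : measurable B -> measurable_fun setT (fun w => N j w B : \bar R).
Proof. by case: (hN j) => + _; apply. Qed.

Lemma source_measurable o : F o `<=` measurable.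
Proof.
case: o => [[j|]|]; [|exact: events_of_real_measurable|exact: events_of_real_measurable].
by apply: events_of_pp_measurable; exact: tier_count_measurable.
Qed.

Lemma source_setT o : F o setT.
Proof.
case: o => [[j|]|]; [exact: events_of_pp_setT|exact: events_of_real_setT|exact: events_of_real_setT].
Qed.

Lemma source_setI o : setI_closed (F o).
Proof.
case: o => [[j|]|]; [exact: events_of_pp_setI|exact: events_of_real_setI|exact: events_of_real_setI].
Qed.

Definition laplace_exponent (x t : R) : R := \sum_(j < K) c j * pi *
  fine (decay_int (alpha j) (t * Pw j) (excl j k x ^+ 2) 1 1).

Lemma interference_laplace (x t : R) : 0 < x -> 0 < t ->
  (\int[P]_w (expN (t%:E * I_ x w))%:E = (expR (- laplace_exponent x t))%:E)%E.
Proof.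
move=> x0 t0.
pose Z (o : option (option 'I_K)) w := if o is Some (Some j) then
  expN (t%:E * tier_interference (Pw j) (alpha j) (excl j k x) (N j w))%E else 1.
pose z (o : option (option 'I_K)) : R := if o is Some (Some j) then
  expR (- (c j * pi * fine (decay_int (alpha j) (t * Pw j) (excl j k x ^+ 2) 1 1))) else 1.
pose s := [seq Some (Some j) | j <- index_enum 'I_K].
have e0 j : 0 < excl j k x by exact: excl_radius_gt0.
have t00 : (0 <= t%:E)%E by rewrite lee_fin ltW.
transitivity (\int[P]_w (\prod_(o <- s) Z o w)%:E)%E.
  apply: eq_integral => w _; congr EFin.
  rewrite interference_tiers ge0_sume_distrr; last first.
    by move=> j _; exact: tier_interference_ge0 (ltW (hPw j)).
  rewrite expN_sum; last first.
    by move=> j; apply: mule_ge0 => //; exact: tier_interference_ge0 (ltW (hPw j)).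
  by rewrite big_map.
rewrite (mutually_indep_prod (z := z) hind source_measurable source_setT source_setI).
- congr EFin; rewrite big_map /laplace_exponent -sumrN expR_sum.
  by apply: eq_bigr.
- by rewrite map_inj_uniq ?index_enum_uniq// => i j [].
- move=> _ /mapP[j _ ->] A mA /=.
  pose G := [set E | exists B : set pt, exists S : set (\bar R),
          [/\ measurable B, measurable S & E = (fun w => N j w B) @^-1` S]].
  have mG : measurable_fun [set: g_sigma_algebraType G] (Z (Some (Some j))).
    apply: (measurableT_comp measurable_expN); apply: measurable_funeM.
    apply: measurable_tier_interference; first exact: ltW.
    move=> B mB _ S mS; rewrite setTI; exact: events_of_pp_count.
  by have := mG measurableT A mA; rewrite setTI.
- by move=> [[j|]|] w //=; exact: expN_ge0.
- move=> _ /mapP[j _ ->] /=.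
  rewrite (tier_laplace (c := c j))//; last exact: ltW.
  have tP : 0 < t * Pw j by rewrite mulr_gt0.
  have ee : 0 < excl j k x ^+ 2 by rewrite exprn_gt0.
  by rewrite (@decay_intE _ _ _ _ (halpha j) tP ee 0 0) -EFinM expN_EFin.
Qed.

Lemma laplace_exponent_le (x : R) : 0 < x ->
  exists2 C : R, 0 <= C & forall t : R, 0 < t -> laplace_exponent x t <= t * C.
Proof.
move=> x0; pose e j := excl j k x ^+ 2.
have ee j : 0 < e j by rewrite exprn_gt0// excl_radius_gt0.
have a1 j : 0 < 1 - 2 / alpha j.
  by rewrite subr_gt0 ltr_pdivrMr ?mul1r// (lt_trans _ (halpha j)).
have a0 j : 0 < alpha j by exact: lt_trans (halpha j).
exists (\sum_(j < K) c j * pi * (Pw j * (e j * (2 / alpha j) * e j `^ (- (alpha j / 2)) / (1 - 2 / alpha j)))).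
  apply: sumr_ge0 => j _; apply: mulr_ge0; first by rewrite mulr_ge0 ?pi_ge0// ltW.
  apply: mulr_ge0; first exact: ltW.
  apply: divr_ge0; last exact: ltW.
  by rewrite !mulr_ge0 ?powR_ge0// ?(ltW (ee _))// invr_ge0 ltW.
move=> t t0; rewrite mulr_sumr; apply: ler_sum => j _.
have tP : 0 < t * Pw j by rewrite mulr_gt0.
have := decay_int11_le (halpha j) tP (ee j); move: (fine _) => D HD.
rewrite mulrCA ler_wpM2l//; first by rewrite mulr_ge0 ?pi_ge0// ltW.
by move: HD; rewrite -mulrA.
Qed.

Lemma laplace_exponent_large (x L : R) : 0 < x -> 0 < L ->
  exists2 t : R, 0 < t & L <= laplace_exponent x t.
Proof.
move=> x0 L0.
have ee j : 0 < excl j k x ^+ 2 by rewrite exprn_gt0// excl_radius_gt0.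
have cp : 0 < c k * pi by rewrite mulr_gt0// pi_gt0.
have [t t0 ht] := @decay_int11_large _ _ _ (L / (c k * pi)) (halpha k) (ee k) (divr_gt0 L0 cp).
exists (t / Pw k); first by rewrite divr_gt0.
have term0 j : 0 <= c j * pi * fine (decay_int (alpha j) (t / Pw k * Pw j) (excl j k x ^+ 2) 1 1).
  apply: mulr_ge0; first by rewrite mulr_ge0 ?pi_ge0// ltW.
  apply: fine_ge0; apply: integral_ge0 => u _; rewrite lee_fin.
  have d0 : 0 <= decay (alpha j) (t / Pw k * Pw j) u.
    by rewrite decay_ge0// mulr_gt0// divr_gt0.
  by rewrite divr_ge0// exprn_ge0// addr_ge0.
rewrite /laplace_exponent (bigD1 k)//=; apply: (@le_trans _ _ (c k * pi * fine (decay_int (alpha k) (t / Pw k * Pw k) (excl k k x ^+ 2) 1 1))).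
  by rewrite divfK ?gt_eqF// mulrC -ler_pdivrMr.
by rewrite lerDl sumr_ge0.
Qed.

Local Lemma mI (x : R) : measurable_fun setT (fun w => I_ x w).
Proof. by apply: measurable_interference_cst => // j; exact: tier_count_measurable. Qed.

Local Lemma int_expN_bounds (x t : R) : 0 < t -> forall w, 0 <= expN (t%:E * I_ x w)%E <= 1.
Proof.
move=> t0 w; rewrite expN_ge0 expN_le1// mule_ge0 ?lee_fin ?(ltW t0)//.
exact: interference_ge0.
Qed.

Local Lemma mexpN (x t : R) : measurable_fun setT (fun w => expN (t%:E * I_ x w)%E).
Proof. by apply: (measurableT_comp measurable_expN); apply: measurable_funeM; exact: mI. Qed.

(** The transform at [t] is at most the probability that the interference is finite. Hence the
    probability of an infinite value is at most [1 - e^(-phi(t)) <= phi(t) <= t C], where [phi] is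
    the Laplace exponent, and [t] can be taken arbitrarily small. *)
Lemma ae_interference_fin1 (x : R) : 0 < x -> {ae P, forall w, (I_ x w < +oo)%E}.
Proof.
move=> x0; pose E := [set w | I_ x w = +oo%E].
have mE : measurable E.
  rewrite (_ : E = (fun w => I_ x w) @^-1` [set +oo%E])//.
  by rewrite -[X in measurable X]setTI; apply: mI => //; exact: emeasurable_set1.
exists E; split => //; last by move=> w /= /negP; rewrite -leNgt leye_eq => /eqP.
have [C C0 hC] := laplace_exponent_le x0.
have key (t : R) : 0 < t -> fine (P E) <= t * C.
  move=> t0.
  have le1 : ((expR (- laplace_exponent x t))%:E <= P (~` E))%E.
    have -> : P (~` E) = (\int[P]_w (\1_(~` E) w)%:E)%E.
      by rewrite integral_indic ?setIT//; exact: measurableC.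
    rewrite -interference_laplace//.
    apply: ge0_le_integral => //.
    - by move=> w _; rewrite lee_fin expN_ge0.
    - exact/measurable_EFinP/mexpN.
    - by apply/measurable_EFinP; apply: measurable_indic; exact: measurableC.
    - move=> w _; rewrite lee_fin indicE; case: (boolP (w \in ~` E)) => [_|].
        by have /andP[] := int_expN_bounds x t0 w.
      by rewrite notin_setE => /contrapT ->; rewrite gt0_muley ?lte_fin.
  have : expR (- laplace_exponent x t) <= 1 - fine (P E).
    by rewrite -lee_fin EFinB fineK ?fin_num_measure// -probability_setC.
  have := expR_ge1Dx (- laplace_exponent x t); have := hC t t0.
  lra.
apply/eqP; rewrite eq_le measure_ge0 andbT -[P E]fineK ?fin_num_measure// lee_fin leNgt.
apply/negP => p0; have := key (fine (P E) / (2 * (C + 1))).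
have C1 : 0 < 2 * (C + 1) by lra.
move=> /(_ (divr_gt0 p0 C1)); rewrite mulrAC ler_pdivlMr//.
by move: p0 => /=; move: (fine _) => p p0; nra.
Qed.

(** The probability of the value 0 is at most the transform [e^(-phi(t))] at every [t], and the
    exponent [phi] is unbounded. *)
Lemma ae_interference_gt01 (x : R) : 0 < x -> {ae P, forall w, (0 < I_ x w)%E}.
Proof.
move=> x0; pose E := [set w | I_ x w = 0%E].
have mE : measurable E.
  rewrite (_ : E = (fun w => I_ x w) @^-1` [set 0%E])//.
  by rewrite -[X in measurable X]setTI; apply: mI => //; exact: emeasurable_set1.
exists E; split => //; last first.
  by move=> w /= /negP; rewrite -leNgt => I0; apply/eqP; rewrite eq_le I0 interference_ge0.
have key (L : R) : 0 < L -> fine (P E) <= expR (- L).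
  move=> L0; have [t t0 tL] := laplace_exponent_large x0 L0.
  apply: (@le_trans _ _ (expR (- laplace_exponent x t))); last by rewrite ler_expR lerN2.
  have PE : P E = (\int[P]_w (\1_E w)%:E)%E by rewrite integral_indic ?setIT.
  rewrite -lee_fin fineK ?fin_num_measure// -interference_laplace// PE.
  apply: ge0_le_integral => //.
  - by apply/measurable_EFinP; exact: measurable_indic.
  - by apply/measurable_EFinP; exact: mexpN.
  - move=> w _; rewrite lee_fin indicE; case: (boolP (w \in E)) => [/set_mem ->|_].
      by rewrite mule0 expN_EFin oppr0 expR0.
    exact: expN_ge0.
apply/eqP; rewrite eq_le measure_ge0 andbT -[P E]fineK ?fin_num_measure// lee_fin leNgt.
(* At [L = 1/p] the bound [p <= e^(-1/p)] contradicts [e^(1/p) >= 1 + 1/p > 1/p]. *)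
apply/negP => p0; have := key (fine (P E))^-1.
rewrite invr_gt0 => /(_ p0); rewrite leNgt => /negP; apply.
rewrite expRN invf_plt ?posrE ?expR_gt0//.
by apply: lt_le_trans (expR_ge1Dx _); rewrite ltrDr.
Qed.

(** The interference decreases in the distance, so finiteness along the countable sequence
    [1 / (n + 1)] gives all positive distances off a single null set. *)
Lemma ae_interference_fin : {ae P, forall w, forall x, 0 < x -> (I_ x w < +oo)%E}.
Proof.
have : {ae P, forall w, forall n, (I_ (n.+1%:R^-1)%R w < +oo)%E}.
  by apply: ae_foralln => n; apply: ae_interference_fin1; rewrite invr_gt0.
apply: filterS => w Hw x x0.
have [n] := ltr_add_invr x0; rewrite add0r => nx.
apply: le_lt_trans (Hw n); by apply: interference_nincr => //; exact: ltW.
Qed.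

(** By monotonicity the distance [r] alone settles all smaller ones; [r] will be the access radius,
    which bounds the serving distance. *)
Lemma ae_interference_gt0 (r : R) : 0 < r ->
  {ae P, forall w, forall x, 0 < x <= r -> (0 < I_ x w)%E}.
Proof.
move=> r0; apply: filterS (ae_interference_gt01 r0) => w Iw x /andP[x0 xr].
by apply: lt_le_trans Iw _; apply: interference_nincr => //; exact: ltW.
Qed.

End InterferenceLaw.

(** * Coverage probability at a fixed distance *)

Section CoverageTerms.
Context {R : realType}.
Variables (K : nat) (lam Pw Bb alpha : 'I_K -> R) (Mant : 'I_K -> nat)
  (lam_u eps W : R) (k : 'I_K).
Hypotheses (hlam : forall j, 0 < lam j) (hlam_u : 0 < lam_u)
  (hPw : forall j, 0 < Pw j) (hBb : forall j, 0 < Bb j)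
  (halpha : forall j, 2 < alpha j) (hMant : forall j, (0 < Mant j)%N)
  (heps : 0 < eps) (hW : 0 <= W).

Local Notation Om := (Omega Pw Bb Mant).
Local Notation de := (delta alpha).
Local Notation Act := (Aact lam Pw Bb alpha Mant lam_u eps).
Local Notation g_ n y b := (gf lam Pw Bb alpha Mant lam_u eps k n y b).
Local Notation Q_ y b := (Qmx lam Pw Bb alpha Mant lam_u eps k y b).
Local Notation sig b := (sigmak Pw W k b).

(* The summand of the rate formula without the factors coming from the law of
   the serving distance and from the layer-cake representation of the logarithm. *)
Definition cov_term (i m n : nat) (y b : R) : R :=
  pi ^+ i * sig b ^+ (m - n) / ((m - n)`!%:R * i`!%:R) * y `^ (alpha k / 2 * (m - n)%:R)
  * expR (- sig b * y `^ (alpha k / 2) - pi * g_ 0 y b) * ((Q_ y b) ^+ i) (inord n) ord0.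

(** The probability that the SINR exceeds [b] when the squared serving distance is [y]. *)
Definition coverage (y b : R) : R :=
  \sum_(0 <= i < Mant k) \sum_(0 <= m < Mant k) \sum_(0 <= n < m.+1) cov_term i m n y b.

Lemma rate_integrand_cov_term i m n y b :
  rate_integrand lam Pw Bb alpha Mant lam_u eps W k i m n y b =
  pi * assoc_exp lam Pw Bb alpha Mant k y / (1 + b) * cov_term i m n y b.
Proof.
rewrite /rate_integrand /cov_term /assoc_exp expRD exprS.
set a := \sum_(j < K) _; set q := _ (inord n) ord0.
by rewrite !mulrA; ring.
Qed.

Lemma Qmx_pow_coef i n y b : (n < Mant k)%N ->
  ((Q_ y b) ^+ i) (inord n) ord0 = ((gen_poly (Mant k) (fun p => g_ p y b)) ^+ i)`_n.
Proof.
move=> nM.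
have -> : ((Q_ y b) ^+ i) (inord n) ord0 =
    ((gen_poly (Mant k).-1.+1 (fun p => g_ p y b)) ^+ i)`_(inord n : 'I_((Mant k).-1.+1)).
  exact: toeplitz_pow.
by rewrite inordK ?prednK.
Qed.

(** Normalizing the lower limit to 1 turns the hypergeometric coefficient back into an integral,
    from which its sign and its measurability in [b] are read. *)
Lemma phif_decay_int j n b : 0 < b ->
  phif Bb alpha Mant j k n b =
  fine (decay_int (alpha j) (Num.max (tauf Bb Mant j k b) 0) 1 (maxn n 1) n.+1).
Proof.
move=> b0.
have t0 : 0 < tauf Bb Mant j k b.
  by rewrite divr_gt0// mulr_gt0// divr_gt0// ltr0n.
rewrite (max_l (ltW t0)) /phif.
have d1 : decay (alpha j) (tauf Bb Mant j k b) 1 = tauf Bb Mant j k b.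
  by rewrite /decay powR1 mulr1.
case: n => [|n].
  by rewrite /= (@decay_intE _ _ _ _ (halpha j) t0 ltr01 0 0) d1 /= mul1r.
rewrite (_ : maxn n.+1 1 = n.+1); last by rewrite maxnE; lia.
by rewrite (@decay_intE _ _ _ _ (halpha j) t0 ltr01 n n.+1) d1 /= mul1r.
Qed.

Lemma phif_ge0 j n b : 0 < b -> 0 <= phif Bb alpha Mant j k n b.
Proof.
move=> b0; rewrite phif_decay_int//; apply: fine_ge0; apply: integral_ge0 => u _.
have d0 : 0 <= decay (alpha j) (Num.max (tauf Bb Mant j k b) 0) u.
  by rewrite mulr_ge0 ?powR_ge0// le_max lexx orbT.
by rewrite lee_fin divr_ge0// exprn_ge0// addr_ge0.
Qed.

Lemma gf_ge0 n y b : 0 < b -> 0 <= g_ n y b.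
Proof.
move=> b0; apply: sumr_ge0 => j _.
apply: mulr_ge0; last exact: powR_ge0.
apply: mulr_ge0; last exact: phif_ge0.
apply: mulr_ge0; last exact: powR_ge0.
apply: mulr_ge0; last exact: ltW.
by apply: ltW; exact: Aact_gt0.
Qed.

Lemma gen_poly_pow_ge0 M (g : nat -> R) i n : (forall p, 0 <= g p) ->
  0 <= ((gen_poly M g) ^+ i)`_n.
Proof.
move=> g0; elim: i n => [|i IH] n; first by rewrite expr0 coef1.
rewrite exprS coefM sumr_ge0// => j _; rewrite mulr_ge0// coef_poly.
by case: ifP => // _; case: ifP.
Qed.

Lemma cov_term_ge0 i m n y b : 0 < b -> (n < Mant k)%N -> 0 <= cov_term i m n y b.
Proof.
move=> b0 nM; rewrite /cov_term Qmx_pow_coef//.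
have s0 : 0 <= sig b by rewrite /sigmak divr_ge0 ?mulr_ge0// ltW.
apply: mulr_ge0; last by apply: gen_poly_pow_ge0 => p; exact: gf_ge0.
apply: mulr_ge0; last exact: expR_ge0.
apply: mulr_ge0; last exact: powR_ge0.
by rewrite divr_ge0// ?mulr_ge0// exprn_ge0// pi_ge0.
Qed.

Lemma coverage_ge0 y b : 0 < b -> 0 <= coverage y b.
Proof.
move=> b0; rewrite /coverage; apply: sumr_ge0 => i _.
rewrite big_nat; apply: sumr_ge0 => m /andP[_ mM].
rewrite big_nat; apply: sumr_ge0 => n /andP[_ nm].
by apply: cov_term_ge0 => //; exact: leq_ltn_trans mM.
Qed.

Local Notation posb z := (0 < z.2).

(** A version of [g_] that is measurable on the whole plane and agrees with it at positive
    thresholds. *)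
Local Definition gmax (n : nat) (z : R * R) : R :=
  \sum_(j < K) Act j * lam j * (Om j / Om k) `^ de j *
    fine (decay_int (alpha j) (Num.max (tauf Bb Mant j k z.2) 0) 1 (maxn n 1) n.+1)
    * z.1 `^ (de j / de k).

Local Lemma gmaxE n z : posb z -> gmax n z = g_ n z.1 z.2.
Proof. by move=> z0; apply: eq_bigr => j _; rewrite phif_decay_int. Qed.

Local Lemma measurable_gmax n : measurable_fun setT (gmax n).
Proof.
apply: measurable_sum => j; apply: measurable_funM; last first.
  exact: (measurableT_comp (measurable_powR _) measurable_fst).
apply: measurable_funM => //.
apply: (measurableT_comp (f := fine)); first exact: (fine_measurable measurableT).
apply: (measurableT_comp (measurable_decay_int (alpha j) 1 (maxn n 1) n.+1)
  (g := fun z : R * R => tauf Bb Mant j k z.2)).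
rewrite /tauf; apply: measurable_funM => //; exact: measurable_snd.
Qed.

Lemma measurable_cov_term i m n : (n < Mant k)%N ->
  measurable_fun setT (fun z : R * R => if posb z then cov_term i m n z.1 z.2 else 0).
Proof.
move=> nM.
pose f (z : R * R) := pi ^+ i * sig z.2 ^+ (m - n) / ((m - n)`!%:R * i`!%:R)
  * z.1 `^ (alpha k / 2 * (m - n)%:R)
  * expR (- sig z.2 * z.1 `^ (alpha k / 2) - pi * gmax 0 z)
  * ((gen_poly (Mant k) (fun p => gmax p z)) ^+ i)`_n.
rewrite (_ : (fun z => _) = fun z => if posb z then f z else 0); last first.
  apply/funext => z; case: ifP => // z0; rewrite /f /cov_term Qmx_pow_coef// gmaxE//.
  by rewrite (_ : (gmax^~ z) = (fun p => g_ p z.1 z.2))//; apply/funext => p; rewrite gmaxE.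
have msig : measurable_fun setT (fun z : R * R => sig z.2).
  exact: (measurable_funM (measurable_funM measurable_snd (measurable_cst W))
    (measurable_cst (Pw k)^-1)).
have mpow (a : R) : measurable_fun setT (fun z : R * R => z.1 `^ a).
  exact: (measurableT_comp (measurable_powR _) measurable_fst).
apply: measurable_fun_ifT => //.
  by apply: (@measurable_fun_ltr _ _ R setT (fun=> 0) snd); [exact: measurable_cst|exact: measurable_snd].
apply: measurable_funM; last by apply: measurable_gen_poly_pow => p; exact: measurable_gmax.
apply: measurable_funM; last first.
  apply: measurableT_comp => //; apply: measurable_funB.
    by apply: measurable_funM => //; exact: measurable_funN.
  by apply: measurable_funM => //; exact: measurable_gmax.
apply: measurable_funM => //; apply: measurable_funM => //.
by apply: measurable_funM => //; exact: measurable_funX.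
Qed.

Lemma measurable_coverage :
  measurable_fun setT (fun z : R * R => if posb z then coverage z.1 z.2 else 0).
Proof.
rewrite (_ : (fun z => _) = fun z => \sum_(i < Mant k) \sum_(m < Mant k) \sum_(n < m.+1)
    (if posb z then cov_term i m n z.1 z.2 else 0)).
  apply: measurable_sum => i; apply: measurable_sum => m; apply: measurable_sum => n.
  by apply: measurable_cov_term; exact: leq_trans (ltn_ord n) (ltn_ord m).
apply/funext => z; case: ifP => z0; last by rewrite !big1// => i _; rewrite big1// => m _; rewrite big1.
rewrite /coverage big_mkord; apply: eq_bigr => i _; rewrite big_mkord.
by apply: eq_bigr => m _; rewrite big_mkord.
Qed.

End CoverageTerms.

(** * Moments of the interference and the conditional coverage probability *)

Section InterferenceMoments.
Context {R : realType}.
Local Notation pt := ((R * R) * R)%type.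
Variables (K : nat) (lam Pw Bb alpha : 'I_K -> R) (Mant : 'I_K -> nat)
  (lam_u eps W : R) (k : 'I_K).
Hypotheses (hlam : forall j, 0 < lam j) (hlam_u : 0 < lam_u)
  (hPw : forall j, 0 < Pw j) (hBb : forall j, 0 < Bb j)
  (halpha : forall j, 2 < alpha j) (hMant : forall j, (0 < Mant j)%N)
  (heps : 0 < eps) (hW : 0 <= W).
Context d (T : measurableType d) (P : probability T R).
Variables (X H : T -> R) (N : 'I_K -> T -> {measure set pt -> \bar R}).

Local Notation Act := (Aact lam Pw Bb alpha Mant lam_u eps).
Local Notation ct j := (Act j * lam j).
Local Notation g_ n y b := (gf lam Pw Bb alpha Mant lam_u eps k n y b).
Local Notation Q_ y b := (Qmx lam Pw Bb alpha Mant lam_u eps k y b).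
Local Notation excl := (excl_radius Pw Bb alpha Mant).
Local Notation I_ x w := (interference Pw Bb alpha Mant k (fun=> x) N w).

Hypotheses (mX : measurable_fun setT X) (mH : measurable_fun setT H)
  (hN : forall j, is_PPP P (N j) (marked_mean (ct j))).
Hypothesis hind : mutually_indep P (fun o : option (option 'I_K) =>
            match o with
            | None => events_of_real X
            | Some None => events_of_real H
            | Some (Some j) => events_of_pp (N j)
            end).

(** The threshold divided by the received signal power per unit of fading: at distance [x],
    [SINR > b] asks the fading to exceed this factor times interference plus noise. *)
Definition path_gain (x b : R) : R := b * x `^ alpha k / Pw k.

Local Lemma ct0 j : 0 < ct j.
Proof. by rewrite mulr_gt0//; exact: Aact_gt0. Qed.

Local Lemma s_gt0 x b : 0 < x -> 0 < b -> 0 < path_gain x b.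
Proof. by move=> x0 b0; rewrite divr_gt0// mulr_gt0// powR_gt0. Qed.

Local Lemma mIc (x : R) : measurable_fun setT (fun w => I_ x w).
Proof. by apply: measurable_interference_cst => // j; case: (hN j). Qed.

Local Lemma mIf (x : R) : measurable_fun setT (fun w => fine (I_ x w)).
Proof. by apply: (measurableT_comp _ (mIc x)); exact: (fine_measurable measurableT). Qed.

Local Lemma If0 x w : 0 <= fine (I_ x w).
Proof. by apply: fine_ge0; exact: interference_ge0. Qed.

Lemma laplace_expansion (x b z : R) : 0 < x -> 0 < b -> 0 <= z <= 2^-1 ->
  `|laplace_exponent Pw Bb alpha Mant k (fun j => ct j) x (path_gain x b * (1 - z)) -
    (pi * g_ 0 (x ^+ 2) b - (gen_poly (Mant k) (fun p => pi * g_ p (x ^+ 2) b)).[z])|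
  <= pi * g_ 0 (x ^+ 2) b * z ^+ Mant k.
Proof.
move=> x0 b0 z01.
pose kap j := path_gain x b * Pw j; pose e j := excl j k x ^+ 2.
have k0 j : 0 < kap j by rewrite mulr_gt0// s_gt0.
have e0 j : 0 < e j by rewrite exprn_gt0// excl_radius_gt0.
pose A j := fine (decay_int (alpha j) (kap j * (1 - z)) (e j) 1 1).
pose B j := fine (decay_int (alpha j) (kap j) (e j) 1 1).
pose G j := (gen_poly (Mant k) (fun p => fine (decay_int (alpha j) (kap j) (e j) p p.+1))).[z].
have -> : laplace_exponent Pw Bb alpha Mant k (fun j => ct j) x (path_gain x b * (1 - z)) =
    \sum_(j < K) ct j * pi * A j.
  by apply: eq_bigr => j _; congr (_ * fine (decay_int _ _ _ _ _)); rewrite /kap mulrAC.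
have gE n : pi * g_ n (x ^+ 2) b =
    \sum_(j < K) ct j * pi * fine (decay_int (alpha j) (kap j) (e j) (maxn n 1) n.+1).
  exact: gf_decay_int.
have -> : pi * g_ 0 (x ^+ 2) b = \sum_(j < K) ct j * pi * B j by exact: gE.
have -> : (gen_poly (Mant k) (fun p => pi * g_ p (x ^+ 2) b)).[z] = \sum_(j < K) ct j * pi * G j.
  have GE j : ct j * pi * G j = \sum_(p < Mant k) ct j * pi *
      ((if p == 0%N :> nat then 0 else fine (decay_int (alpha j) (kap j) (e j) p p.+1)) * z ^+ p).
    by rewrite /G horner_poly mulr_sumr.
  rewrite horner_poly (eq_bigr _ (fun j _ => GE j)) exchange_big/=; apply: eq_bigr => -[[|p] pM] _ /=.
    by rewrite mul0r big1// => j _; rewrite mulr0.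
  rewrite gE mulr_suml; apply: eq_bigr => j _.
  by rewrite (_ : maxn p.+1 1 = p.+1) ?mulrA// maxnE; lia.
rewrite -!sumrB mulr_suml; apply: le_trans (ler_norm_sum _ _ _) _.
apply: ler_sum => j _; rewrite -!mulrBr normrM ger0_norm; last by rewrite mulr_ge0 ?pi_ge0// ltW// ct0.
rewrite -[leRHS]mulrA; apply: ler_wpM2l; first by rewrite mulr_ge0 ?pi_ge0// ltW// ct0.
exact: decay_int_expansion.
Qed.

Lemma interference_moment (x b : R) n : 0 < x -> 0 < b -> (n < Mant k)%N ->
  (\int[P]_w ((path_gain x b * fine (I_ x w)) ^+ n / n`!%:R
     * expR (- (path_gain x b * fine (I_ x w))))%:E =
   (expR (- (pi * g_ 0 (x ^+ 2) b)) * \sum_(0 <= i < Mant k)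
      pi ^+ i * ((Q_ (x ^+ 2) b) ^+ i) (inord n) ord0 / i`!%:R)%:E)%E.
Proof.
move=> x0 b0 nM; have s0 := s_gt0 x0 b0.
have mZ : measurable_fun setT (fun w => path_gain x b * fine (I_ x w)).
  by apply: measurable_funM => //; exact: mIf.
have Z0 w : 0 <= path_gain x b * fine (I_ x w) by rewrite mulr_ge0 ?If0// ltW.
have g0 p : 0 <= pi * g_ p (x ^+ 2) b by rewrite mulr_ge0 ?pi_ge0//; exact: gf_ge0.
rewrite (@laplace_moments _ _ _ P _
  (fun z => laplace_exponent Pw Bb alpha Mant k (fun j => ct j) x (path_gain x b * (1 - z)))
  (fun p => pi * g_ p (x ^+ 2) b) (Mant k) (pi * g_ 0 (x ^+ 2) b) mZ Z0 g0 (g0 0%N) (hMant k))//.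
- congr (_ * _)%:E; apply: eq_bigr => i _; congr (_ / _).
  rewrite Qmx_pow_coef// (_ : gen_poly _ _ = pi *: gen_poly (Mant k) (fun p => g_ p (x ^+ 2) b)).
    by rewrite exprZn coefZ.
  apply/polyP => p; rewrite coefZ !coef_poly; case: ifP => _; last by rewrite mulr0.
  by case: ifP => _; rewrite ?mulr0.
- move=> z /andP[z0 z2].
  have t0 : 0 < path_gain x b * (1 - z) by rewrite mulr_gt0//; move: z2; lra.
  rewrite -(interference_laplace k hPw hBb halpha hMant mX mH ct0 hN hind x0 t0).
  apply: ae_eq_integral => //.
  + apply/measurable_EFinP; apply: measurableT_comp => //; apply: measurable_funN.
    by apply: measurable_funM.
  + apply/measurable_EFinP; apply: (measurableT_comp measurable_expN).
    by apply: measurable_funeM; exact: mIc.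
  (* The moments involve [fine] of the interference and the transform involves [expN]; they agree
     off the null set of infinite values. *)
  have fin := ae_interference_fin k hPw hBb halpha hMant mX mH ct0 hN hind.
  apply: filterS fin => w /(_ x x0) Iw _; congr EFin.
  have -> : I_ x w = (fine (I_ x w))%:E by rewrite fineK// ge0_fin_numE// interference_ge0.
  by rewrite -EFinM expN_EFin /= mulrAC.
- by move=> z z01; exact: laplace_expansion.
Qed.

Lemma coverage_fixed_distance (x b : R) : 0 < x -> 0 < b ->
  (\int[P]_w (erlang_tail (Mant k) (path_gain x b * (fine (I_ x w) + W)))%:E =
   (coverage lam Pw Bb alpha Mant lam_u eps W k (x ^+ 2) b)%:E)%E.
Proof.
move=> x0 b0; have s0 := s_gt0 x0 b0.
pose sW := path_gain x b * W.
have sW0 : 0 <= sW by rewrite mulr_ge0// ltW.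
pose Z w := path_gain x b * fine (I_ x w).
have mZ : measurable_fun setT Z by apply: measurable_funM => //; exact: mIf.
have Z0 w : 0 <= Z w by rewrite mulr_ge0 ?If0// ltW.
pose u n w := Z w ^+ n / n`!%:R * expR (- Z w).
have u0 n w : 0 <= u n w by rewrite mulr_ge0 ?expR_ge0// divr_ge0// exprn_ge0.
have mu n : measurable_fun setT (u n).
  apply: measurable_funM; first by apply: measurable_funM => //; exact: measurable_funX.
  by apply: measurableT_comp => //; exact: measurable_funN.
(* The noise part of the binomial expansion of order [m]: [m - n] factors come from the noise and
   [n] from the interference. *)
pose kap m n := sW ^+ (m - n) / (m - n)`!%:R * expR (- sW).
have kap0 m n : 0 <= kap m n by rewrite mulr_ge0 ?expR_ge0// divr_ge0// exprn_ge0.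
have fact_neq0 m : m`!%:R != 0 :> R by rewrite pnatr_eq0 -lt0n fact_gt0.
have tailE w : erlang_tail (Mant k) (path_gain x b * (fine (I_ x w) + W)) =
    \sum_(0 <= m < Mant k) \sum_(0 <= n < m.+1) kap m n * u n w.
  rewrite /erlang_tail mulr_suml; apply: eq_bigr => m _.
  rewrite mulrDr -/sW -/(Z w) addrC exprDn opprD expRD !mulr_suml big_mkord.
  apply: eq_bigr => n _; rewrite /kap /u.
  have nm : (n <= m)%N by rewrite -ltnS.
  have -> : m`!%:R = 'C(m, n)%:R * (n`!%:R * (m - n)`!%:R) :> R.
    by rewrite -!natrM bin_fact.
  have c0 : 'C(m, n)%:R != 0 :> R by rewrite pnatr_eq0 -lt0n bin_gt0.
  rewrite -[_ *+ 'C(m, n)]mulr_natr.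
  by field; rewrite c0 !fact_neq0.
under eq_integral do rewrite tailE -sumEFin.
rewrite ge0_integral_sum//; last 2 first.
- move=> m; apply/measurable_EFinP; apply: measurable_sum => n.
  exact: measurable_funM.
- by move=> m w _; rewrite lee_fin sumr_ge0// => n _; rewrite mulr_ge0.
pose U n := expR (- (pi * g_ 0 (x ^+ 2) b)) * \sum_(0 <= i < Mant k)
      pi ^+ i * ((Q_ (x ^+ 2) b) ^+ i) (inord n) ord0 / i`!%:R.
transitivity ((\sum_(0 <= m < Mant k) \sum_(0 <= n < m.+1) kap m n * U n)%:E).
  rewrite -sumEFin; apply: eq_big_nat => m /andP[_ mM].
  under eq_integral do rewrite -sumEFin.
  rewrite ge0_integral_sum//; last 2 first.
  - by move=> n; apply/measurable_EFinP; exact: measurable_funM.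
  - by move=> n w _; rewrite lee_fin mulr_ge0.
  rewrite -sumEFin; apply: eq_big_nat => n /andP[_ nm].
  under eq_integral do rewrite EFinM.
  rewrite ge0_integralZl_EFin//; last 2 first.
  - by move=> w _; rewrite lee_fin.
  - exact/measurable_EFinP.
  by rewrite interference_moment// (leq_ltn_trans _ mM).
congr EFin; rewrite /coverage.
transitivity (\sum_(0 <= m < Mant k) \sum_(0 <= n < m.+1) \sum_(0 <= i < Mant k)
   cov_term lam Pw Bb alpha Mant lam_u eps W k i m n (x ^+ 2) b); last first.
  rewrite exchange_big/=; apply: eq_bigr => m _.
  by rewrite exchange_big.
apply: eq_bigr => m _; apply: eq_bigr => n _.
rewrite /U mulrA mulr_sumr; apply: eq_bigr => i _.
rewrite /cov_term.
have x2 : (x ^+ 2) `^ (alpha k / 2) = x `^ alpha k.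
  rewrite -(powR_mulrn 2 (ltW x0)) -powRrM; congr (_ `^ _); by field.
have sWE : sW = sigmak Pw W k b * x `^ alpha k.
  by rewrite /sW /path_gain /sigmak; field; rewrite gt_eqF.
rewrite powRrM powR_mulrn ?powR_ge0// x2 mulNr expRD -sWE /kap.
have -> : sW ^+ (m - n) = sigmak Pw W k b ^+ (m - n) * x `^ alpha k ^+ (m - n).
  by rewrite -exprMn -sWE.
move: (_ (inord n) ord0) (expR (- sW)) (expR (- (pi * _))) (x `^ alpha k ^+ _) => q e1 e2 y.
by move: (sigmak _ _ _ _ ^+ _) => s; field; rewrite !fact_neq0.
Qed.

End InterferenceMoments.

(** * Averaging over the serving distance and the threshold *)

Section DoubleIntegralSum.
Context {R : realType}.
Local Notation leb := (@lebesgue_measure R).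

(** The formulas are controlled for positive thresholds only, so joint measurability is stated for
    the extension by 0. *)
Lemma measurable_integral_pos (F : R -> R -> R) :
  measurable_fun setT (fun z : R * R => if 0 < z.2 then F z.1 z.2 else 0) ->
  (forall y b, 0 < b -> 0 <= F y b) ->
  measurable_fun setT (fun y : R => \int[leb]_(b in Ioo0inf) (F y b)%:E)%E.
Proof.
move=> mF F0.
pose f (z : measurableTypeR R * measurableTypeR R) : \bar R :=
  (if 0 < z.2 then F z.1 z.2 else 0)%:E.
have mf : measurable_fun setT f by apply/measurable_EFinP; exact: mF.
have f0 z : (0 <= f z)%E by rewrite lee_fin; case: ifP => // /F0.
have := @measurable_fun_fubini_tonelli_F _ _ _ _ R leb f mf f0.
rewrite /fubini_F; apply: eq_measurable_fun => y _.
rewrite [RHS]integral_mkcond; apply: eq_integral => b _.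
by rewrite patchE /Ioo0inf mem_setE in_itv/= andbT /f/=; case: ifP.
Qed.

Lemma measurable_section_pos (F : R -> R -> R) y :
  measurable_fun setT (fun z : R * R => if 0 < z.2 then F z.1 z.2 else 0) ->
  measurable_fun Ioo0inf (fun b : R => (F y b)%:E).
Proof.
move=> mF; have := measurableT_comp mF (pair1_measurable y) => mFy.
apply/measurable_EFinP; apply: (eq_measurable_fun (fun b : R => if 0 < b then F y b else 0)).
  by move=> b; rewrite /Ioo0inf inE/= in_itv/= andbT => ->.
exact: measurable_funS mFy.
Qed.

Lemma measurable_pos_sum n (F : nat -> R -> R -> R) :
  (forall i, (i < n)%N ->
    measurable_fun setT (fun z : R * R => if 0 < z.2 then F i z.1 z.2 else 0)) ->
  measurable_fun setT (fun z : R * R => if 0 < z.2 then \sum_(0 <= i < n) F i z.1 z.2 else 0).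
Proof.
move=> mF.
rewrite (_ : (fun z => _) = fun z => \sum_(i < n) (if 0 < z.2 then F i z.1 z.2 else 0)).
  by apply: measurable_sum => i; exact: mF.
by apply/funext => z; rewrite big_mkord; case: ifP => // _; rewrite big1.
Qed.

Lemma double_integral_sum (D : set R) n (F : nat -> R -> R -> R) : measurable D ->
  (forall i, (i < n)%N ->
    measurable_fun setT (fun z : R * R => if 0 < z.2 then F i z.1 z.2 else 0)) ->
  (forall i y b, (i < n)%N -> 0 < b -> 0 <= F i y b) ->
  (\int[leb]_(y in D) \int[leb]_(b in Ioo0inf) (\sum_(0 <= i < n) F i y b)%:E =
   \sum_(0 <= i < n) \int[leb]_(y in D) \int[leb]_(b in Ioo0inf) (F i y b)%:E)%E.
Proof.
move=> mD; elim: n => [|n IH] mF F0.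
  rewrite big_geq//; apply: integral0_eq => y _; apply: integral0_eq => b _.
  by rewrite big_geq.
have mI : measurable (Ioo0inf : set R) by exact: measurable_itv.
pose S y b := \sum_(0 <= i < n) F i y b.
have mS : measurable_fun setT (fun z : R * R => if 0 < z.2 then S z.1 z.2 else 0).
  by apply: measurable_pos_sum => i ilt; apply: mF; exact: ltn_trans (ltnSn n).
have S0 y b : 0 < b -> 0 <= S y b.
  move=> b0; rewrite /S big_nat sumr_ge0// => i /andP[_ ilt].
  by apply: F0 => //; exact: ltn_trans (ltnSn n).
have Fn0 y b : 0 < b -> 0 <= F n y b by exact: F0.
have Ib (b : R) : Ioo0inf b -> 0 < b by rewrite /Ioo0inf/= in_itv/= andbT.
rewrite big_nat_recr//= -IH; last 2 first.
- by move=> i ilt; apply: mF; exact: ltn_trans (ltnSn n).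
- by move=> i y b ilt; apply: F0; exact: ltn_trans (ltnSn n).
rewrite -ge0_integralD//; last 4 first.
- by move=> y _; apply: integral_ge0 => b /Ib b0; rewrite lee_fin S0.
- by apply: measurable_funS (measurable_integral_pos mS S0).
- by move=> y _; apply: integral_ge0 => b /Ib b0; rewrite lee_fin Fn0.
- by apply: measurable_funS (measurable_integral_pos (mF n (ltnSn n)) Fn0).
apply: eq_integral => y _; rewrite -ge0_integralD//; last 4 first.
- by move=> b /Ib b0; rewrite lee_fin S0.
- exact: measurable_section_pos mS.
- by move=> b /Ib b0; rewrite lee_fin Fn0.
- exact: measurable_section_pos (mF n (ltnSn n)).
by apply: eq_integral => b _; rewrite big_nat_recr.
Qed.

End DoubleIntegralSum.

Section Assembly.
Context {R : realType}.
Local Notation pt := ((R * R) * R)%type.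
Local Notation leb := (@lebesgue_measure R).
Variables (K : nat) (lam Pw Bb alpha : 'I_K -> R) (Mant : 'I_K -> nat)
  (lam_u eps W : R) (k : 'I_K).
Hypotheses (hlam : forall j, 0 < lam j) (hlam_u : 0 < lam_u)
  (hPw : forall j, 0 < Pw j) (hBb : forall j, 0 < Bb j)
  (halpha : forall j, 2 < alpha j) (hMant : forall j, (0 < Mant j)%N)
  (heps : 0 < eps) (hW : 0 <= W).
Context d (T : measurableType d) (P : probability T R).
Variables (X H : T -> R) (N : 'I_K -> T -> {measure set pt -> \bar R}).

Local Notation Rd := (Rad Pw Bb alpha Mant eps k).
Local Notation dens := (serv_dens lam Pw Bb alpha Mant eps k).
Local Notation ct j := (Aact lam Pw Bb alpha Mant lam_u eps j * lam j).
Local Notation I_ x w := (interference Pw Bb alpha Mant k (fun=> x) N w).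
Local Notation gain x b := (path_gain Pw alpha k x b).
Local Notation cov y b := (coverage lam Pw Bb alpha Mant lam_u eps W k y b).
Local Notation F := (fun o : option (option 'I_K) =>
            match o with
            | None => events_of_real X
            | Some None => events_of_real H
            | Some (Some j) => events_of_pp (N j)
            end).

Hypothesis hXm : measurable_fun setT X.
Hypothesis hXlaw : forall A : set R, measurable A ->
     P (X @^-1` A) = (\int[leb]_(x in A `&` Ioc0 Rd) (dens x)%:E)%E.
Hypothesis hHm : measurable_fun setT H.
Hypothesis hHlaw : forall A : set R, measurable A ->
     P (H @^-1` A) =
     (\int[leb]_(h in A `&` Ioo0inf)
        (h ^+ (Mant k).-1 * expR (- h) / ((Mant k).-1)`!%:R)%:E)%E.
Hypothesis hN : forall j, is_PPP P (N j) (marked_mean (ct j)).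
Hypothesis hind : mutually_indep P F.

Local Lemma ctg j : 0 < ct j.
Proof. by rewrite mulr_gt0//; exact: Aact_gt0. Qed.

(** Almost surely, [SINR > b] means that [H] exceeds this variable, which involves every source
    except the signal fading. *)
Local Definition fading_threshold (b : R) (w : T) : R :=
  gain (X w) b * (fine (interference Pw Bb alpha Mant k X N w) + W).

Local Lemma fading_threshold_ge0 b w : 0 < b -> 0 <= fading_threshold b w.
Proof.
move=> b0; rewrite /fading_threshold mulr_ge0//.
  by rewrite divr_ge0 ?(ltW (hPw k))// mulr_ge0 ?powR_ge0// ltW.
by rewrite addr_ge0// fine_ge0//; exact: interference_ge0.
Qed.

(** The space is kept arbitrary because the statement is used both for the full sigma-algebra and
    for the one generated by the sources other than a given one, where it yields independence. *)
Lemma measurable_threshold d' (T' : measurableType d') (X' : T' -> R)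
    (N' : 'I_K -> T' -> {measure set pt -> \bar R}) (b : R) :
  measurable_fun setT X' ->
  (forall j B, measurable B -> measurable_fun setT (fun w => N' j w B : \bar R)) ->
  measurable_fun setT (fun w => gain (X' w) b *
    (fine (interference Pw Bb alpha Mant k X' N' w) + W)).
Proof.
move=> mX' mN'; apply: measurable_funM.
  apply: measurable_funM => //; apply: measurable_funM => //.
  exact: (measurableT_comp (measurable_powR _) mX').
apply: measurable_funD => //.
apply: (measurableT_comp (f := fine)); first exact: (fine_measurable measurableT).
exact: measurable_interference.
Qed.

Local Lemma count_measurable j B : measurable B -> measurable_fun setT (fun w => N j w B : \bar R).
Proof. by case: (hN j) => + _; apply. Qed.

Local Lemma measurable_fading_threshold b : measurable_fun setT (fading_threshold b).
Proof. by apply: measurable_threshold => // j; exact: count_measurable. Qed.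

Local Notation others o := (\bigcup_(i in [set i | i != o]) F i).

Lemma indep_source o E0 E : F o E0 -> <<s others o >> E -> P (E0 `&` E) = (P E0 * P E)%E.
Proof.
move=> FE0 FE; apply: (mutually_indep_group hind _ _ _ FE0 FE) => i.
- exact: (source_measurable (c := fun j => ct j) hXm hHm hN).
- exact: source_setT.
- exact: source_setI.
Qed.

Local Lemma mN_others o j B : Some (Some j) != o -> measurable B ->
  measurable_fun [set: g_sigma_algebraType (others o)] (fun w => N j w B : \bar R).
Proof.
move=> jo mB _ S mS; rewrite setTI; apply: sub_sigma_algebra.
by exists (Some (Some j)) => //; exact: events_of_pp_count.
Qed.

Local Lemma mX_others o : None != o ->
  measurable_fun [set: g_sigma_algebraType (others o)] (X : g_sigma_algebraType (others o) -> R).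
Proof.
move=> no _ A mA; rewrite setTI; apply: sub_sigma_algebra.
by exists None => //; exists A.
Qed.

(** The threshold is measurable for the sources other than [H], and the indicator of [y < H] is
    right-continuous in [y], so the threshold can be frozen and the Gamma tail inserted. *)
Lemma fading_freeze (b : R) : 0 < b ->
  (\int[P]_w ((fading_threshold b w < H w)%R%:R)%:E = \int[P]_w (erlang_tail (Mant k) (fading_threshold b w))%:E)%E.
Proof.
move=> b0.
pose E (y : R) := [set w | (0 <= y) && (y < H w)].
have EE y w : \1_(E y) w = ((0 <= y) && (y < H w))%:R :> R.
  rewrite indicE; congr (_%:R); apply: congr1; apply/idP/idP => [/set_mem//|h].
  exact: mem_set.
have E_H y : 0 <= y -> E y = H @^-1` `]y, +oo[.
  by move=> y0; apply/seteqP; split => w; rewrite /E/= in_itv/= andbT y0.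
have E_neg y : y < 0 -> E y = set0.
  by move=> y0; apply/seteqP; split => w //; rewrite /E/= leNgt y0.
have mE y : measurable (E y).
  have [y0|y0] := leP 0 y; last by rewrite E_neg.
  by rewrite E_H// -[X in measurable X]setTI; apply: hHm => //; exact: measurable_itv.
pose phi (y : R) := if 0 <= y then erlang_tail (Mant k) y else 0.
transitivity (\int[P]_w (\1_(E (fading_threshold b w)) w)%:E)%E.
  by apply: eq_integral => w _; rewrite EE fading_threshold_ge0.
rewrite (@indep_freeze _ _ _ P (fading_threshold b) (fun y => \1_(E y)) phi [set y | 0 <= y]).
- by apply: eq_integral => w _; rewrite /phi fading_threshold_ge0.
- exact: measurable_fading_threshold.
- by move=> y; exact: measurable_indic.
- apply: measurable_fun_ifT => //; first exact: measurable_fun_ler.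
  by apply: continuous_measurable_fun; exact: continuous_erlang_tail.
- rewrite (_ : (fun w => _) = fun w => if fading_threshold b w < H w then 1 else 0).
    by apply: measurable_fun_ifT => //; apply: measurable_fun_ltr => //; exact: measurable_fading_threshold.
  by apply/funext => w; rewrite EE fading_threshold_ge0//=; case: ifP.
- by move=> y w; rewrite EE ler0n lern1 leq_b1.
- move=> y; rewrite integral_indic// setIT /phi; case: ifPn => [y0|]; last first.
    by rewrite -ltNge => /E_neg ->; rewrite measure0.
  rewrite E_H//; apply: (etrans (hHlaw (measurable_itv _))).
  rewrite (_ : _ `&` _ = `]y, +oo[%classic).
    by rewrite gamma_tail// prednK.
  apply/seteqP; split => h; rewrite /Ioo0inf/= !in_itv/= !andbT; first by case.
  by move=> yh; split => //; exact: le_lt_trans yh.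
- move=> y A mA.
  have mYA : measurable (fading_threshold b @^-1` A) by rewrite -[X in measurable X]setTI; exact: measurable_fading_threshold.
  have [y0|y0] := leP 0 y; last first.
    rewrite E_neg//; under eq_integral do rewrite indic0.
    by under [in RHS]eq_integral do rewrite indic0; rewrite !integral0 mule0.
  rewrite !integral_indic// setIT muleC; apply: (indep_source (o := Some None)).
    by rewrite E_H//; exists `]y, +oo[%classic => //; exact: measurable_itv.
  have mYo : measurable_fun [set: g_sigma_algebraType (others (Some None))] (fading_threshold b).
    apply: measurable_threshold; first exact: mX_others.
    by move=> j B; exact: mN_others.
  by have := mYo measurableT A mA; rewrite setTI.
- by apply: aeW => w; exact: fading_threshold_ge0.
- apply: aeW => w x /= x0.
  have up0 n : 0 <= updyadic n x by apply: ltW; exact: le_lt_trans (updyadic_gt _ _).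
  have [xH|Hx] := ltP x (H w).
    apply: cvg_near_cst; near=> n; rewrite !EE x0 up0/= xH.
    suff -> : updyadic n x < H w by [].
    by near: n; apply: (cvgr_lt x) => //; exact: cvg_updyadic.
  apply: cvg_near_cst; apply: nearW => n; rewrite !EE x0 up0/= (le_gtF Hx).
  by rewrite le_gtF// (le_trans Hx)// ltW// updyadic_gt.
Unshelve. all: by end_near. Qed.

Local Lemma ae_X : {ae P, forall w, 0 < X w <= Rd}.
Proof.
have mA : measurable (~` Ioc0 Rd) by apply: measurableC; exact: measurable_itv.
exists (X @^-1` (~` Ioc0 Rd)); split.
- by rewrite -[X in measurable X]setTI; exact: hXm.
- by rewrite hXlaw// setICl integral_set0.
- by move=> w /= Hw; rewrite /Ioc0/= in_itv/=.
Qed.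

Local Lemma mcov : measurable_fun setT (fun z : R * R => if 0 < z.2 then cov z.1 z.2 else 0).
Proof. exact: measurable_coverage. Qed.

Local Lemma mcov_sqr (b : R) : 0 < b -> measurable_fun setT (fun x : R => cov (x ^+ 2) b).
Proof.
move=> b0.
have mp : measurable_fun setT (fun x : R => (x ^+ 2, b)).
  by apply: measurable_fun_pair => //; exact: measurable_funX.
by have := measurableT_comp mcov mp; rewrite /comp/= b0.
Qed.

(** The second freezing, now of the serving distance. Both sides are set to 0 at nonpositive
    distances, which the law of [X] does not charge. *)
Lemma distance_freeze (b : R) : 0 < b ->
  (\int[P]_w (erlang_tail (Mant k) (fading_threshold b w))%:E =
   \int[P]_w (if 0 < X w then cov (X w ^+ 2) b else 0)%R%:E)%E.
Proof.
move=> b0.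
pose f (x : R) (w : T) : R :=
  if 0 < x then erlang_tail (Mant k) (gain x b * (fine (I_ x w) + W)) else 0.
pose phi (x : R) := if 0 < x then cov (x ^+ 2) b else 0.
have met : measurable_fun setT (erlang_tail (Mant k) : R -> R).
  by apply: continuous_measurable_fun; exact: continuous_erlang_tail.
have mfX : measurable_fun setT (fun w => f (X w) w).
  rewrite (_ : (fun w => _) = fun w => if 0 < X w then erlang_tail (Mant k) (fading_threshold b w) else 0)//.
  apply: measurable_fun_ifT => //; first exact: measurable_fun_ltr.
  by apply: measurableT_comp => //; exact: measurable_fading_threshold.
have thr0 x w : 0 <= gain x b * (fine (I_ x w) + W).
  rewrite mulr_ge0//; first by rewrite divr_ge0 ?(ltW (hPw k))// mulr_ge0 ?powR_ge0// ltW.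
  by rewrite addr_ge0// fine_ge0//; exact: interference_ge0.
have f01 x w : 0 <= f x w <= 1.
  by rewrite /f; case: ifP => _; rewrite ?lexx ?ler01// erlang_tail_ge0// erlang_tail_le1.
have mf d' (T' : measurableType d') (N' : 'I_K -> T' -> {measure set pt -> \bar R}) x :
    (forall j B, measurable B -> measurable_fun setT (fun w => N' j w B : \bar R)) ->
    measurable_fun setT (fun w => if 0 < x then erlang_tail (Mant k)
      (gain x b * (fine (interference Pw Bb alpha Mant k (fun=> x) N' w) + W)) else 0).
  move=> mN'; case: (0 < x); last exact: measurable_cst.
  by apply: measurableT_comp => //; exact: (@measurable_threshold _ _ (fun=> x)).
transitivity (\int[P]_w (f (X w) w)%:E)%E.
  apply: ae_eq_integral => //.
  - by apply/measurable_EFinP; apply: measurableT_comp => //; exact: measurable_fading_threshold.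
  - exact/measurable_EFinP.
  - by apply: filterS ae_X => w /andP[x0 _] _; rewrite /f x0.
rewrite (@indep_freeze _ _ _ P X f phi [set x | 0 < x]).
- by [].
- exact: hXm.
- by move=> x; apply: mf => j; exact: count_measurable.
- apply: measurable_fun_ifT => //; first exact: measurable_fun_ltr.
  exact: mcov_sqr.
- exact: mfX.
- exact: f01.
- move=> x; rewrite /f /phi; case: ifP => x0; last by rewrite integral0.
  exact: (coverage_fixed_distance k hlam hlam_u hPw hBb halpha hMant heps hW hXm hHm hN hind).
- move=> x A mA.
  have mXA : measurable (X @^-1` A) by rewrite -[X in measurable X]setTI; exact: hXm.
  apply: indep_event_integral => //.
  + by apply/measurable_EFinP; apply: mf => j; exact: count_measurable.
  + by move=> w; rewrite lee_fin; have /andP[] := f01 x w.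
  + move=> B mB; apply: (indep_source (o := None)); first by exists A.
    have mfo : measurable_fun [set: g_sigma_algebraType (others None)] (fun w => (f x w)%:E).
      by apply/measurable_EFinP; apply: mf => j C; exact: mN_others.
    by have := mfo measurableT B mB; rewrite setTI.
- by apply: filterS ae_X => w /andP[].
(* The dyadic distances vary with the outcome, so finiteness is required off one null set for all
   positive distances together; it makes [fine] continuous at the limit. *)
- have fin := ae_interference_fin k hPw hBb halpha hMant hXm hHm ctg hN hind.
  apply: filterS fin => w Iw x /= x0.
  have up0 n : 0 < updyadic n x by exact: lt_trans (updyadic_gt _ _).
  rewrite /f x0; under eq_fun do rewrite up0.
  have cu : updyadic n x @[n --> \oo] --> x by apply: cvg_updyadic; exact: ltW.
  have Ifin : I_ x w \is a fin_num by rewrite ge0_fin_numE ?Iw// interference_ge0.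
  have cI : fine (I_ (updyadic n x) w) @[n --> \oo] --> fine (I_ x w).
    by apply: fine_cvg; rewrite fineK//; exact: cvg_interference.
  have carg : gain (updyadic n x) b * (fine (I_ (updyadic n x) w) + W) @[n --> \oo] -->
      gain x b * (fine (I_ x w) + W).
    apply: cvgM; last by apply: cvgD => //; exact: cvg_cst.
    by apply: cvgMl; apply: cvgMr; exact: cvg_powR_seq.
  exact: (cvg_comp _ _ carg (@continuous_erlang_tail R (Mant k) _)).
Qed.


(** This form exhibits the Jacobian [2 x] of the substitution of [x^2]. *)
Lemma serv_dens_sqr (x : R) : 0 < x ->
  dens x = 2 * x * (pi * lam k / Tassoc lam Pw Bb alpha Mant eps k
                    * assoc_exp lam Pw Bb alpha Mant k (x ^+ 2)).
Proof.
move=> x0; rewrite /serv_dens /assoc_exp.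
have E j : x `^ (2 * (delta alpha j / delta alpha k)) = (x ^+ 2) `^ (delta alpha j / delta alpha k).
  by rewrite -(powR_mulrn 2 (ltW x0)) -powRrM.
under eq_bigr do rewrite E.
by ring.
Qed.

Lemma serv_dens_ge0 (x : R) : 0 < x -> 0 <= dens x.
Proof.
move=> x0; rewrite serv_dens_sqr//; apply: mulr_ge0; first by rewrite mulr_ge0// ltW.
apply: mulr_ge0; last exact: expR_ge0.
apply: divr_ge0; first by rewrite mulr_ge0 ?pi_ge0// ltW.
by apply: ltW; exact: Tassoc_gt0.
Qed.

Lemma measurable_dens : measurable_fun setT dens.
Proof.
apply: measurable_funM; first exact: measurable_funM.
apply: measurableT_comp => //; apply: measurable_funN; apply: measurable_funM => //.
exact: measurable_powR_sum.
Qed.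

Local Notation sinr := (SINR Pw Bb alpha Mant W k X H N).

Lemma measurable_sinr : measurable_fun setT sinr.
Proof.
apply: measurable_funM.
  apply: measurable_funM; first exact: measurable_funM.
  exact: (measurableT_comp (measurable_powR _) hXm).
rewrite (_ : (fun w => _^-1) =
    fun w => (fine (interference Pw Bb alpha Mant k X N w) + W) `^ (-1)); last first.
  apply/funext => w; rewrite powR_inv1// addr_ge0// fine_ge0//.
  exact: interference_ge0.
apply: (measurableT_comp (measurable_powR _)); apply: measurable_funD => //.
apply: (measurableT_comp (f := fine)); first exact: (fine_measurable measurableT).
by apply: measurable_interference => // j; exact: count_measurable.
Qed.

(** Clearing the denominator needs it to be positive. Since [W] may be 0, positivity comes from the
    interference; with a zero denominator the SINR would be 0 while [0 < H] holds. *)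
Lemma ae_sinr : {ae P, forall w, (0 < H w -> 0 <= sinr w) /\
  forall b, 0 < b -> (b < sinr w) = (fading_threshold b w < H w)}.
Proof.
have fin := ae_interference_fin k hPw hBb halpha hMant hXm hHm ctg hN hind.
have Rd0 : 0 < Rd by exact: Rad_gt0.
have pos := ae_interference_gt0 k hPw hBb halpha hMant hXm hHm ctg hN hind Rd0.
apply: filterS3 ae_X fin pos => w Xw /(_ (X w)) Ifin /(_ (X w) Xw) I0.
have /andP[x0 _] := Xw; have {}Ifin := Ifin x0.
set D := fine (interference Pw Bb alpha Mant k X N w) + W.
have D0 : 0 < D by rewrite ltr_pwDl//; apply: fine_gt0; apply/andP.
have p0 : 0 < X w `^ alpha k by rewrite powR_gt0.
rewrite /SINR -/D powRN; split.
  move=> h0; apply: divr_ge0; last exact: ltW.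
  by rewrite !mulr_ge0 ?invr_ge0 ?ltW.
move=> b b0; rewrite ltr_pdivlMr// /fading_threshold -/D /path_gain.
rewrite ltr_pdivlMr// [RHS](_ : _ = (b * X w `^ alpha k * D < H w * Pw k)).
  by rewrite [H w * _]mulrC mulrAC.
by rewrite mulrAC ltr_pdivrMr.
Qed.

Lemma coverage_probability (b : R) : 0 < b ->
  (\int[P]_w ((b < sinr w)%R%:R)%:E =
   \int[leb]_x ((if (0 < x) && (x <= Rd) then dens x * cov (x ^+ 2) b else 0)%R%:E))%E.
Proof.
move=> b0.
have mlt (f g : T -> R) : measurable_fun setT f -> measurable_fun setT g ->
    measurable_fun setT (fun w => ((f w < g w)%R%:R : R)%:E).
  move=> mf mg; apply/measurable_EFinP.
  rewrite (_ : (fun w => _) = fun w => if f w < g w then 1 else 0).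
    by apply: measurable_fun_ifT => //; exact: measurable_fun_ltr.
  by apply/funext => w; case: ifP.
transitivity (\int[P]_w ((fading_threshold b w < H w)%R%:R)%:E)%E.
  apply: ae_eq_integral => //.
  - by apply: mlt => //; exact: measurable_sinr.
  - by apply: mlt => //; exact: measurable_fading_threshold.
  - by apply: filterS ae_sinr => w [_ /(_ b b0) ->].
rewrite fading_freeze// distance_freeze//.
pose g (x : R) : \bar R := (if 0 < x then cov (x ^+ 2) b else 0)%:E.
have mc := mcov_sqr b0.
have mpos : measurable_fun setT (fun x : R => 0 < x) by exact: measurable_fun_ltr.
have mg : measurable_fun setT g.
  by apply/measurable_EFinP; exact: measurable_fun_ifT.
have mdens := measurable_dens.
pose p (x : R) : \bar R := (if (0 < x) && (x <= Rd) then dens x else 0)%:E.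
have mp : measurable_fun setT p.
  apply/measurable_EFinP; apply: measurable_fun_ifT => //.
  by apply: measurable_and => //; exact: measurable_fun_ler.
have p0 x : (0 <= p x)%E.
  by rewrite lee_fin /p; case: ifP => // /andP[x0 _]; exact: serv_dens_ge0.
transitivity (\int[P]_w (g (X w) * 1))%E.
  by apply: eq_integral => w _; rewrite mule1.
rewrite (@eq_weighted_image_integral _ _ _ T (measurableTypeR R) (measurableTypeR R) R P leb
  X idfun (cst 1%E) p g)//.
- apply: eq_integral => x _; rewrite /g /p /=; case: ifPn => x0 /=; last by rewrite mul0e.
  by case: ifP => _; rewrite -EFinM ?mulr0// mulrC.
- exact: (@measurable_id _ (measurableTypeR R)).
- move=> A mA; rewrite integral_cst//=; last by rewrite -[X in measurable X]setTI; exact: hXm.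
  rewrite mul1e hXlaw// [LHS]integral_mkcond [RHS]integral_mkcond; apply: eq_integral => x _.
  rewrite !patchE /p.
  have -> : (x \in A `&` Ioc0 Rd) = (x \in A) && ((0 < x) && (x <= Rd)).
    rewrite in_setI; congr (_ && _); apply/idP/idP => [/set_mem|h]; last apply: mem_set.
      by rewrite /Ioc0/= in_itv.
    by rewrite /Ioc0/= in_itv.
  by case: (x \in A) => //=; case: ifP.
- by move=> x; rewrite lee_fin; case: ifP => // x0; exact: coverage_ge0.
Qed.

Local Lemma ae_H : {ae P, forall w, 0 < H w}.
Proof.
have mA : measurable (~` (Ioo0inf : set R)) by apply: measurableC; exact: measurable_itv.
exists (H @^-1` (~` Ioo0inf)); split.
- by rewrite -[X in measurable X]setTI; exact: hHm.
- by rewrite hHlaw// setICl integral_set0.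
- by move=> w /= Hw; rewrite /Ioo0inf/= in_itv/= andbT.
Qed.

(** Equal to [1 / (1 + b)] at positive [b], and nonnegative and measurable on the whole line. *)
Local Definition inv1p (b : R) : R := (1 + Num.max b 0) `^ (-1).

Local Lemma inv1pE b : 0 < b -> inv1p b = (1 + b)^-1.
Proof. by move=> b0; rewrite /inv1p (max_l (ltW b0)) powR_inv1// addr_ge0// ltW. Qed.

Local Lemma measurable_inv1p : measurable_fun setT inv1p.
Proof.
apply: (measurableT_comp (measurable_powR _)); apply: measurable_funD => //.
by apply: measurable_maxr.
Qed.

Local Notation rate i m n y b := (rate_integrand lam Pw Bb alpha Mant lam_u eps W k i m n y b).
Local Notation rate_sum y b := (\sum_(0 <= i < Mant k) \sum_(0 <= m < Mant k)
  \sum_(0 <= n < m.+1) rate i m n y b).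

Lemma rate_sum_coverage y b :
  rate_sum y b = pi * assoc_exp lam Pw Bb alpha Mant k y / (1 + b) * cov y b.
Proof.
rewrite /coverage mulr_sumr; apply: eq_bigr => i _; rewrite mulr_sumr.
apply: eq_bigr => m _; rewrite mulr_sumr; apply: eq_bigr => n _.
exact: rate_integrand_cov_term.
Qed.

Lemma rate_integrand_ge0 i m n (y b : R) : (n < Mant k)%N -> 0 < b -> 0 <= rate i m n y b.
Proof.
move=> nM b0; rewrite rate_integrand_cov_term; apply: mulr_ge0; last exact: cov_term_ge0.
apply: divr_ge0; last by rewrite addr_ge0// ltW.
by rewrite mulr_ge0 ?pi_ge0//; exact: expR_ge0.
Qed.

Lemma measurable_rate_integrand i m n : (n < Mant k)%N ->
  measurable_fun setT (fun z : R * R => if 0 < z.2 then rate i m n z.1 z.2 else 0).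
Proof.
move=> nM.
pose ct' (z : R * R) := if 0 < z.2 then
  cov_term lam Pw Bb alpha Mant lam_u eps W k i m n z.1 z.2 else 0.
have mct : measurable_fun setT ct' by exact: measurable_cov_term.
rewrite (_ : (fun z => _) = fun z : R * R =>
    pi * assoc_exp lam Pw Bb alpha Mant k z.1 * inv1p z.2 * ct' z).
  apply: measurable_funM => //; apply: measurable_funM.
    apply: measurable_funM => //.
    exact: (measurableT_comp (measurable_assoc_exp _ _ _ _ _ k) measurable_fst).
  exact: (measurableT_comp measurable_inv1p measurable_snd).
apply/funext => z; rewrite /ct'; case: ifP => z0; last by rewrite mulr0.
by rewrite rate_integrand_cov_term inv1pE.
Qed.

Lemma double_integral_rate_sum (D : set R) : measurable D ->
  (\int[leb]_(y in D) \int[leb]_(b in Ioo0inf) (rate_sum y b)%:E =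
   \sum_(0 <= i < Mant k) \sum_(0 <= m < Mant k) \sum_(0 <= n < m.+1)
     \int[leb]_(y in D) \int[leb]_(b in Ioo0inf) (rate i m n y b)%:E)%E.
Proof.
move=> mD.
have nM m n : (m < Mant k)%N -> (n < m.+1)%N -> (n < Mant k)%N.
  by move=> mM nm; exact: leq_trans mM.
have mn i m : (m < Mant k)%N -> measurable_fun setT
    (fun z : R * R => if 0 < z.2 then \sum_(0 <= n < m.+1) rate i m n z.1 z.2 else 0).
  move=> mM; apply: measurable_pos_sum => n nm.
  by apply: measurable_rate_integrand; exact: nM mM nm.
have n0 i m (y b : R) : (m < Mant k)%N -> 0 < b -> 0 <= \sum_(0 <= n < m.+1) rate i m n y b.
  move=> mM b0; rewrite big_nat sumr_ge0// => n /andP[_ nm].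
  by apply: rate_integrand_ge0 => //; exact: nM mM nm.
rewrite double_integral_sum//; last 2 first.
- move=> i _; apply: (measurable_pos_sum (F := fun m y b => \sum_(0 <= n < m.+1) rate i m n y b)).
  by move=> m; exact: mn.
- by move=> i y b _ b0; rewrite big_nat sumr_ge0// => m /andP[_ mM]; exact: n0.
apply: eq_bigr => i _; rewrite double_integral_sum//; last 2 first.
- by move=> m; exact: mn.
- by move=> m y b; exact: n0.
apply: eq_big_nat => m /andP[_ mM]; rewrite double_integral_sum//.
- by move=> n nm; apply: measurable_rate_integrand; exact: nM mM nm.
- by move=> n y b nm; apply: rate_integrand_ge0; exact: nM mM nm.
Qed.

Lemma avg_rate_formula : avg_rate Pw Bb alpha Mant P W k X H N =
  rate_formula lam Pw Bb alpha Mant lam_u eps W k.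
Proof.
pose c := lam k / Tassoc lam Pw Bb alpha Mant eps k.
have T0 : 0 < Tassoc lam Pw Bb alpha Mant eps k by exact: Tassoc_gt0.
have c0 : 0 <= c by rewrite divr_ge0// ltW.
have l2 : 0 <= (ln 2)^-1 :> R by rewrite invr_ge0 ltW// ln_gt0// ltr1n.
have Rd0 : 0 < Rd by exact: Rad_gt0.
pose f (z : T * measurableTypeR R) : \bar R :=
  (if (0 < z.2) && (z.2 < sinr z.1) then inv1p z.2 else 0)%:E.
have inv0 b : 0 <= inv1p b by exact: powR_ge0.
have mf : measurable_fun setT f.
  apply/measurable_EFinP; apply: measurable_fun_ifT.
  - apply: measurable_and.
      by apply: (@measurable_fun_ltr _ _ R setT (fun=> 0) snd); [exact: measurable_cst|exact: measurable_snd].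
    apply: (@measurable_fun_ltr _ _ R setT snd (fun z => sinr z.1)); first exact: measurable_snd.
    exact: (measurableT_comp measurable_sinr measurable_fst).
  - exact: (measurableT_comp measurable_inv1p measurable_snd).
  - exact: measurable_cst.
have f0 z : (0 <= f z)%E by rewrite lee_fin; case: ifP.
have fL w : (\int[leb]_b f (w, b) = \int[leb]_(b in Ioo0inf) ((b < sinr w)%R%:R / (1 + b))%:E)%E.
  rewrite [RHS]integral_mkcond; apply: eq_integral => b _.
  rewrite patchE /Ioo0inf mem_setE in_itv/= andbT /f/=.
  by case: ltP => //= b0; rewrite inv1pE//; case: ltP => _; rewrite ?mul1r ?mul0r.
have -> : avg_rate Pw Bb alpha Mant P W k X H N = ((ln 2)^-1%:E * \int[P]_w \int[leb]_b f (w, b))%E.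
  have mfF : measurable_fun setT (fun w => \int[leb]_b f (w, b))%E.
    exact: (@measurable_fun_fubini_tonelli_F _ _ _ _ R leb f mf f0).
  rewrite -ge0_integralZl//; last by move=> w _; apply: integral_ge0.
  apply: ae_eq_integral => //.
  - apply/measurable_EFinP; apply: measurable_funM => //.
    apply: (measurableT_comp (f := @ln R)); first exact: measurable_ln.
    by apply: measurable_funD => //; exact: measurable_sinr.
  - exact: measurable_funeM.
  - apply: filterS2 ae_sinr ae_H => w [h _] H0 _.
    by rewrite fL ln1p_layer ?h// -EFinM mulrC.
(* Exchanging expectation and threshold integral allows independence to be used at each fixed
   threshold [b]. *)
rewrite (@fubini_tonelli _ _ _ _ R P leb f mf f0).
pose hh (z : measurableTypeR R * measurableTypeR R) : \bar R :=
  (if (0 < z.2) && (z.2 <= Rd) then dens z.2 *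
     (if 0 < z.1 then cov (z.2 ^+ 2) z.1 else 0) * inv1p z.1 else 0)%:E.
have mhh : measurable_fun setT hh.
  apply/measurable_EFinP; apply: measurable_fun_ifT => //.
    apply: measurable_and.
      by apply: (@measurable_fun_ltr _ _ R setT (fun=> 0) snd); [exact: measurable_cst|exact: measurable_snd].
    by apply: (@measurable_fun_ler _ _ R setT snd (fun=> Rd)); [exact: measurable_snd|exact: measurable_cst].
  apply: measurable_funM; last exact: (measurableT_comp measurable_inv1p measurable_fst).
  apply: measurable_funM; first exact: (measurableT_comp measurable_dens measurable_snd).
  have mp : measurable_fun setT (fun z : measurableTypeR R * measurableTypeR R => (z.2 ^+ 2, z.1) : R * R).
    apply: measurable_fun_pair; last exact: measurable_fst.
    exact: (@measurable_funX _ _ R setT snd 2 measurable_snd).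
  exact: (measurableT_comp mcov mp).
have hh0 z : (0 <= hh z)%E.
  rewrite lee_fin; case: ifP => // /andP[z0 _]; apply: mulr_ge0 => //.
  by apply: mulr_ge0; [exact: serv_dens_ge0|case: ifP => // b0; exact: coverage_ge0].
have -> : (\int[leb]_b \int[P]_w f (w, b) = \int[leb]_b \int[leb]_x hh (b, x))%E.
  apply: eq_integral => b _; have [b0|b0] := ltP 0 b; last first.
    rewrite !integral0_eq// => u _; first by rewrite /hh/= (le_gtF b0) mulr0 mul0r; case: ifP.
    by rewrite /f/= (le_gtF b0).
  have ib : (0 <= (inv1p b)%:E)%E by rewrite lee_fin.
  transitivity ((inv1p b)%:E * \int[P]_w ((b < sinr w)%R%:R)%:E)%E.
    have mb : measurable_fun setT (fun w => ((b < sinr w)%R%:R : R)%:E).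
      apply/measurable_EFinP.
      rewrite (_ : (fun w => _) = fun w => if b < sinr w then 1 else 0).
        by apply: measurable_fun_ifT => //; apply: measurable_fun_ltr => //; exact: measurable_sinr.
      by apply/funext => w; case: ifP.
    have b1 w : (0 <= ((b < sinr w)%R%:R : R)%:E)%E by rewrite lee_fin.
    rewrite -ge0_integralZl//.
    apply: eq_integral => w _; rewrite /f/= b0/= -EFinM; congr EFin.
    by case: ifP => _; rewrite ?mulr1 ?mulr0.
  pose q (x : R) : \bar R := (if (0 < x) && (x <= Rd) then dens x * cov (x ^+ 2) b else 0)%:E.
  have mq : measurable_fun setT q.
    apply/measurable_EFinP; apply: measurable_fun_ifT => //.
      by apply: measurable_and; [exact: measurable_fun_ltr|exact: measurable_fun_ler].
    by apply: measurable_funM; [exact: measurable_dens|exact: mcov_sqr].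
  have q0 x : (0 <= q x)%E.
    rewrite lee_fin; case: ifP => // /andP[x0 _].
    by apply: mulr_ge0; [exact: serv_dens_ge0|exact: coverage_ge0].
  rewrite coverage_probability// -ge0_integralZl//; last by move=> x _; exact: q0.
  apply: eq_integral => x _; rewrite /hh/= b0 -EFinM; congr EFin.
  by case: ifP => _; rewrite ?mulr0// mulrC.
(* A second exchange restores the order of the formula, with the threshold inside and the distance
   outside. *)
rewrite (@fubini_tonelli _ _ _ _ R leb leb hh mhh hh0).
have mS : measurable_fun setT (fun z : R * R => if 0 < z.2 then rate_sum z.1 z.2 else 0).
  apply: (measurable_pos_sum (F := fun i y b => \sum_(0 <= m < Mant k)
    \sum_(0 <= n < m.+1) rate i m n y b)) => i _.
  apply: (measurable_pos_sum (F := fun m y b => \sum_(0 <= n < m.+1) rate i m n y b)) => m mM.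
  apply: measurable_pos_sum => n nm; apply: measurable_rate_integrand.
  exact: leq_trans mM.
have S0 (y b : R) : 0 < b -> 0 <= rate_sum y b.
  move=> b0; apply: sumr_ge0 => i _; rewrite big_nat sumr_ge0// => m /andP[_ mM].
  rewrite big_nat sumr_ge0// => n /andP[_ nm]; apply: rate_integrand_ge0 => //.
  exact: leq_trans mM.
pose J (y : R) : \bar R := (\int[leb]_(b in Ioo0inf) (rate_sum y b)%:E)%E.
have mJ : measurable_fun setT J by exact: measurable_integral_pos mS S0.
have J0 y : (0 <= J y)%E.
  apply: integral_ge0 => b; rewrite /Ioo0inf/= in_itv/= andbT => b0.
  by rewrite lee_fin S0.
pose G (y : R) : \bar R := if y <= Rd ^+ 2 then (c%:E * J y)%E else 0%E.
have mG : measurable_fun setT G.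
  apply: measurable_fun_ifT => //; first exact: measurable_fun_ler.
  exact: measurable_funeM.
have G0 y : (0 <= G y)%E.
  by rewrite /G; case: ifP => // _; apply: mule_ge0; rewrite ?lee_fin.
have -> : (\int[leb]_x \int[leb]_b hh (b, x) = \int[leb]_x (G (x ^+ 2)%R * (2 * Num.max x 0)%:E))%E.
  apply: eq_integral => x _; have [x0|x0] := ltP 0 x; last first.
    rewrite mulr0 mule0; apply: integral0_eq => b _.
    by rewrite /hh/= (le_gtF x0).
  have xR : (x ^+ 2 <= Rd ^+ 2) = (x <= Rd) by rewrite ler_pXn2r// nnegrE ltW.
  rewrite /G xR; case: ifP => xRd; last first.
    by rewrite mul0e; apply: integral0_eq => b _; rewrite /hh/= x0 xRd.
  have mSx := @measurable_section_pos _ (fun y b => rate_sum y b) (x ^+ 2) mS.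
  have mI : measurable (Ioo0inf : set R) by exact: measurable_itv.
  have Ib (b : R) : Ioo0inf b -> 0 < b by rewrite /Ioo0inf/= in_itv/= andbT.
  rewrite muleC muleA -EFinM /J -ge0_integralZl//; last 2 first.
  - by move=> b /Ib b0; rewrite lee_fin S0.
  - by rewrite lee_fin; apply: mulr_ge0 => //; apply: mulr_ge0 => //; exact: ltW.
  rewrite [RHS]integral_mkcond; apply: eq_integral => b _.
  rewrite patchE /Ioo0inf mem_setE in_itv/= andbT /hh/= x0 xRd/=.
  case: ifP => b0; last by rewrite mulr0 mul0r.
  rewrite rate_sum_coverage -EFinM inv1pE// serv_dens_sqr// /c; congr EFin.
  by ring.
rewrite integral_sqr_subst//.
have -> : (\int[leb]_(y in `]0%R, +oo[) G y = \int[leb]_(y in Ioc0 (Rd ^+ 2)) (c%:E * J y))%E.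
  rewrite [LHS]integral_mkcond [RHS]integral_mkcond; apply: eq_integral => y _.
  rewrite !patchE /Ioc0 !mem_setE !in_itv/= andbT /G.
  by case: ltP => //= y0.
have mD : measurable (Ioc0 (Rd ^+ 2)) by exact: measurable_itv.
rewrite ge0_integralZl//; last exact: measurable_funS mJ.
by rewrite double_integral_rate_sum// muleA -EFinM.
Qed.

End Assembly.

Theorem theorem4
  (R : realType) (d : measure_display) (T : measurableType d)
  (P : probability T R)
  (K : nat) (lam Pw Bb alpha : 'I_K -> R) (Mant : 'I_K -> nat)
  (lam_u eps W : R) (k : 'I_K)
  (hlam : forall j, 0 < lam j) (hlam_u : 0 < lam_u)
  (hPw : forall j, 0 < Pw j) (hBb : forall j, 0 < Bb j)
  (halpha : forall j, 2 < alpha j) (hMant : forall j, (0 < Mant j)%N)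
  (heps : 0 < eps) (hW : 0 <= W)
  (X H : T -> R) (N : 'I_K -> T -> {measure set ((R * R) * R)%type -> \bar R})
  (* serving distance X_k : density on (0, R_k] *)
  (hXm : measurable_fun setT X)
  (hXlaw : forall A : set R, measurable A ->
     P (X @^-1` A) =
     (\int[@lebesgue_measure R]_(x in A `&` Ioc0 (Rad Pw Bb alpha Mant eps k))
        (serv_dens lam Pw Bb alpha Mant eps k x)%:E)%E)
  (* signal gain ||h||^2 ~ Gamma(M_k, 1) *)
  (hHm : measurable_fun setT H)
  (hHlaw : forall A : set R, measurable A ->
     P (H @^-1` A) =
     (\int[@lebesgue_measure R]_(h in A `&` Ioo0inf)
        (h ^+ (Mant k).-1 * expR (- h) / ((Mant k).-1)`!%:R)%:E)%E)
  (* active tier-j BSs: homogeneous PPP of intensity A_j lam_j, Exp(1) marks *)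
  (hN : forall j, is_PPP P (N j)
          (marked_mean (Aact lam Pw Bb alpha Mant lam_u eps j * lam j)))
  (* X, H, N_1, ..., N_K are mutually independent *)
  (hind : mutually_indep P (fun o : option (option 'I_K) =>
            match o with
            | None => events_of_real X
            | Some None => events_of_real H
            | Some (Some j) => events_of_pp (N j)
            end)) :
  avg_rate Pw Bb alpha Mant P W k X H N =
  rate_formula lam Pw Bb alpha Mant lam_u eps W k.
Proof.
exact: (avg_rate_formula hlam hlam_u).
Qed.
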